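(* Let $b>0$ and $z>0$ be fixed real numbers and let $$G(\nu)=\frac{\Phi(\nu+1,b+1,z)}{\nu\,\Phi(\nu,b,z)} .$$ Let $0>\nu_1^*>\nu_2^*>\cdots$ be the zeros of $\nu\mapsto\Phi(\nu,b,z)$. Then for $u>0$ the inverse Laplace transform of $G$ is given by the residue expansion $$\mathcal{L}^{-1}\{G(\nu)\}(u)=\lim_{\gamma\to\infty}\frac{1}{2\pi i}\int_{\varepsilon-i\gamma}^{\varepsilon+i\gamma}e^{\nu u}G(\nu)\,d\nu=\mathrm{Res}(e^{\nu u}G,0)+\sum_{k=1}^{\infty}\mathrm{Res}(e^{\nu u}G,\nu_k^* ),$$ where $\varepsilon>0$ is an arbitrarily small number and $\mathrm{Res}(e^{\nu u}G,p)$ is the residue of $\nu\mapsto e^{\nu u}G(\nu)$ at $p$.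
   Context: The confluent hypergeometric function is $\Phi(a,b,z)=\sum_{n=0}^{\infty}\frac{(a)_n}{(b)_n\,n!}z^n$, where $(a)_0=1$ and $(a)_n=a(a+1)\cdots(a+n-1)$. For fixed $b,z>0$ it is an entire function of $a$ whose zeros are all real, simple and negative, and form an infinite sequence tending to $-\infty$. Hence $G$ has a simple pole at $\nu=0$ and its other poles are at the zeros $\nu_k^*$. *)

(* Defs.v *)
(* Real and complex analysis over Stdlib's [R], with Coquelicot. *)
From Stdlib Require Import Reals Factorial.
From Coquelicot Require Import Coquelicot.

Open Scope R_scope.

(* Sum of a complex series, taken on real and imaginary parts because
   Coquelicot's total operator [Series] is real-valued. *)
Definition CSeries (a : nat -> C) : C :=
  (Series (fun n => Re (a n)), Series (fun n => Im (a n))).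

Definition Cexp (w : C) : C :=
  (exp (Re w) * cos (Im w), exp (Re w) * sin (Im w)).

(* Rising factorial (a)_n = a (a + 1) ... (a + n - 1). *)
Fixpoint Cpoch (a : C) (n : nat) : C :=
  match n with
  | O => RtoC 1
  | S m => (Cpoch a m * (a + RtoC (INR m)))%C
  end.

Definition Phi (a b z : C) : C :=
  CSeries (fun n =>
    (Cpoch a n / (Cpoch b n * RtoC (INR (fact n))) * Cpow z n)%C).

(* Division by zero is total in [C]: the value at a pole is meaningless, and
   nothing below depends on it. *)
Definition G (b z : R) (v : C) : C :=
  (Phi (v + RtoC 1) (RtoC b + RtoC 1) (RtoC z)
   / (v * Phi v (RtoC b) (RtoC z)))%C.

Definition is_segment_int (f : C -> C) (p q I : C) : Prop :=
  is_RInt (V := C_R_NormedModule)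
    (fun t : R => (f (p + RtoC t * (q - p)) * (q - p))%C) 0 1 I.

(* Contour integral of [f] over the positively oriented circle
   t |-> p + r e^{it}, 0 <= t <= 2 pi. *)
Definition is_circle_int (f : C -> C) (p : C) (r : R) (I : C) : Prop :=
  is_RInt (V := C_R_NormedModule)
    (fun t : R => (f (p + RtoC r * Cexp (Ci * RtoC t))
                   * (Ci * (RtoC r * Cexp (Ci * RtoC t))))%C)
    0 (2 * PI) I.

(* [c] is the residue at [p] of a function [f] holomorphic on a punctured disc
   around [p]: (1 / 2 pi i) times its integral over every small circle.
   The value of [f] at [p] itself is irrelevant. *)
Definition is_residue (f : C -> C) (p c : C) : Prop :=
  exists r0 : R, 0 < r0 /\
    (forall w : C, 0 < Cmod (w - p) < r0 ->
       ex_derive (K := C_AbsRing) (V := C_NormedModule) f w) /\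
    (forall r : R, 0 < r < r0 ->
       is_circle_int f p r (RtoC (2 * PI) * Ci * c)%C).

(* Bromwich formula: [L] is the limit, as gam -> +oo, of
   (1 / 2 pi i) times the integral of e^{v u} F(v) over the segment
   from eps - i gam to eps + i gam. *)
Definition is_inverse_laplace (F : C -> C) (eps u : R) (L : C) : Prop :=
  exists J : R -> C,
    (forall gam : R, 0 < gam ->
       is_segment_int (fun v : C => (Cexp (v * RtoC u) * F v)%C)
         (RtoC eps - Ci * RtoC gam)%C (RtoC eps + Ci * RtoC gam)%C (J gam)) /\
    filterlim (fun gam : R => (/ (RtoC (2 * PI) * Ci) * J gam)%C)
      (Rbar_locally p_infty) (locally (T := C_UniformSpace) L).

(* [nu k] is the (k+1)-st zero of v |-> Phi(v, b, z): the zeros in the complex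
   plane are exactly the terms of a strictly decreasing sequence of negative
   reals. *)
Definition zeros_of_Phi (b z : R) (nu : nat -> R) : Prop :=
  nu O < 0 /\
  (forall k : nat, nu (S k) < nu k) /\
  (forall w : C, Phi w (RtoC b) (RtoC z) = RtoC 0 <->
                 exists k : nat, w = RtoC (nu k)).

(* Main.v *)
(* Write y_v(x) = Phi(v, b, x), p(x) = x^b e^(-x), w = p / x. Kummer's equation reads
   (p y_v')' = v w y_v, and y_v'(z) = (v / b) Phi(v + 1, b + 1, z), so that G is
   (b / p(z)) (1 / v) times H(v) = p(z) y_v'(z) / (v y_v(z)). The functions y_(nu k) are
   orthogonal for w on (0, z); Bessel's inequality for y_v says exactly that, for
   K_N(v) = H(v) - sum_(k < N) d_k / (nu_k (nu_k - v)), obtained from H by removing its first N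
   poles, Im (v K_N(v)) Im v >= 0. On a circle of radius R between |nu_(N-1)|
   and |nu_N| this sign and the mean value property give the Harnack-type bound
   |K_N(w) - K_N(0)| <= 20 |w| K_N(0) / R. Since 0 <= K_N(0) <= H(0) and H(x) -> 0 as x -> +oo,
   K_N -> 0 pointwise: H = sum_k d_k / (nu_k (nu_k - v)) with sum_k d_k / nu_k^2 = H(0) finite.
   Hence G is an absolutely convergent combination of 1 / v - 1 / (v - nu_k), and the
   Bromwich integral of 1 / (v - a) is e^(a u) + O(1 / gamma) uniformly in a <= 0: deform the
   vertical segment to the right half of a circle around the pole. *)
Require Import Defs.
From Stdlib Require Import Reals Lra Lia Psatz List Factorial.
From Coquelicot Require Import Coquelicot.

Open Scope R_scope.

(* Coquelicot's structures hide the carrier [C] from [ring] and [field]. *)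
Ltac Ceq_type := match goal with |- ?a = ?b => change (@eq C a b) end.

(** Closing the contour to the left would call for lower bounds for [Phi] on arcs between zeros of
    which only the order is given. Positivity takes their place: on a circle, Im (v K) sin t is a
    non-negative density whose mass is proportional to K(0), so K inside is controlled by K(0)
    alone, however large K is on the circle, and the radius may tend to infinity. Decay enters at a
    single real point X, where the power series of y_X has positive coefficients: K_N(0) is compared
    with K_N(X) <= H(X). The Bromwich integral of one fraction converges only conditionally, so sum
    and limit are exchanged through the error terms: each is at most a constant over gamma, and the
    coefficients are summable. For fixed gamma the remainder vanishes uniformly on the vertical
    line, because in the right half plane every term of the tail is dominated by its value at 0.
    Derivatives in the parameter are treated as divided differences with coinciding nodes allowed,
    which keeps Green's identities and the removable singularities algebraic. *)

(** * Modulus and neighbourhoods in the complex plane *)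

Lemma C_ext (x y : C) : Re x = Re y -> Im x = Im y -> x = y.
Proof. destruct x, y; simpl; congruence. Qed.

Lemma Rabs_Re_le (x : C) : Rabs (Re x) <= Cmod x.
Proof. generalize (Rmax_Cmod x) (Rmax_l (Rabs (fst x)) (Rabs (snd x))). unfold Re; lra. Qed.

Lemma Rabs_Im_le (x : C) : Rabs (Im x) <= Cmod x.
Proof. generalize (Rmax_Cmod x) (Rmax_r (Rabs (fst x)) (Rabs (snd x))). unfold Im; lra. Qed.

Lemma Cmod_le_abs (x : C) : Cmod x <= Rabs (Re x) + Rabs (Im x).
Proof.
  unfold Cmod. apply Rsqr_incr_0_var.
  - rewrite Rsqr_sqrt by nra. unfold Re, Im, Rsqr.
    generalize (Rabs_pos (fst x)) (Rabs_pos (snd x)) (pow2_abs (fst x)) (pow2_abs (snd x)). simpl; nra.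
  - generalize (Rabs_pos (Re x)) (Rabs_pos (Im x)). lra.
Qed.

Lemma Cmod_sqr (x : C) : Cmod x * Cmod x = Re x * Re x + Im x * Im x.
Proof. unfold Cmod, Re, Im. rewrite sqrt_sqrt by nra. simpl. ring. Qed.

Lemma Cmod_Ci : Cmod Ci = 1.
Proof. unfold Cmod; simpl. replace (0 * (0 * 1) + 1 * (1 * 1)) with 1 by ring. apply sqrt_1. Qed.

Lemma Cmod_sub_sym (x y : C) : Cmod (x - y) = Cmod (y - x).
Proof. rewrite <- Cmod_opp. f_equal. ring. Qed.

Lemma Cmod_triangle_sub (x y z : C) : Cmod (x - z) <= Cmod (x - y) + Cmod (y - z).
Proof. replace (x - z)%C with ((x - y) + (y - z))%C by ring. apply Cmod_triangle. Qed.

Lemma Cmod_ge_sub (x y : C) : Cmod x - Cmod y <= Cmod (x - y).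
Proof. generalize (Cmod_triangle (x - y) y). replace (x - y + y)%C with x by ring. lra. Qed.

Lemma Cmult_eq_0 (x y : C) : (x * y)%C = 0%R -> x = RtoC 0 \/ y = RtoC 0.
Proof.
  intros H. destruct (Req_EM_T (Cmod x) 0) as [E|E]; [left; now apply Cmod_eq_0|].
  right. apply Cmod_eq_0. apply Rmult_eq_reg_l with (Cmod x); auto.
  rewrite <- Cmod_mult, H, Cmod_0. ring.
Qed.

Lemma C_eq_dec (x y : C) : {x = y} + {x <> y}.
Proof.
  destruct x as [a b], y as [c d].
  destruct (Req_EM_T a c), (Req_EM_T b d); subst; auto; right; congruence.
Qed.

(** The uniform structure on [C] is that of a product, so its balls are squares. All later estimates
    pass through this comparison with discs of the modulus. *)
Lemma locally_Cmod (w : C) (P : C -> Prop) :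
  locally (T := C_UniformSpace) w P <->
  exists d : R, 0 < d /\ forall v, Cmod (v - w) < d -> P v.
Proof.
  split.
  - intros [d Hd]. exists d; split; [apply cond_pos|]. intros v Hv. apply Hd.
    split; change (Rabs (fst v - fst w) < d) || change (Rabs (snd v - snd w) < d).
    + apply Rle_lt_trans with (2 := Hv). apply (Rabs_Re_le (v - w)).
    + apply Rle_lt_trans with (2 := Hv). apply (Rabs_Im_le (v - w)).
  - intros [d [Hd H]].
    exists (mkposreal (d / 2) (ltac:(lra))). intros v [H1 H2]. apply H.
    change (Rabs (fst v - fst w) < d/2) in H1. change (Rabs (snd v - snd w) < d/2) in H2.
    apply Rle_lt_trans with (1 := Cmod_le_abs _). unfold Re, Im; simpl. unfold Rminus in *; lra.
Qed.

(** * Continuity of complex-valued functions *)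

Notation Ccont f x := (continuous (U := C_UniformSpace) f x).

Section Cont.
Context {T : UniformSpace}.
Implicit Types (f g : T -> C) (x : T).

Lemma Ccont_pair f x :
  continuous (fun t => Re (f t)) x -> continuous (fun t => Im (f t)) x -> Ccont f x.
Proof.
  intros H1 H2. apply continuous_ext with (fun t => (Re (f t), Im (f t))).
  - intros t. now destruct (f t).
  - intros P [e He].
    destruct (H1 (ball (Re (f x)) e) (locally_ball _ e)) as [d1 D1].
    destruct (H2 (ball (Im (f x)) e) (locally_ball _ e)) as [d2 D2].
    exists (mkposreal _ (Rmin_stable_in_posreal d1 d2)). intros y Hy. apply He. split.
    + apply D1. apply ball_le with (2 := Hy). apply Rmin_l.
    + apply D2. apply ball_le with (2 := Hy). apply Rmin_r.
Qed.

Lemma continuous_Re f x : Ccont f x -> continuous (fun t => Re (f t)) x.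
Proof. intros H. apply (continuous_comp f (fun z : C_UniformSpace => fst z) x H).
  apply (continuous_fst (U := R_UniformSpace) (V := R_UniformSpace)). Qed.
Lemma continuous_Im f x : Ccont f x -> continuous (fun t => Im (f t)) x.
Proof. intros H. apply (continuous_comp f (fun z : C_UniformSpace => snd z) x H).
  apply (continuous_snd (U := R_UniformSpace) (V := R_UniformSpace)). Qed.

Lemma Ccont_const (c : C) x : Ccont (fun _ => c) x.
Proof. apply continuous_const. Qed.

Lemma Ccont_plus f g x : Ccont f x -> Ccont g x -> Ccont (fun t => f t + g t)%C x.
Proof.
  intros Hf Hg. apply Ccont_pair; simpl.
  - apply (continuous_plus (V := R_NormedModule) (fun t => Re (f t)) (fun t => Re (g t))); now apply continuous_Re.
  - apply (continuous_plus (V := R_NormedModule) (fun t => Im (f t)) (fun t => Im (g t))); now apply continuous_Im.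
Qed.

Lemma Ccont_opp f x : Ccont f x -> Ccont (fun t => - f t)%C x.
Proof.
  intros Hf. apply Ccont_pair; simpl.
  - apply (continuous_opp (V := R_NormedModule) (fun t => Re (f t))); now apply continuous_Re.
  - apply (continuous_opp (V := R_NormedModule) (fun t => Im (f t))); now apply continuous_Im.
Qed.

Lemma Ccont_minus f g x : Ccont f x -> Ccont g x -> Ccont (fun t => f t - g t)%C x.
Proof. intros Hf Hg. apply Ccont_plus; auto. now apply Ccont_opp. Qed.

Lemma Ccont_mult f g x : Ccont f x -> Ccont g x -> Ccont (fun t => f t * g t)%C x.
Proof.
  intros Hf Hg. assert (H1 := continuous_Re _ _ Hf). assert (H2 := continuous_Im _ _ Hf).
  assert (H3 := continuous_Re _ _ Hg). assert (H4 := continuous_Im _ _ Hg).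
  apply Ccont_pair; simpl.
  - apply (continuous_minus (V := R_NormedModule) (fun t => Re (f t) * Re (g t)) (fun t => Im (f t) * Im (g t)));
    apply (continuous_mult (K := R_AbsRing)); auto.
  - apply (continuous_plus (V := R_NormedModule) (fun t => Re (f t) * Im (g t)) (fun t => Im (f t) * Re (g t)));
    apply (continuous_mult (K := R_AbsRing)); auto.
Qed.

Lemma Ccont_RtoC (r : T -> R) x : continuous r x -> Ccont (fun t => RtoC (r t)) x.
Proof. intros H. apply Ccont_pair; simpl; auto. apply continuous_const. Qed.

Lemma Ccont_inv f x : Ccont f x -> f x <> RtoC 0 -> Ccont (fun t => / f t)%C x.
Proof.
  intros Hf H0. assert (H1 := continuous_Re _ _ Hf). assert (H2 := continuous_Im _ _ Hf).
  assert (Hn : Re (f x) * Re (f x) + Im (f x) * Im (f x) <> 0).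
  { rewrite <- Cmod_sqr. apply Cmod_gt_0 in H0. nra. }
  assert (Hc : continuous (fun t => / (Re (f t) * Re (f t) + Im (f t) * Im (f t))) x).
  { apply (continuous_comp (fun t => Re (f t) * Re (f t) + Im (f t) * Im (f t)) Rinv).
    - apply (continuous_plus (V := R_NormedModule) (fun t => Re (f t) * Re (f t)) (fun t => Im (f t) * Im (f t)));
      apply (continuous_mult (K := R_AbsRing)); auto.
    - now apply continuous_Rinv. }
  apply continuous_ext with (fun t => RtoC (/ (Re (f t) * Re (f t) + Im (f t) * Im (f t))) * (RtoC (Re (f t)) - Ci * RtoC (Im (f t))))%C.
  - intros t. apply C_ext; unfold Cinv, Re, Im, Rdiv; simpl; rewrite !Rmult_1_r; ring.
  - apply Ccont_mult. now apply Ccont_RtoC.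
    apply Ccont_minus. now apply Ccont_RtoC. apply Ccont_mult. apply Ccont_const. now apply Ccont_RtoC.
Qed.

Lemma Ccont_div f g x : Ccont f x -> Ccont g x -> g x <> RtoC 0 -> Ccont (fun t => f t / g t)%C x.
Proof. intros. apply Ccont_mult; auto. now apply Ccont_inv. Qed.

Lemma Ccont_eps f x : Ccont f x <->
  (forall e, 0 < e -> locally x (fun y => Cmod (f y - f x) < e)).
Proof.
  split.
  - intros H e He. apply (H (fun y => Cmod (y - f x) < e)).
    apply locally_Cmod. exists e; auto.
  - intros H P HP. apply locally_Cmod in HP. destruct HP as [d [Hd HP]].
    destruct (H d Hd) as [e He]. exists e. intros y Hy. apply HP. now apply He.
Qed.

Lemma Ccont_neq0 f x : Ccont f x -> f x <> RtoC 0 -> locally x (fun y => f y <> RtoC 0).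
Proof.
  intros H H0. assert (Hp := proj1 (Cmod_gt_0 _) H0).
  destruct (proj1 (Ccont_eps f x) H _ Hp) as [e He]. exists e. intros y Hy E.
  specialize (He y Hy). simpl in He. rewrite E, Cmod_sub_sym in He.
  replace (f x - 0)%C with (f x) in He by ring. lra.
Qed.

End Cont.

Lemma Ccont_id (x : C) : Ccont (fun t : C_UniformSpace => t) x.
Proof. apply continuous_id. Qed.

(** * Strict complex differentiability *)

Definition CC := prod_UniformSpace C_UniformSpace C_UniformSpace.

(* Carathéodory form of strict differentiability: it makes the algebraic closure
   properties immediate, and at every point of an open set it amounts to being
   holomorphic with continuous derivative there. *)
Definition sder (f : C -> C) (w l : C) : Prop :=
  exists D : CC -> C, Ccont D ((w, w) : CC) /\ D (w, w) = l /\
    locally ((w, w) : CC) (fun p => f (fst p) - f (snd p) = (fst p - snd p) * D p)%C.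

Definition shol (f : C -> C) (w : C) : Prop := exists l, sder f w l.

Lemma locally_CC (w : C) (P : C * C -> Prop) :
  locally ((w, w) : CC) P <->
  exists d : R, 0 < d /\ forall v v', Cmod (v - w) < d -> Cmod (v' - w) < d -> P (v, v').
Proof.
  split.
  - intros [e He].
    destruct (proj1 (locally_Cmod w _) (locally_ball (T := C_UniformSpace) w e)) as [d [Hd H]].
    exists d; split; auto. intros v v' Hv Hv'. apply He. split; simpl; auto.
  - intros [d [Hd H]].
    destruct (proj2 (locally_Cmod w (fun v => Cmod (v - w) < d))) as [e He].
    { exists d; auto. }
    exists e. intros [v v'] [H1 H2]. simpl in *. apply H; auto.
Qed.

Lemma sder_bound (f : C -> C) (w l : C) : sder f w l ->
  forall e, 0 < e -> exists d, 0 < d /\ forall v v', Cmod (v - w) < d -> Cmod (v' - w) < d ->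
    Cmod (f v - f v' - l * (v - v')) <= e * Cmod (v - v').
Proof.
  intros [D [HD [Hl H]]] e He.
  assert (HH := filter_and _ _ H (proj1 (Ccont_eps _ _) HD e He)).
  apply locally_CC in HH. destruct HH as [d [Hd HH]]. exists d; split; auto.
  intros v v' Hv Hv'. destruct (HH v v' Hv Hv') as [E1 E2]. simpl in *. rewrite Hl in E2.
  rewrite E1. replace ((v - v') * D (v, v') - l * (v - v'))%C with ((D (v, v') - l) * (v - v'))%C by ring.
  rewrite Cmod_mult. apply Rmult_le_compat_r. apply Cmod_ge_0. lra.
Qed.

(** The witness is the difference quotient, filled with [l] on the diagonal; the two-point bound is
    exactly its continuity at [(w, w)]. *)
Lemma sder_of_bound (f : C -> C) (w l : C) :
  (forall e, 0 < e -> exists d, 0 < d /\ forall v v', Cmod (v - w) < d -> Cmod (v' - w) < d ->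
    Cmod (f v - f v' - l * (v - v')) <= e * Cmod (v - v')) -> sder f w l.
Proof.
  intros H.
  exists (fun p => if C_eq_dec (fst p) (snd p) then l else ((f (fst p) - f (snd p)) / (fst p - snd p))%C).
  simpl. split; [|split].
  - apply Ccont_eps. intros e He. destruct (H (e/2)) as [d [Hd Hb]]; [lra|].
    apply locally_CC. exists d; split; auto. intros v v' Hv Hv'. simpl.
    destruct (C_eq_dec w w) as [_|]; [|tauto].
    destruct (C_eq_dec v v') as [E|E].
    + replace (l - l)%C with (RtoC 0) by ring. rewrite Cmod_0; lra.
    + assert (Hn : (v - v' <> 0)%C). { intros E'. apply E. replace v with (v - v' + v')%C by ring. rewrite E'; ring. }
      assert (Hp := proj1 (Cmod_gt_0 _) Hn).
      specialize (Hb v v' Hv Hv').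
      replace ((f v - f v') / (v - v') - l)%C with ((f v - f v' - l * (v - v')) / (v - v'))%C by (field; auto).
      rewrite Cmod_div by auto. apply Rle_lt_trans with (e/2); [|lra].
      apply Rmult_le_reg_r with (Cmod (v - v')); auto. unfold Rdiv at 1. rewrite Rmult_assoc, Rinv_l by lra. lra.
  - destruct (C_eq_dec w w); tauto.
  - apply filter_forall. intros [v v']; simpl. destruct (C_eq_dec v v') as [->|E]; [ring|].
    field. intros E'. apply E. replace v with (v - v' + v')%C by ring. rewrite E'; ring.
Qed.

Lemma sder_cont f w l : sder f w l -> Ccont f w.
Proof.
  intros H. apply Ccont_eps. intros e He.
  destruct (sder_bound _ _ _ H 1 Rlt_0_1) as [d [Hd Hb]].
  apply locally_Cmod. set (K := 1 + Cmod l). assert (HK : 0 < K) by (unfold K; generalize (Cmod_ge_0 l); lra).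
  exists (Rmin d (e / K)). split. { apply Rmin_glb_lt; auto. now apply Rdiv_lt_0_compat. }
  intros v Hv. specialize (Hb v w). assert (H1 := Rmin_l d (e/K)). assert (H2 := Rmin_r d (e/K)).
  assert (E : Cmod (w - w) < d). { replace (w - w)%C with (RtoC 0) by ring. now rewrite Cmod_0. }
  specialize (Hb ltac:(lra) E).
  assert (Cmod (f v - f w) <= K * Cmod (v - w)).
  { replace (f v - f w)%C with (f v - f w - l * (v - w) + l * (v - w))%C by ring.
    eapply Rle_trans. apply Cmod_triangle. rewrite Cmod_mult. unfold K. lra. }
  apply Rle_lt_trans with (1 := H0). replace e with (K * (e/K)) by (field; lra).
  apply Rmult_lt_compat_l; lra.
Qed.

Lemma Ccont_comp {T : UniformSpace} (h : T -> C) (f : C -> C) (x : T) :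
  Ccont h x -> Ccont f (h x) -> Ccont (fun t => f (h t)) x.
Proof. intros. now apply (continuous_comp (V := C_UniformSpace) h f). Qed.

Lemma Ccont_fst (w : CC) : Ccont (fun p : CC => fst p) w.
Proof. destruct w. apply (continuous_fst (U := C_UniformSpace) (V := C_UniformSpace)). Qed.
Lemma Ccont_snd (w : CC) : Ccont (fun p : CC => snd p) w.
Proof. destruct w. apply (continuous_snd (U := C_UniformSpace) (V := C_UniformSpace)). Qed.

Lemma sder_const (c w : C) : sder (fun _ => c) w 0.
Proof.
  exists (fun _ => RtoC 0). split; [|split]; auto. apply Ccont_const.
  apply filter_forall. intros; ring.
Qed.

Lemma sder_id (w : C) : sder (fun v => v) w 1.
Proof.
  exists (fun _ => RtoC 1). split; [|split]; auto. apply Ccont_const.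
  apply filter_forall. intros; ring.
Qed.

Lemma sder_plus f g w l m : sder f w l -> sder g w m -> sder (fun v => f v + g v)%C w (l + m)%C.
Proof.
  intros [D [HD [Hl H]]] [D' [HD' [Hl' H']]].
  exists (fun p => D p + D' p)%C. split; [|split].
  - now apply Ccont_plus.
  - congruence.
  - generalize (filter_and _ _ H H'). apply filter_imp. intros p [E E'].
    replace (f (fst p) + g (fst p) - (f (snd p) + g (snd p)))%C with
      ((f (fst p) - f (snd p)) + (g (fst p) - g (snd p)))%C by ring. rewrite E, E'; ring.
Qed.

Lemma sder_mult f g w l m : sder f w l -> sder g w m ->
  sder (fun v => f v * g v)%C w (l * g w + f w * m)%C.
Proof.
  intros Hf Hg. assert (Cf := sder_cont _ _ _ Hf). assert (Cg := sder_cont _ _ _ Hg).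
  destruct Hf as [D [HD [Hl H]]]. destruct Hg as [D' [HD' [Hl' H']]].
  exists (fun p => D p * g (fst p) + f (snd p) * D' p)%C. split; [|split].
  - apply Ccont_plus; apply Ccont_mult; auto.
    + apply (Ccont_comp (T := CC)); auto. apply Ccont_fst.
    + apply (Ccont_comp (T := CC)); auto. apply Ccont_snd.
  - simpl. congruence.
  - generalize (filter_and _ _ H H'). apply filter_imp. intros p [E E'].
    replace (f (fst p) * g (fst p) - (f (snd p) * g (snd p)))%C with
      ((f (fst p) - f (snd p)) * g (fst p) + f (snd p) * (g (fst p) - g (snd p)))%C by ring. rewrite E, E'; ring.
Qed.

Lemma sder_inv f w l : sder f w l -> f w <> RtoC 0 ->
  sder (fun v => / f v)%C w (- l / (f w * f w))%C.
Proof.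
  intros Hf H0. assert (Cf := sder_cont _ _ _ Hf).
  destruct Hf as [D [HD [Hl H]]].
  assert (C1 : Ccont (fun p : CC => f (fst p)) ((w,w):CC)) by (apply (Ccont_comp (T := CC)); auto; apply Ccont_fst).
  assert (C2 : Ccont (fun p : CC => f (snd p)) ((w,w):CC)) by (apply (Ccont_comp (T := CC)); auto; apply Ccont_snd).
  exists (fun p => - D p / (f (fst p) * f (snd p)))%C. split; [|split].
  - apply Ccont_div. now apply Ccont_opp. now apply Ccont_mult. simpl. now apply Cmult_neq_0.
  - simpl. congruence.
  - generalize (filter_and _ _ H (filter_and _ _ (Ccont_neq0 _ _ C1 H0) (Ccont_neq0 _ _ C2 H0))).
    apply filter_imp. intros p [E [E1 E2]].
    replace (/ f (fst p) - / f (snd p))%C with (- (f (fst p) - f (snd p)) / (f (fst p) * f (snd p)))%C by (field; auto).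
    rewrite E. field; auto.
Qed.

Lemma sder_comp f g w l m : sder f w l -> sder g (f w) m -> sder (fun v => g (f v)) w (m * l)%C.
Proof.
  intros Hf Hg. assert (Cf := sder_cont _ _ _ Hf).
  destruct Hf as [D [HD [Hl H]]]. destruct Hg as [D' [HD' [Hl' H']]].
  set (k := fun p : CC => (f (fst p), f (snd p)) : CC).
  assert (Ck : continuous k ((w,w):CC)).
  { intros P HP. apply locally_CC in HP. destruct HP as [d [Hd HP]].
    assert (HH := proj1 (Ccont_eps _ _) Cf d Hd). apply locally_Cmod in HH.
    destruct HH as [e [He HH]]. apply locally_CC. exists e; split; auto.
    intros v v' Hv Hv'. apply HP; auto. }
  exists (fun p => D' (k p) * D p)%C. split; [|split].
  - apply Ccont_mult; auto. apply (continuous_comp (U := CC) (V := CC) k D'); auto.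
  - unfold k; simpl. congruence.
  - assert (HH := Ck _ H'). generalize (filter_and _ _ H HH). apply filter_imp.
    intros p [E E'].
    change (g (f (fst p)) - g (f (snd p)) = (f (fst p) - f (snd p)) * D' (k p))%C in E'.
    rewrite E', E. ring.
Qed.

Lemma sder_ext_loc f g w l : locally (T := C_UniformSpace) w (fun v => f v = g v) -> sder f w l -> sder g w l.
Proof.
  intros HE [D [HD [Hl H]]]. exists D. split; [|split]; auto.
  apply locally_Cmod in HE. destruct HE as [d [Hd HE]].
  assert (HE2 : locally ((w,w):CC) (fun p => f (fst p) = g (fst p) /\ f (snd p) = g (snd p))).
  { apply locally_CC. exists d; split; auto. }
  generalize (filter_and _ _ H HE2). apply filter_imp. intros p [E [E1 E2]]. now rewrite <- E1, <- E2.
Qed.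

Lemma shol_cont f w : shol f w -> Ccont f w.
Proof. intros [l H]. eapply sder_cont; eauto. Qed.
Lemma shol_const (c w : C) : shol (fun _ => c) w.
Proof. eexists; apply sder_const. Qed.
Lemma shol_id (w : C) : shol (fun v => v) w.
Proof. eexists; apply sder_id. Qed.
Lemma shol_plus f g w : shol f w -> shol g w -> shol (fun v => f v + g v)%C w.
Proof. intros [l H] [m H']. eexists; eapply sder_plus; eauto. Qed.
Lemma shol_mult f g w : shol f w -> shol g w -> shol (fun v => f v * g v)%C w.
Proof. intros [l H] [m H']. eexists; eapply sder_mult; eauto. Qed.
Lemma shol_inv f w : shol f w -> f w <> RtoC 0 -> shol (fun v => / f v)%C w.
Proof. intros [l H] H0. eexists; eapply sder_inv; eauto. Qed.
Lemma shol_div f g w : shol f w -> shol g w -> g w <> RtoC 0 -> shol (fun v => f v / g v)%C w.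
Proof. intros. apply shol_mult; auto. now apply shol_inv. Qed.
Lemma shol_ext_loc f g w : locally (T := C_UniformSpace) w (fun v => f v = g v) -> shol f w -> shol g w.
Proof. intros HE [l H]. exists l. eapply sder_ext_loc; eauto. Qed.
Lemma shol_opp f w : shol f w -> shol (fun v => - f v)%C w.
Proof.
  intros H. apply shol_ext_loc with (fun v => - RtoC 1 * f v)%C.
  - apply filter_forall. intros v. ring.
  - apply shol_mult; auto. apply shol_const.
Qed.
Lemma shol_minus f g w : shol f w -> shol g w -> shol (fun v => f v - g v)%C w.
Proof. intros. apply shol_plus; auto. now apply shol_opp. Qed.
Lemma shol_comp f g w : shol f w -> shol g (f w) -> shol (fun v => g (f v)) w.
Proof. intros [l H] [m H']. eexists; eapply sder_comp; eauto. Qed.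

(** Strict differentiability is the working notion; this is the bridge to the derivative that occurs
    in [is_residue]. *)
Lemma sder_is_derive f w l : sder f w l -> is_derive (K := C_AbsRing) (V := C_NormedModule) f w l.
Proof.
  intros H. split.
  - apply (is_linear_scal_l (K := C_AbsRing) (V := C_NormedModule)).
  - intros x Hx. apply (is_filter_lim_locally_unique (K := C_AbsRing) (V := AbsRing_NormedModule C_AbsRing)) in Hx. subst x. intros e.
    destruct (sder_bound _ _ _ H e (cond_pos e)) as [d [Hd Hb]].
    apply locally_C. apply locally_Cmod. exists d; split; auto. intros v Hv.
    specialize (Hb v w Hv). 
    assert (E : Cmod (w - w) < d). { replace (w - w)%C with (RtoC 0) by ring. now rewrite Cmod_0. }
    specialize (Hb E).
    change (Cmod (f v - f w - (v - w) * l)%C <= e * Cmod (v - w)).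
    replace ((v - w) * l)%C with (l * (v - w))%C by ring. exact Hb.
Qed.

Lemma shol_ex_derive f w : shol f w -> ex_derive (K := C_AbsRing) (V := C_NormedModule) f w.
Proof. intros [l H]. exists l. now apply sder_is_derive. Qed.

(** * The complex exponential *)

Lemma Cexp_add (a b : C) : Cexp (a + b) = (Cexp a * Cexp b)%C.
Proof.
  unfold Cexp, Re, Im; apply C_ext; unfold Re, Im; simpl; rewrite exp_plus;
  [rewrite cos_plus | rewrite sin_plus]; ring.
Qed.

Lemma Cmod_Cexp (a : C) : Cmod (Cexp a) = exp (Re a).
Proof.
  unfold Cexp, Cmod; simpl.
  replace (_ + _) with ((exp (Re a))²).
  - apply sqrt_Rsqr. left; apply exp_pos.
  - unfold Rsqr. generalize (sin2_cos2 (Im a)). unfold Rsqr. intros H.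
    transitivity (exp (Re a) * exp (Re a) * (sin (Im a) * sin (Im a) + cos (Im a) * cos (Im a))).
    rewrite H; ring. ring.
Qed.

Lemma Cexp_0 : Cexp 0 = 1%R.
Proof. unfold Cexp; simpl. rewrite exp_0, cos_0, sin_0. apply C_ext; simpl; ring. Qed.

Lemma Cexp_neq_0 (a : C) : Cexp a <> 0%R.
Proof. apply Cmod_gt_0. rewrite Cmod_Cexp. apply exp_pos. Qed.

Lemma derivable_pt_lim_bound (f : R -> R) (x l : R) : derivable_pt_lim f x l ->
  forall e, 0 < e -> exists d, 0 < d /\ forall h, Rabs h < d ->
    Rabs (f (x + h) - f x - l * h) <= e * Rabs h.
Proof.
  intros H e He. destruct (H e He) as [d Hd]. exists d; split; [apply cond_pos|].
  intros h Hh. destruct (Req_dec h 0) as [->|H0].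
  - replace (f (x + 0) - f x - l * 0) with 0 by (rewrite Rplus_0_r; ring). rewrite Rabs_R0. lra.
  - specialize (Hd h H0 Hh).
    replace (f (x + h) - f x - l * h) with (((f (x + h) - f x) / h - l) * h) by (field; auto).
    rewrite Rabs_mult. apply Rmult_le_compat_r. apply Rabs_pos. lra.
Qed.

Lemma Cexp_first_order e : 0 < e -> exists d, 0 < d /\
  forall h, Cmod h < d -> Cmod (Cexp h - 1 - h) <= e * Cmod h.
Proof.
  (* The real part will cost [3 e' |h|] and the imaginary part [5 e' |h|], whence [e / 8]. The cap 1
     gives [|1 + x| <= 2] and slopes at most 2 for [exp] and [sin] near 0. *)
  intros He. set (e' := Rmin (e / 8) 1).
  assert (He' : 0 < e') by (apply Rmin_glb_lt; lra).
  assert (He1 : e' <= e / 8) by apply Rmin_l. assert (He2 : e' <= 1) by apply Rmin_r.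
  destruct (derivable_pt_lim_bound exp 0 (exp 0) (derivable_pt_lim_exp 0) e' He') as [d1 [Hd1 H1]].
  destruct (derivable_pt_lim_bound cos 0 (- sin 0) (derivable_pt_lim_cos 0) e' He') as [d2 [Hd2 H2]].
  destruct (derivable_pt_lim_bound sin 0 (cos 0) (derivable_pt_lim_sin 0) e' He') as [d3 [Hd3 H3]].
  exists (Rmin (Rmin d1 d2) (Rmin d3 e')). split; [apply Rmin_glb_lt; apply Rmin_glb_lt; auto|].
  intros h Hh.
  assert (A1 := Rmin_l (Rmin d1 d2) (Rmin d3 e')). assert (A2 := Rmin_r (Rmin d1 d2) (Rmin d3 e')).
  assert (A3 := Rmin_l d1 d2). assert (A4 := Rmin_r d1 d2). assert (A5 := Rmin_l d3 e'). assert (A6 := Rmin_r d3 e').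
  assert (Hx := Rabs_Re_le h). assert (Hy := Rabs_Im_le h).
  assert (Kx := H1 (Re h) ltac:(lra)). assert (Ky := H2 (Im h) ltac:(lra)). assert (Kz := H3 (Im h) ltac:(lra)).
  rewrite !Rplus_0_l in *. rewrite exp_0 in Kx. rewrite cos_0, sin_0 in *.
  eapply Rle_trans. apply Cmod_le_abs. unfold Cexp, Re, Im in *; simpl in *.
  set (x := fst h) in *. set (y := snd h) in *. set (m := Cmod h) in *.
  assert (Cx : Rabs (cos y) <= 1). { apply Rabs_le. generalize (COS_bound y). lra. }
  assert (Hm : 0 <= m) by (generalize (Rabs_pos x); lra).
  assert (B1 : Rabs (exp x * cos y - 1 - x) <= 3 * e' * m).
  { replace (exp x * cos y - 1 - x) with ((exp x - 1 - 1 * x) * cos y + (1 + x) * (cos y - 1 - - 0 * y)) by ring.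
    eapply Rle_trans. apply Rabs_triang. rewrite !Rabs_mult.
    assert (Rabs (1 + x) <= 2). { apply Rabs_le. assert (Rabs x <= 1) by lra. apply Rabs_le_between in H. lra. }
    generalize (Rabs_pos (exp x - 1 - 1 * x)) (Rabs_pos (cos y)) (Rabs_pos (1 + x)) (Rabs_pos (cos y - 1 - - 0 * y)).
    intros. assert (e' * Rabs x <= e' * m) by (apply Rmult_le_compat_l; lra).
    assert (e' * Rabs y <= e' * m) by (apply Rmult_le_compat_l; lra).
    assert (Rabs (exp x - 1 - 1 * x) * Rabs (cos y) <= e' * m * 1) by (apply Rmult_le_compat; lra).
    assert (Rabs (1 + x) * Rabs (cos y - 1 - - 0 * y) <= 2 * (e' * m)) by (apply Rmult_le_compat; lra). lra. }
  assert (B2 : Rabs (exp x * sin y - 0 - y) <= 5 * e' * m).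
  { replace (exp x * sin y - 0 - y) with ((exp x - 1) * sin y + (sin y - 0 - 1 * y)) by ring.
    eapply Rle_trans. apply Rabs_triang. rewrite !Rabs_mult.
    assert (E1 : Rabs (exp x - 1) <= 2 * Rabs x).
    { replace (exp x - 1) with (exp x - 1 - 1 * x + x) by ring. eapply Rle_trans. apply Rabs_triang.
      generalize (Rabs_pos x); nra. }
    assert (E2 : Rabs (sin y) <= 2 * Rabs y).
    { replace (sin y) with (sin y - 0 - 1 * y + y) by ring. eapply Rle_trans. apply Rabs_triang.
      generalize (Rabs_pos y); nra. }
    generalize (Rabs_pos (exp x - 1)) (Rabs_pos (sin y)); intros.
    assert (Rabs (exp x - 1) * Rabs (sin y) <= (2 * e') * (2 * m)) by (apply Rmult_le_compat; lra).
    assert (e' * Rabs y <= e' * m) by (apply Rmult_le_compat_l; lra). lra. }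
  replace (exp x * cos y + - (1) + - x) with (exp x * cos y - 1 - x) by ring.
  replace (exp x * sin y + - 0 + - y) with (exp x * sin y - 0 - y) by ring.
  assert (8 * e' * m <= e * m) by (apply Rmult_le_compat_r; lra). lra.
Qed.

Lemma Ccont_Cexp (w : C) : Ccont Cexp w.
Proof.
  assert (H1 := continuous_Re (T := C_UniformSpace) _ w (Ccont_id w)).
  assert (H2 := continuous_Im (T := C_UniformSpace) _ w (Ccont_id w)).
  assert (He : continuous (fun t : C_UniformSpace => exp (Re t)) w).
  { apply (continuous_comp (U := C_UniformSpace) (fun t => Re t) exp); auto. apply continuous_exp. }
  apply Ccont_pair; simpl.
  - apply (continuous_mult (K := R_AbsRing) (fun t => exp (Re t)) (fun t => cos (Im t))); auto.
    apply (continuous_comp (U := C_UniformSpace) (fun t => Im t) cos); auto. apply continuous_cos.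
  - apply (continuous_mult (K := R_AbsRing) (fun t => exp (Re t)) (fun t => sin (Im t))); auto.
    apply (continuous_comp (U := C_UniformSpace) (fun t => Im t) sin); auto. apply continuous_sin.
Qed.

(** The addition theorem moves the expansion at 0 to the point [v'], and continuity then exchanges
    the slope [Cexp v'] for [Cexp w]. *)
Lemma sder_Cexp (w : C) : sder Cexp w (Cexp w).
Proof.
  apply sder_of_bound. intros e He. set (K := Cmod (Cexp w) + 1).
  assert (HK : 0 < K) by (unfold K; generalize (Cmod_ge_0 (Cexp w)); lra).
  destruct (Cexp_first_order (e / (2 * K))) as [d [Hd H]]. { apply Rdiv_lt_0_compat; lra. }
  set (e1 := Rmin (e / 2) 1). assert (He1 : 0 < e1) by (apply Rmin_glb_lt; lra).
  assert (A1 := Rmin_l (e/2) 1). assert (A2 := Rmin_r (e/2) 1). fold e1 in A1, A2.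
  destruct (proj1 (locally_Cmod _ _) (proj1 (Ccont_eps _ _) (Ccont_Cexp w) e1 He1)) as [d' [Hd' H']].
  exists (Rmin (d/2) d'). split; [apply Rmin_glb_lt; lra|]. intros v v' Hv Hv'.
  assert (B1 := Rmin_l (d/2) d'). assert (B2 := Rmin_r (d/2) d').
  replace (Cexp v - Cexp v' - Cexp w * (v - v'))%C with
    (Cexp v' * (Cexp (v - v') - 1 - (v - v')) + (Cexp v' - Cexp w) * (v - v'))%C.
  2:{ replace (Cexp v) with (Cexp v' * Cexp (v - v'))%C. ring. rewrite <- Cexp_add. f_equal. ring. }
  eapply Rle_trans. apply Cmod_triangle. rewrite !Cmod_mult.
  assert (Hc := H' v' ltac:(lra)).
  assert (Hb : Cmod (Cexp v') <= K).
  { generalize (Cmod_ge_sub (Cexp v') (Cexp w)). unfold K. lra. }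
  assert (Hs : Cmod (v - v') < d).
  { generalize (Cmod_triangle_sub v w v'). rewrite (Cmod_sub_sym w v'). lra. }
  specialize (H _ Hs). assert (Hp := Cmod_ge_0 (v - v')). assert (Hq := Cmod_ge_0 (Cexp (v - v') - 1 - (v - v'))).
  assert (Cmod (Cexp v') * Cmod (Cexp (v - v') - 1 - (v - v')) <= K * (e / (2 * K) * Cmod (v - v'))).
  { apply Rmult_le_compat; auto. apply Cmod_ge_0. }
  assert (Cmod (Cexp v' - Cexp w) * Cmod (v - v') <= e/2 * Cmod (v - v')) by (apply Rmult_le_compat_r; lra).
  replace (K * (e / (2 * K) * Cmod (v - v'))) with (e / 2 * Cmod (v - v')) in H0 by (field; lra). lra.
Qed.

Lemma shol_Cexp_scal (u : R) (w : C) : shol (fun v => Cexp (v * RtoC u))%C w.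
Proof.
  apply (shol_comp (fun v => v * RtoC u)%C Cexp).
  - apply shol_mult. apply shol_id. apply shol_const.
  - eexists; apply sder_Cexp.
Qed.

(** * Complex-valued functions of a real variable *)

(** Ordinary differentiability at [t], in the same factored form as [sder]: the chain rule becomes a
    substitution of [(v s, v t)] into the two-point slope. *)
Definition Rder (f : R -> C) (t : R) (l : C) : Prop :=
  exists D : R -> C, Ccont D t /\ D t = l /\
    locally t (fun s => f s - f t = RtoC (s - t) * D s)%C.

Lemma Rder_is_derive f t l : Rder f t l ->
  is_derive (fun s => Re (f s)) t (Re l) /\ is_derive (fun s => Im (f s)) t (Im l).
Proof.
  intros [D [HD [Hl [d0 H]]]].
  assert (K : forall (P : C -> R) , (forall x y, P (x - y)%C = P x - P y) -> (forall r x, P (RtoC r * x)%C = r * P x) ->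
     continuous (fun s => P (D s)) t -> is_derive (fun s => P (f s)) t (P l)).
  { intros P P1 P2 HP. apply is_derive_Reals. intros e He.
    destruct (HP (ball (P (D t)) (mkposreal e He)) (locally_ball _ (mkposreal e He))) as [d1 K1].
    exists (mkposreal _ (Rmin_stable_in_posreal d0 d1)). intros h H0 Hh. simpl in Hh.
    assert (Bh : forall d : posreal, Rabs h < d -> ball t d (t + h)).
    { intros d Hd. change (Rabs (t + h - t) < d). now replace (t + h - t) with h by ring. }
    assert (E1 := H (t + h) (Bh d0 ltac:(generalize (Rmin_l d0 d1); lra))).
    assert (E2 := K1 (t + h) (Bh d1 ltac:(generalize (Rmin_r d0 d1); lra))).
    change (Rabs (P (D (t + h)) - P (D t)) < e) in E2.
    rewrite <- P1, E1, P2, <- Hl. replace (t + h - t) with h by ring.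
    replace (h * P (D (t + h)) / h) with (P (D (t+h))) by (field; auto). auto. }
  split; apply K.
  - intros [] []; reflexivity.
  - intros r []; unfold Re; simpl; ring.
  - now apply continuous_Re.
  - intros [] []; reflexivity.
  - intros r []; unfold Im; simpl; ring.
  - now apply continuous_Im.
Qed.

Lemma real_caratheodory (g : R -> R) (t l : R) : is_derive g t l ->
  exists D : R -> R, continuous D t /\ D t = l /\ forall s, g s - g t = (s - t) * D s.
Proof.
  intros H. apply is_derive_Reals in H.
  exists (fun s => if Req_EM_T s t then l else (g s - g t) / (s - t)). split; [|split].
  - intros P [e He]. destruct (Req_EM_T t t) as [_|]; [|tauto].
    destruct (H e (cond_pos e)) as [d Hd]. exists d. intros s Hs. apply He.
    change R in s. destruct (Req_EM_T s t) as [_|E]. apply ball_center.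
    change (Rabs ((g s - g t)/(s - t) - l) < e). specialize (Hd (s - t) ltac:(lra) Hs).
    now replace (t + (s - t)) with s in Hd by ring.
  - destruct (Req_EM_T t t); tauto.
  - intros s. destruct (Req_EM_T s t) as [->|E]. ring. field. lra.
Qed.

Lemma Rder_pair (a b : R -> R) t la lb : is_derive a t la -> is_derive b t lb ->
  Rder (fun s => (a s, b s)) t (la, lb).
Proof.
  intros Ha Hb. destruct (real_caratheodory _ _ _ Ha) as [D [H1 [H2 H3]]].
  destruct (real_caratheodory _ _ _ Hb) as [D' [H1' [H2' H3']]].
  exists (fun s => (D s, D' s)). split; [|split].
  - now apply Ccont_pair.
  - now rewrite H2, H2'.
  - apply filter_forall. intros s. change R in s. apply C_ext.
    + change (a s - a t = (s - t) * D s - 0 * D' s). rewrite H3. ring.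
    + change (b s - b t = (s - t) * D' s + 0 * D s). rewrite H3'. ring.
Qed.

Lemma Rder_of_is_derive f t l : is_derive (fun s => Re (f s)) t (Re l) -> is_derive (fun s => Im (f s)) t (Im l) -> Rder f t l.
Proof.
  intros H1 H2. destruct (Rder_pair _ _ _ _ _ H1 H2) as [D [HD [Hl H]]].
  exists D. split; [auto|split]. rewrite Hl. now destruct l.
  revert H. apply filter_imp. intros s E. rewrite <- E. now destruct (f s), (f t).
Qed.

Lemma Rder_cont f t l : Rder f t l -> Ccont f t.
Proof.
  intros H. apply Rder_is_derive in H. destruct H.
  apply Ccont_pair; apply (ex_derive_continuous (K := R_AbsRing) (V := R_NormedModule)); eexists; eauto.
Qed.

Lemma Rder_const c t : Rder (fun _ => c) t 0.
Proof. exists (fun _ => RtoC 0). split; [|split]; auto. apply Ccont_const. apply filter_forall. intros; ring. Qed.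

Lemma Rder_RtoC t : Rder (fun t => RtoC t) t 1.
Proof.
  exists (fun _ => RtoC 1). split; [|split]; auto. apply Ccont_const. apply filter_forall. intros s.
  rewrite RtoC_minus. ring.
Qed.

Lemma Rder_plus f g t l m : Rder f t l -> Rder g t m -> Rder (fun s => f s + g s)%C t (l + m)%C.
Proof.
  intros [D [HD [Hl H]]] [D' [HD' [Hl' H']]].
  exists (fun p => D p + D' p)%C. split; [|split].
  - now apply Ccont_plus.
  - congruence.
  - generalize (filter_and _ _ H H'). apply filter_imp. intros s [E E'].
    replace (f s + g s - (f t + g t))%C with ((f s - f t) + (g s - g t))%C by ring. rewrite E, E'; ring.
Qed.

Lemma Rder_mult f g t l m : Rder f t l -> Rder g t m -> Rder (fun s => f s * g s)%C t (l * g t + f t * m)%C.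
Proof.
  intros Hf Hg. assert (Cf := Rder_cont _ _ _ Hf). assert (Cg := Rder_cont _ _ _ Hg).
  destruct Hf as [D [HD [Hl H]]]. destruct Hg as [D' [HD' [Hl' H']]].
  exists (fun s => D s * g s + f t * D' s)%C. split; [|split].
  - apply Ccont_plus; apply Ccont_mult; auto. apply Ccont_const.
  - simpl. congruence.
  - generalize (filter_and _ _ H H'). apply filter_imp. intros s [E E'].
    replace (f s * g s - f t * g t)%C with ((f s - f t) * g s + f t * (g s - g t))%C by ring. rewrite E, E'; ring.
Qed.

Lemma Rder_comp (v : R -> C) f t l m : Rder v t l -> sder f (v t) m -> Rder (fun s => f (v s)) t (m * l)%C.
Proof.
  intros Hv Hf. assert (Cv := Rder_cont _ _ _ Hv).
  destruct Hv as [D [HD [Hl H]]]. destruct Hf as [D' [HD' [Hl' H']]].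
  set (k := fun s : R => (v s, v t) : CC).
  assert (Ck : continuous k t).
  { intros P HP. apply locally_CC in HP. destruct HP as [d [Hd HP]].
    unfold filtermap. generalize (proj1 (Ccont_eps _ _) Cv d Hd). apply filter_imp. intros s Hs. apply HP; auto.
    replace (v t - v t)%C with (RtoC 0) by ring. now rewrite Cmod_0. }
  exists (fun s => D' (k s) * D s)%C. split; [|split].
  - apply Ccont_mult; auto. apply (continuous_comp (V := CC) k D'); auto.
  - unfold k; simpl. congruence.
  - generalize (filter_and _ _ H (Ck _ H')). apply filter_imp. intros s [E E'].
    change (f (v s) - f (v t) = (v s - v t) * D' (k s))%C in E'.
    rewrite E', E. ring.
Qed.

Lemma Rder_ext f g t l : (forall s, f s = g s) -> Rder f t l -> Rder g t l.
Proof.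
  intros HE [D [HD [Hl H]]]. exists D. split; [|split]; auto. revert H; apply filter_imp.
  intros s. now rewrite !HE.
Qed.

Definition cis (t : R) : C := Cexp (Ci * RtoC t).

Lemma cis_eq t : cis t = (cos t, sin t).
Proof. unfold cis, Cexp, Re, Im; simpl. 
  apply C_ext; unfold Re, Im; simpl; replace (0 * t - 1 * 0) with 0 by ring;
  replace (0 * 0 + 1 * t) with t by ring; rewrite exp_0; ring. Qed.

Lemma Rder_cis t : Rder cis t (Ci * cis t).
Proof.
  apply Rder_ext with (fun t => (cos t, sin t)). intros; now rewrite cis_eq.
  replace (Ci * cis t)%C with (- sin t, cos t).
  apply Rder_pair. apply is_derive_cos. apply is_derive_sin.
  rewrite cis_eq. apply C_ext; unfold Re, Im; simpl; ring.
Qed.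

Lemma Cmod_cis t : Cmod (cis t) = 1.
Proof. unfold cis. rewrite Cmod_Cexp. unfold Re; simpl. replace (0 * t - 1 * 0) with 0 by ring. apply exp_0. Qed.

(** * Integrals of complex-valued functions of a real variable *)

Notation isCInt := (is_RInt (V := C_R_NormedModule)).

Lemma isCInt_pair f a b I :
  isCInt f a b I <-> is_RInt (fun t => Re (f t)) a b (Re I) /\ is_RInt (fun t => Im (f t)) a b (Im I).
Proof.
  split.
  - intros H. split.
    + apply (is_RInt_fct_extend_fst (U := R_NormedModule) (V := R_NormedModule) f a b I H).
    + apply (is_RInt_fct_extend_snd (U := R_NormedModule) (V := R_NormedModule) f a b I H).
  - intros [H1 H2]. destruct I as [I1 I2].
    apply (is_RInt_fct_extend_pair (U := R_NormedModule) (V := R_NormedModule)); auto.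
Qed.

Lemma isCInt_unique f a b I J : isCInt f a b I -> isCInt f a b J -> I = J.
Proof.
  intros H K. apply isCInt_pair in H. apply isCInt_pair in K. destruct H, K.
  apply C_ext.
  - rewrite <- (is_RInt_unique _ _ _ _ H). now apply is_RInt_unique.
  - rewrite <- (is_RInt_unique _ _ _ _ H0). now apply is_RInt_unique.
Qed.

Lemma isCInt_plus f g a b I J : isCInt f a b I -> isCInt g a b J -> isCInt (fun t => f t + g t)%C a b (I + J)%C.
Proof. apply (is_RInt_plus (V := C_R_NormedModule)). Qed.

Lemma isCInt_scal c f a b I : isCInt f a b I -> isCInt (fun t => c * f t)%C a b (c * I)%C.
Proof.
  intros H. apply isCInt_pair in H. destruct H as [H1 H2].
  assert (S : forall (k : R) g J, is_RInt g a b J -> is_RInt (fun t => k * g t) a b (k * J))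
    by (intros; now apply (is_RInt_scal (V := R_NormedModule))).
  apply isCInt_pair. split.
  - apply (is_RInt_minus (V := R_NormedModule) (fun t => Re c * Re (f t)) (fun t => Im c * Im (f t))); now apply S.
  - apply (is_RInt_plus (V := R_NormedModule) (fun t => Re c * Im (f t)) (fun t => Im c * Re (f t))); now apply S.
Qed.

Lemma isCInt_minus f g a b I J : isCInt f a b I -> isCInt g a b J -> isCInt (fun t => f t - g t)%C a b (I - J)%C.
Proof. apply (is_RInt_minus (V := C_R_NormedModule)). Qed.

Lemma isCInt_conj f a b I : isCInt f a b I -> isCInt (fun t => Cconj (f t)) a b (Cconj I).
Proof.
  intros H. apply isCInt_pair in H. destruct H as [H1 H2]. apply isCInt_pair. split; auto.
  now apply (is_RInt_opp (V := R_NormedModule)).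
Qed.

Lemma isCInt_ext f g a b I : (forall t, Rmin a b <= t <= Rmax a b -> f t = g t) -> isCInt f a b I -> isCInt g a b I.
Proof. intros H. apply (is_RInt_ext (V := C_R_NormedModule)). intros; apply H; lra. Qed.

Lemma isCInt_const c a b : isCInt (fun _ => c) a b (RtoC (b - a) * c)%C.
Proof.
  apply isCInt_pair. split; unfold Re, Im; simpl.
  - replace ((b - a) * fst c - 0 * snd c) with ((b - a) * fst c) by ring. apply (is_RInt_const (V := R_NormedModule)).
  - replace ((b - a) * snd c + 0 * fst c) with ((b - a) * snd c) by ring. apply (is_RInt_const (V := R_NormedModule)).
Qed.

Lemma isCInt_Chasles f a b c I J : isCInt f a b I -> isCInt f b c J -> isCInt f a c (I + J)%C.
Proof. apply (is_RInt_Chasles (V := C_R_NormedModule)). Qed.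

Lemma ex_isCInt f a b : (forall t, Rmin a b <= t <= Rmax a b -> Ccont f t) -> exists I, isCInt f a b I.
Proof.
  intros H. destruct (ex_RInt_continuous (V := R_CompleteNormedModule) (fun t => Re (f t)) a b) as [I1 H1].
  { intros; now apply continuous_Re, H. }
  destruct (ex_RInt_continuous (V := R_CompleteNormedModule) (fun t => Im (f t)) a b) as [I2 H2].
  { intros; now apply continuous_Im, H. }
  exists (I1, I2). apply isCInt_pair; auto.
Qed.

(** The factor 2 comes from bounding real and imaginary parts separately; only the order of
    magnitude of such bounds matters later. *)
Lemma isCInt_bound f g a b I K : a <= b -> isCInt f a b I -> is_RInt g a b K ->
  (forall t, a <= t <= b -> Cmod (f t) <= g t) -> Cmod I <= 2 * K.
Proof.
  intros Hab H Hg Hb. apply isCInt_pair in H. destruct H as [H1 H2].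
  assert (B : forall h J, is_RInt h a b J -> (forall t, a <= t <= b -> Rabs (h t) <= g t) -> Rabs J <= K).
  { intros h J Hh Hn. apply (norm_RInt_le (V := R_NormedModule) h g a b J K); auto. }
  eapply Rle_trans. apply Cmod_le_abs.
  assert (Rabs (Re I) <= K). { apply (B _ _ H1). intros; eapply Rle_trans. apply Rabs_Re_le. auto. }
  assert (Rabs (Im I) <= K). { apply (B _ _ H2). intros; eapply Rle_trans. apply Rabs_Im_le. auto. }
  lra.
Qed.

Lemma isCInt_bound_const f a b I M : a <= b -> isCInt f a b I ->
  (forall t, a <= t <= b -> Cmod (f t) <= M) -> Cmod I <= 2 * ((b - a) * M).
Proof.
  intros Hab H Hb. apply (isCInt_bound f (fun _ => M) a b I _ Hab H); auto.
  apply (is_RInt_const (V := R_NormedModule)).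
Qed.

(** * Homotopy of contour integrals and the mean value property *)

(* The complex derivative read off along the real direction. *)
Definition Cderiv (f : C -> C) (v : C) : C :=
  (Derive (fun t => Re (f (v + RtoC t)%C)) 0, Derive (fun t => Im (f (v + RtoC t)%C)) 0).

Lemma Cderiv_unique f v l : sder f v l -> Cderiv f v = l.
Proof.
  intros H.
  assert (HR : Rder (fun t : R => f (v + RtoC t)%C) 0 (l * (0 + 1))%C).
  { apply (Rder_comp (fun t : R => v + RtoC t)%C).
    - apply (Rder_plus (fun _ => v) (fun t => RtoC t)). apply Rder_const. apply Rder_RtoC.
    - now replace (v + RtoC 0)%C with v by ring. }
  replace (l * (0 + 1))%C with l in HR by ring.
  apply Rder_is_derive in HR. destruct HR as [H1 H2].
  apply is_derive_unique in H1. apply is_derive_unique in H2.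
  apply C_ext; [exact H1|exact H2].
Qed.

Lemma sder_Cderiv f v : shol f v -> sder f v (Cderiv f v).
Proof. intros [l H]. now rewrite (Cderiv_unique f v l H). Qed.

(** Strictness at [w] controls all short chords near [w]. A short horizontal chord starting at a
    nearby [v] is compared with both derivatives, so these must be close to each other. *)
Lemma Ccont_Cderiv f w : locally (T := C_UniformSpace) w (shol f) -> Ccont (Cderiv f) w.
Proof.
  intros Hl. apply Ccont_eps. intros e He.
  assert (Hw : sder f w (Cderiv f w)) by (apply sder_Cderiv; now apply locally_singleton).
  destruct (sder_bound _ _ _ Hw (e/4)) as [d [Hd Hb]]; [lra|].
  apply locally_Cmod in Hl. destruct Hl as [d1 [Hd1 Hl]].
  apply locally_Cmod. exists (Rmin d d1). split; [now apply Rmin_glb_lt|].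
  intros v Hv. assert (A1 := Rmin_l d d1). assert (A2 := Rmin_r d d1).
  assert (Hs := sder_Cderiv f v (Hl v ltac:(lra))).
  destruct (sder_bound _ _ _ Hs (e/4)) as [d2 [Hd2 Hb2]]; [lra|].
  (* The chord must stay in the disc belonging to [v] and also in the one belonging to [w]. *)
  set (t := Rmin (d2/2) ((d - Cmod (v - w))/2)).
  assert (Ht : 0 < t) by (apply Rmin_glb_lt; lra).
  assert (A3 := Rmin_l (d2/2) ((d - Cmod (v - w))/2)). assert (A4 := Rmin_r (d2/2) ((d - Cmod (v - w))/2)).
  fold t in A3, A4.
  assert (Et : Cmod (RtoC t) = t) by (rewrite Cmod_R; apply Rabs_right; lra).
  assert (E0 : (v - v = 0)%C) by ring.
  assert (B2 := Hb2 (v + RtoC t)%C v). replace (v + RtoC t - v)%C with (RtoC t) in B2 by ring.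
  rewrite E0, Cmod_0, Et in B2. specialize (B2 ltac:(lra) ltac:(lra)).
  assert (B1 := Hb (v + RtoC t)%C v). replace (v + RtoC t - v)%C with (RtoC t) in B1 by ring.
  rewrite Et in B1.
  assert (Cmod (v + RtoC t - w) < d).
  { replace (v + RtoC t - w)%C with (RtoC t + (v - w))%C by ring. eapply Rle_lt_trans. apply Cmod_triangle. rewrite Et. lra. }
  specialize (B1 ltac:(lra) ltac:(lra)).
  assert (Cmod (Cderiv f v - Cderiv f w) * t <= e / 2 * t).
  { rewrite <- Et at 1. rewrite <- Cmod_mult.
    replace ((Cderiv f v - Cderiv f w) * RtoC t)%C with
      ((f (v + RtoC t) - f v - Cderiv f w * RtoC t) - (f (v + RtoC t) - f v - Cderiv f v * RtoC t))%C by ring.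
    eapply Rle_trans. apply Cmod_triangle. rewrite Cmod_opp. lra. }
  apply Rmult_le_reg_r in H0; lra.
Qed.

Definition RR := prod_UniformSpace R_UniformSpace R_UniformSpace.

Lemma Ccont_curve1 (g : R -> C) (p : RR) : Ccont g (fst p) -> Ccont (fun q : RR => g (fst q)) p.
Proof. intros H. apply (continuous_comp (U := RR) (fun q : RR => fst q) g); auto. destruct p; apply (continuous_fst (U := R_UniformSpace) (V := R_UniformSpace)). Qed.
Lemma Ccont_curve2 (g : R -> C) (p : RR) : Ccont g (snd p) -> Ccont (fun q : RR => g (snd q)) p.
Proof. intros H. apply (continuous_comp (U := RR) (fun q : RR => snd q) g); auto. destruct p; apply (continuous_snd (U := R_UniformSpace) (V := R_UniformSpace)). Qed.

Lemma continuity_2d_continuous (g : R -> R -> R) (s t : R) :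
  continuous (U := R_UniformSpace) (fun q : RR => g (fst q) (snd q)) ((s, t) : RR) -> continuity_2d_pt g s t.
Proof. intros H. apply continuity_2d_pt_filterlim. exact H. Qed.

Lemma continuous_RR_slice (V : UniformSpace) (g : RR -> V) (s t : R) :
  continuous g ((s, t) : RR) -> continuous (fun u : R => g (s, u)) t.
Proof.
  intros H P HP. destruct (H P HP) as [d Hd]. exists d. intros u Hu. apply Hd. split; auto. apply ball_center.
Qed.

Lemma Ccont_RtoC_id (t : R) : Ccont (fun s : R => RtoC s) t.
Proof. apply Ccont_RtoC. apply continuous_id. Qed.

Section Homotopy.
Variables (f : C -> C) (al al' be be' : R -> C) (a b s0 s1 : R).
Hypothesis Hab : a <= b.
Hypothesis Hal : forall t, Rder al t (al' t).
Hypothesis Hbe : forall t, Rder be t (be' t).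
Hypothesis Hal' : forall t, Ccont al' t.
Hypothesis Hbe' : forall t, Ccont be' t.
Let v (s t : R) : C := (al t + RtoC s * be t)%C.
Let vt (s t : R) : C := (al' t + RtoC s * be' t)%C.
Hypothesis Hf : forall s t, s0 < s < s1 -> a <= t <= b -> locally (T := C_UniformSpace) (v s t) (shol f).

(** Common value of the [s]-derivative of [f(v) v_t] and of the [t]-derivative of [f(v) v_s], where
    [v_s = be]. This symmetry is the content of Cauchy's theorem for the family of curves. *)
Let Ds (s t : R) : C := (Cderiv f (v s t) * be t * vt s t + f (v s t) * be' t)%C.

Lemma homotopy_v_cont (p : RR) : Ccont (fun q : RR => v (fst q) (snd q)) p.
Proof.
  unfold v. apply Ccont_plus. apply Ccont_curve2. eapply Rder_cont; apply Hal.
  apply Ccont_mult. apply (Ccont_curve1 RtoC). apply Ccont_RtoC_id.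
  apply Ccont_curve2. eapply Rder_cont; apply Hbe.
Qed.

Lemma homotopy_vt_cont (p : RR) : Ccont (fun q : RR => vt (fst q) (snd q)) p.
Proof.
  unfold vt. apply Ccont_plus. apply Ccont_curve2; auto.
  apply Ccont_mult. apply (Ccont_curve1 RtoC). apply Ccont_RtoC_id.
  apply Ccont_curve2; auto.
Qed.

Lemma homotopy_Ds_cont s t : s0 < s < s1 -> a <= t <= b -> Ccont (fun q : RR => Ds (fst q) (snd q)) ((s,t):RR).
Proof.
  intros Hs Ht. unfold Ds. assert (Hc := Hf s t Hs Ht).
  apply Ccont_plus; [apply Ccont_mult; [apply Ccont_mult|]|apply Ccont_mult].
  - apply (Ccont_comp (T := RR) (fun q : RR => v (fst q) (snd q)) (Cderiv f)). apply homotopy_v_cont. now apply Ccont_Cderiv.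
  - apply Ccont_curve2. eapply Rder_cont; apply Hbe.
  - apply homotopy_vt_cont.
  - apply (Ccont_comp (T := RR) (fun q : RR => v (fst q) (snd q)) f). apply homotopy_v_cont.
    apply shol_cont. now apply locally_singleton in Hc.
  - apply Ccont_curve2; auto.
Qed.

Lemma homotopy_ds s t : shol f (v s t) -> Rder (fun s => f (v s t) * vt s t)%C s (Ds s t).
Proof.
  intros H. unfold Ds.
  assert (Hv : Rder (fun s => v s t) s (0 + (1 * be t + RtoC s * 0))%C).
  { unfold v. apply (Rder_plus (fun _ => al t)). apply Rder_const.
    apply (Rder_mult (fun s => RtoC s) (fun _ => be t)). apply Rder_RtoC. apply Rder_const. }
  assert (Hvt : Rder (fun s => vt s t) s (0 + (1 * be' t + RtoC s * 0))%C).
  { unfold vt. apply (Rder_plus (fun _ => al' t)). apply Rder_const.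
    apply (Rder_mult (fun s => RtoC s) (fun _ => be' t)). apply Rder_RtoC. apply Rder_const. }
  assert (K := Rder_mult _ _ _ _ _ (Rder_comp _ f _ _ _ Hv (sder_Cderiv f _ H)) Hvt).
  cbv beta in K.
  match type of K with Rder _ _ ?l => replace (Cderiv f (v s t) * be t * vt s t + f (v s t) * be' t)%C with l by ring end.
  exact K.
Qed.

Lemma homotopy_dt s t : shol f (v s t) -> Rder (fun t => f (v s t) * be t)%C t (Ds s t).
Proof.
  intros H. unfold Ds.
  assert (Hv : Rder (fun t => v s t) t (al' t + (0 * be t + RtoC s * be' t))%C).
  { unfold v. apply (Rder_plus al); auto.
    apply (Rder_mult (fun _ => RtoC s) be); auto. apply Rder_const. }
  assert (K := Rder_mult _ _ _ _ _ (Rder_comp _ f _ _ _ Hv (sder_Cderiv f _ H)) (Hbe t)).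
  cbv beta in K.
  match type of K with Rder _ _ ?l => replace (Cderiv f (v s t) * be t * vt s t + f (v s t) * be' t)%C with l by (unfold vt; ring) end.
  exact K.
Qed.

Lemma homotopy_loc s t : s0 < s < s1 -> a <= t <= b ->
  locally ((s, t) : RR) (fun q : RR => shol f (v (fst q) (snd q))).
Proof. intros Hs Ht. apply (homotopy_v_cont ((s,t):RR) (shol f)). now apply Hf. Qed.

(** Differentiation under the integral sign produces the integral of [Ds], which is the
    [t]-derivative of [f(v) be]; what is left is a boundary term. It vanishes for closed curves, and
    for the open curves of the Bromwich kernel it measures the motion of the end points. *)
Lemma homotopy_RInt (s : R) : s0 < s < s1 ->
  Rder (fun s => (RInt (fun t => Re (f (v s t) * vt s t)%C) a b, RInt (fun t => Im (f (v s t) * vt s t)%C) a b) : C) s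
    (f (v s b) * be b - f (v s a) * be a)%C.
Proof.
  intros Hs.
  assert (Hsl : locally s (fun u : R => s0 < u < s1)).
  { apply (open_and (fun u => s0 < u) (fun u => u < s1)); auto. apply open_gt. apply open_lt. }
  (* [P] is [Re] or [Im]: one argument serves both coordinates. *)
  assert (G : forall (P : C -> R), (forall g t l, Rder g t l -> is_derive (fun u => P (g u)) t (P l)) ->
    (forall (T : UniformSpace) (g : T -> C) x, Ccont g x -> continuous (fun u => P (g u)) x) ->
    is_derive (fun s => RInt (fun t => P (f (v s t) * vt s t)%C) a b) s
      (P (f (v s b) * be b)%C - P (f (v s a) * be a)%C)).
  { intros P P1 P2.
    replace (P (f (v s b) * be b)%C - P (f (v s a) * be a)%C) with
      (RInt (fun t => Derive (fun u => P (f (v u t) * vt u t)%C) s) a b).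
    - apply (is_derive_RInt_param (fun s t => P (f (v s t) * vt s t)%C)).
      + revert Hsl. apply filter_imp. intros u Hu t Ht. rewrite Rmin_left, Rmax_right in Ht by auto.
        eexists. apply (P1 (fun u => f (v u t) * vt u t)%C). apply homotopy_ds.
        apply locally_singleton. now apply Hf.
      + intros t Ht. rewrite Rmin_left, Rmax_right in Ht by auto.
        apply continuity_2d_pt_ext_loc with (fun u w => P (Ds u w)).
        * destruct (homotopy_loc s t Hs Ht) as [e He]. exists e. intros u w Hu Hw.
          symmetry. apply is_derive_unique. apply (P1 (fun u => f (v u w) * vt u w)%C). apply homotopy_ds.
          apply (He (u, w)). split; auto.
        * apply continuity_2d_continuous. apply (P2 RR (fun q : RR => Ds (fst q) (snd q))). now apply homotopy_Ds_cont.
      + revert Hsl. apply filter_imp. intros u Hu.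
        apply (ex_RInt_continuous (V := R_CompleteNormedModule)). intros t Ht. rewrite Rmin_left, Rmax_right in Ht by auto.
        apply (P2 R_UniformSpace (fun t => f (v u t) * vt u t)%C). apply Ccont_mult.
        * apply (Ccont_comp (fun t => v u t)).
          apply (continuous_RR_slice _ (fun q : RR => v (fst q) (snd q)) u t (homotopy_v_cont _)).
          apply shol_cont. apply locally_singleton. now apply Hf.
        * apply (continuous_RR_slice _ (fun q : RR => vt (fst q) (snd q)) u t (homotopy_vt_cont _)).
    - apply is_RInt_unique.
      apply (is_RInt_ext (V := R_NormedModule) (fun t => P (Ds s t))).
      { intros t Ht. rewrite Rmin_left, Rmax_right in Ht by auto. symmetry. apply is_derive_unique.
        apply (P1 (fun u => f (v u t) * vt u t)%C). apply homotopy_ds. apply locally_singleton. apply Hf; lra. }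
      apply (is_RInt_derive (V := R_CompleteNormedModule) (fun t => P (f (v s t) * be t)%C) (fun t => P (Ds s t)));
        rewrite Rmin_left, Rmax_right by auto; intros t Ht.
      + apply (P1 (fun t => f (v s t) * be t)%C). apply homotopy_dt. apply locally_singleton. now apply Hf.
      + apply (P2 R_UniformSpace (fun t => Ds s t)).
        apply (continuous_RR_slice _ (fun q : RR => Ds (fst q) (snd q)) s t). now apply homotopy_Ds_cont. }
  apply Rder_of_is_derive.
  - apply (G Re). intros; now apply Rder_is_derive. intros; now apply continuous_Re.
  - apply (G Im). intros; now apply Rder_is_derive. intros; now apply continuous_Im.
Qed.

End Homotopy.

(** The interval is split at each exceptional point and continuity joins the pieces. This lets the
    radius of a circle pass a point where the integrand is known only to be continuous. *)
Lemma constant_off_finite (L : list R) (h : R -> R) (a b : R) : a <= b ->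
  (forall x, a <= x <= b -> continuous h x) ->
  (forall x, a < x < b -> ~ In x L -> is_derive h x 0) -> h b = h a.
Proof.
  revert a b. induction L as [|c L IH]; intros a b Hab Hc Hd.
  - destruct (MVT_gen h a b (fun _ => 0)) as [x [_ E]].
    + rewrite Rmin_left, Rmax_right by auto. intros; apply Hd; auto.
    + rewrite Rmin_left, Rmax_right by auto. intros. apply continuity_pt_filterlim. now apply Hc.
    + lra.
  - assert (D : (a < c < b) \/ ~ (a < c < b)) by (destruct (Rlt_dec a c), (Rlt_dec c b); lra).
    destruct D as [D|D].
    + transitivity (h c).
      * apply IH; [lra| intros; apply Hc; lra|]. intros x Hx Hn. apply Hd; [lra|]. intros [E|E]; [lra|auto].
      * apply IH; [lra| intros; apply Hc; lra|]. intros x Hx Hn. apply Hd; [lra|]. intros [E|E]; [lra|auto].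
    + apply IH; auto. intros x Hx Hn. apply Hd; auto. intros [E|E]; [subst; auto|auto].
Qed.

Lemma locally_not_In (L : list C) (w : C) : ~ In w L -> locally (T := C_UniformSpace) w (fun v => ~ In v L).
Proof.
  induction L as [|c L IH]; intros H.
  - apply filter_forall. auto.
  - assert (H1 : locally (T := C_UniformSpace) w (fun v => v <> c)).
    { assert (K : (w - c)%C <> RtoC 0). { intros E. apply H. left. replace w with (w - c + c)%C by ring. rewrite E; ring. }
      generalize (Ccont_neq0 (T := C_UniformSpace) (fun v : C => v - c)%C w
        (Ccont_minus (T := C_UniformSpace) (fun v : C => v) (fun _ => c) w (Ccont_id w) (Ccont_const c w)) K).
      apply filter_imp. intros v Hv E. apply Hv. rewrite E. ring. }
    generalize (filter_and _ _ H1 (IH (fun K => H (or_intror K)))). apply filter_imp.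
    intros v [E1 E2] [E|E]; auto.
Qed.

Lemma locally_Cmod_lt (p w : C) (r : R) : Cmod (w - p) < r -> locally (T := C_UniformSpace) w (fun v => Cmod (v - p) < r).
Proof.
  intros H. apply locally_Cmod. exists (r - Cmod (w - p)). split; [lra|]. intros v Hv.
  generalize (Cmod_triangle_sub v w p). lra.
Qed.

Lemma Cmod_circle (p : C) (r t : R) : 0 <= r -> Cmod (p + RtoC r * cis t - p) = r.
Proof.
  intros Hr. replace (p + RtoC r * cis t - p)%C with (RtoC r * cis t)%C by ring.
  rewrite Cmod_mult, Cmod_cis, Cmod_R, Rabs_right; lra.
Qed.

Lemma cis_2PI : cis (2 * PI) = cis 0.
Proof. rewrite !cis_eq. now rewrite cos_2PI, sin_2PI, cos_0, sin_0. Qed.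

(** The mean over the circle of relative radius [s] is continuous in [s] and has derivative 0
    whenever the circle misses [L], so its value at [s = 1] is that at [s = 0]. Allowing mere
    continuity on [L] makes the statement applicable to functions with filled removable
    singularities. *)
Lemma mean_value_continuous (f : C -> C) (p : C) (r r' : R) (L : list C) : 0 < r < r' ->
  (forall v, Cmod (v - p) < r' -> ~ In v L -> shol f v) ->
  (forall v, In v L -> Cmod (v - p) < r' -> Ccont f v) ->
  isCInt (fun t => f (p + RtoC r * cis t)%C) 0 (2 * PI) (RtoC (2 * PI) * f p)%C.
Proof.
  intros Hr Hh Hc. assert (HPI := PI_RGT_0).
  assert (Hcont : forall v, Cmod (v - p) < r' -> Ccont f v).
  { intros v Hv. destruct (in_dec C_eq_dec v L). now apply Hc. apply shol_cont; auto. }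
  set (k := fun t : R => (RtoC r * cis t)%C).
  set (k' := fun t : R => (RtoC r * (Ci * cis t))%C).
  assert (Hk : forall t, Rder k t (k' t)).
  { intros t. unfold k, k'. assert (K := Rder_mult (fun _ => RtoC r) cis t _ _ (Rder_const _ t) (Rder_cis t)).
    replace (RtoC r * (Ci * cis t))%C with (0 * cis t + RtoC r * (Ci * cis t))%C by ring. exact K. }
  assert (Hk' : forall t, Ccont k' t).
  { intros t. unfold k'. apply Ccont_mult. apply Ccont_const. apply Ccont_mult. apply Ccont_const.
    eapply Rder_cont. apply Rder_cis. }
  set (V := fun s t : R => (p + RtoC s * k t)%C).
  assert (HV : forall s t, Cmod (V s t - p) = Rabs s * r).
  { intros s t. unfold V, k. replace (p + RtoC s * (RtoC r * cis t) - p)%C with (RtoC s * (RtoC r * cis t))%C by ring.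
    rewrite !Cmod_mult, Cmod_cis, !Cmod_R, (Rabs_right r); lra. }
  (* The range of [s] extends a little beyond [[0, 1]], as two-sided continuity at the end points
     requires. *)
  assert (HVin : forall s t, -1 < s * (r / r') < 1 -> Cmod (V s t - p) < r').
  { intros s t Hs. rewrite HV. assert (Rabs (s * (r / r')) < 1) by (apply Rabs_lt_between; lra).
    rewrite Rabs_mult, (Rabs_right (r / r')) in H.
    2:{ apply Rle_ge, Rlt_le, Rdiv_lt_0_compat; lra. }
    apply Rmult_lt_compat_r with (r := r') in H; [|lra]. replace (Rabs s * (r / r') * r') with (Rabs s * r) in H by (field; lra). lra. }
  assert (Hq : 0 < r / r' < 1).
  { split. apply Rdiv_lt_0_compat; lra. apply Rmult_lt_reg_r with r'; [lra|]. unfold Rdiv. rewrite Rmult_assoc, Rinv_l; lra. }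
  assert (Hs01 : forall s, 0 <= s <= 1 -> -1 < s * (r / r') < 1) by (intros; nra).
  assert (HVc : forall q : RR, Ccont (fun q : RR => V (snd q) (fst q)) q).
  { intros q. unfold V. apply Ccont_plus. apply Ccont_const. apply Ccont_mult.
    apply (Ccont_curve2 RtoC). apply Ccont_RtoC_id.
    apply (Ccont_curve1 k). eapply Rder_cont, Hk. }
  assert (HVt : forall s t, Ccont (fun t => V s t) t).
  { intros s t. unfold V. apply Ccont_plus. apply Ccont_const. apply Ccont_mult. apply Ccont_const. eapply Rder_cont, Hk. }
  (* The relative radii at which the circle meets a point of [L]. *)
  set (LR := 0 :: map (fun a => Cmod (a - p) / r) L).
  assert (G : forall (P : C -> R), (forall g t l, Rder g t l -> is_derive (fun u => P (g u)) t (P l)) ->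
    (forall (T : UniformSpace) (g : T -> C) x, Ccont g x -> continuous (fun u => P (g u)) x) ->
    P 0 = 0 ->
    (forall s0, 0 < s0 < 1 -> ~ In s0 LR ->
       is_derive (fun s => RInt (fun t => P (f (V s t))) 0 (2 * PI)) s0 0) ->
    is_RInt (fun t => P (f (V 1 t))) 0 (2 * PI) (2 * PI * P (f p))).
  { intros P P1 P2 P0 Hd.
    assert (Hex : forall s, -1 < s * (r / r') < 1 -> ex_RInt (fun t => P (f (V s t))) 0 (2 * PI)).
    { intros s Hs. apply (ex_RInt_continuous (V := R_CompleteNormedModule)). intros t _.
      apply (P2 R_UniformSpace (fun t => f (V s t))). apply (Ccont_comp (fun t => V s t)); auto. }
    assert (E : RInt (fun t => P (f (V 1 t))) 0 (2 * PI) = RInt (fun t => P (f (V 0 t))) 0 (2 * PI)).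
    { apply (constant_off_finite LR (fun s => RInt (fun t => P (f (V s t))) 0 (2 * PI)) 0 1); [lra| |].
      2:{ intros; now apply Hd. }
      intros c Hc01. intros Q [e He].
      destruct (uniform_continuity_2d_1d (fun t s => P (f (V s t))) 0 (2 * PI) c) with (eps := mkposreal (e / (4 * PI)) (ltac:(apply Rdiv_lt_0_compat; [apply cond_pos|lra]))) as [d Hd2].
      { intros t Ht. apply continuity_2d_continuous.
        apply (P2 RR (fun q : RR => f (V (snd q) (fst q)))).
        apply (Ccont_comp (T := RR) (fun q : RR => V (snd q) (fst q))); [apply HVc|]. simpl. auto. }
      assert (Hd' : 0 < Rmin d (r' / r - 1)).
      { apply Rmin_glb_lt. apply cond_pos. apply Rlt_0_minus. apply Rmult_lt_reg_r with r; [lra|].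
        unfold Rdiv. rewrite Rmult_assoc, Rinv_l; lra. }
      exists (mkposreal _ Hd'). intros s Hs. change (Rabs (s - c) < Rmin d (r' / r - 1)) in Hs.
      assert (A1 := Rmin_l d (r' / r - 1)). assert (A2 := Rmin_r d (r' / r - 1)).
      apply Rabs_lt_between in Hs.
      assert (Hs1 : -1 < s * (r / r') < 1).
      { assert (Hrr : (r' / r) * (r / r') = 1) by (field; lra).
        split. nra. nra. }
      apply He.
      change (Rabs (RInt (fun t => P (f (V s t))) 0 (2 * PI) - RInt (fun t => P (f (V c t))) 0 (2 * PI)) < e).
      assert (I1 := RInt_correct _ _ _ (Hex s Hs1)). assert (I2 := RInt_correct _ _ _ (Hex c (Hs01 c Hc01))).
      assert (I3 := is_RInt_minus (V := R_NormedModule) _ _ _ _ _ _ I1 I2).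
      assert (I4 := is_RInt_const (V := R_NormedModule) 0 (2 * PI) (e / (4 * PI))).
      assert (B : norm (minus (RInt (fun t => P (f (V s t))) 0 (2 * PI)) (RInt (fun t => P (f (V c t))) 0 (2 * PI)) : R_NormedModule) <= (2 * PI - 0) * (e / (4 * PI))).
      2:{ apply Rle_lt_trans with (1 := B).
        replace ((2 * PI - 0) * (e / (4 * PI))) with (e / 2) by (field; lra). generalize (cond_pos e); lra. }
      apply (norm_RInt_le (V := R_NormedModule) (fun t => minus (P (f (V s t))) (P (f (V c t)))) (fun _ => e / (4 * PI)) 0 (2 * PI));
        [lra| |exact I3|exact I4].
      intros t Ht.
      left. change (Rabs (P (f (V s t)) - P (f (V c t))) < e / (4 * PI)).
      apply Hd2; try lra. rewrite Rminus_diag_eq, Rabs_R0 by auto. apply cond_pos. }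
    assert (E0 : RInt (fun t => P (f (V 0 t))) 0 (2 * PI) = 2 * PI * P (f p)).
    { rewrite (RInt_ext _ (fun _ => P (f p))).
      - rewrite RInt_const. replace (2 * PI) with (2 * PI - 0) at 2 by ring. reflexivity.
      - intros t _. f_equal. f_equal. unfold V. ring. }
    rewrite <- E0, <- E. apply (RInt_correct (V := R_CompleteNormedModule)). apply Hex. apply Hs01. lra. }
  assert (HD : forall s0, 0 < s0 < 1 -> ~ In s0 LR ->
     Rder (fun s => (RInt (fun t => Re (f (V s t))) 0 (2 * PI), RInt (fun t => Im (f (V s t))) 0 (2 * PI)) : C) s0 0).
  { intros s0 Hs0 Hn.
    (* The velocity of the circle is [i (V - p)], so the contour integrand of [ft] is [f (V s t)]
       itself and the homotopy lemma applies to the mean. *)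
    set (ft := fun v => (- Ci * f v / (v - p))%C).
    assert (Ho : exists d, 0 < d /\ forall s, Rabs (s - s0) < d -> 0 < s < 1 /\ ~ In s LR).
    { assert (HL : forall M : list R, ~ In s0 M -> exists d, 0 < d /\ forall s, Rabs (s - s0) < d -> ~ In s M).
      { induction M as [|m M IH]; intros HM. exists 1; split; [lra|auto].
        destruct IH as [d [Hd H]]. { intros K; apply HM; now right. }
        assert (m <> s0) by (intros K; apply HM; now left).
        exists (Rmin d (Rabs (m - s0))). split. apply Rmin_glb_lt; auto. apply Rabs_pos_lt; lra.
        intros s Hs [K|K]. subst s. generalize (Rmin_r d (Rabs (m - s0))); lra.
        apply (H s); auto. generalize (Rmin_l d (Rabs (m - s0))); lra. }
      destruct (HL LR Hn) as [d [Hd H]]. exists (Rmin d (Rmin s0 (1 - s0))).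
      split. repeat apply Rmin_glb_lt; lra. intros s Hs.
      generalize (Rmin_l d (Rmin s0 (1 - s0))) (Rmin_r d (Rmin s0 (1 - s0))) (Rmin_l s0 (1 - s0)) (Rmin_r s0 (1 - s0)).
      intros. split. apply Rabs_lt_between in Hs. lra. apply H. lra. }
    destruct Ho as [d [Hd Ho]].
    assert (K := homotopy_RInt ft (fun _ => p) (fun _ => RtoC 0) k k' 0 (2 * PI) (s0 - d) (s0 + d)
       ltac:(lra) (fun t => Rder_const p t) Hk (fun t => Ccont_const _ t) Hk').
    assert (Hnp : forall s t, 0 < s -> (V s t - p <> 0)%C).
    { intros s t Hs. apply Cmod_gt_0. rewrite HV. apply Rmult_lt_0_compat; [|lra]. apply Rabs_pos_lt; lra. }
    destruct K with (s := s0) as [DD HDD]; [|lra|].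
    { intros s t Hs Ht. destruct (Ho s) as [Hs1 Hs2]. apply Rabs_lt_between; lra.
      assert (E1 : Cmod (V s t - p) < r') by (apply HVin, Hs01; lra).
      assert (E2 : ~ In (V s t) L).
      { intros Hi. apply Hs2. right. apply in_map_iff. exists (V s t). split; auto. rewrite HV, Rabs_right by lra. field; lra. }
      generalize (filter_and _ _ (locally_Cmod_lt _ _ _ E1) (filter_and _ _ (locally_not_In _ _ E2)
        (locally_not_In (p :: nil) (V s t) (fun K => match K with or_introl E => Hnp s t (proj1 Hs1) (eq_ind p (fun x => (x - p)%C = RtoC 0) (Cplus_opp_r p) _ E) | or_intror Fdd => Fdd end)))).
      apply filter_imp. intros v [F1 [F2 F3]]. unfold ft. apply shol_div.
      apply shol_mult. apply shol_const. auto. apply shol_minus. apply shol_id. apply shol_const.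
      intros E. apply F3. left. change (@eq C p v). replace v with (v - p + p)%C by ring. rewrite E. ring. }
    assert (Eb : k (2 * PI) = k 0) by (unfold k; now rewrite cis_2PI).
    rewrite Eb in HDD.
    match type of HDD with _ /\ _ = ?X /\ _ => replace X with (RtoC 0) in HDD by ring end.
    assert (Hint : forall s, 0 < s -> forall t, (ft (p + RtoC s * k t) * (0 + RtoC s * k' t))%C = f (V s t)).
    { intros s Hs t. unfold ft. fold (V s t).
      assert (N := Hnp s t Hs).
      assert (E : (0 + RtoC s * k' t = Ci * (V s t - p))%C) by (unfold V, k', k; ring).
      rewrite E. assert (Ci2 : (Ci * Ci = - RtoC 1)%C) by (apply C_ext; unfold Re, Im; simpl; ring).
      transitivity (- (Ci * Ci) * f (V s t))%C. field; auto. rewrite Ci2; ring. }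
    exists DD. destruct HDD as [H1 [H2 H3]]. split; [auto|split;[auto|]].
    assert (Hl : locally s0 (fun s => 0 < s)) by (apply open_gt; lra).
    assert (HE : forall s, 0 < s -> ((RInt (fun t => Re (f (V s t))) 0 (2 * PI), RInt (fun t => Im (f (V s t))) 0 (2 * PI)) : C)
      = (RInt (fun t => Re (ft (p + RtoC s * k t) * (0 + RtoC s * k' t))%C) 0 (2 * PI),
         RInt (fun t => Im (ft (p + RtoC s * k t) * (0 + RtoC s * k' t))%C) 0 (2 * PI))).
    { intros s Hs. f_equal; apply RInt_ext; intros t _; now rewrite Hint. }
    generalize (filter_and _ _ Hl H3). apply filter_imp. intros s [Hs E]. change R in s.
    rewrite !HE; auto; lra. }
  apply isCInt_ext with (fun t => f (V 1 t)).
  { intros t _. f_equal. unfold V, k. ring. }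
  apply isCInt_pair. split.
  - replace (Re (RtoC (2 * PI) * f p)) with (2 * PI * Re (f p)) by (unfold Re; simpl; ring).
    apply (G Re); auto. intros; now apply Rder_is_derive. intros; now apply continuous_Re.
    intros s Hs Hn. apply (Rder_is_derive _ _ _ (HD s Hs Hn)).
  - replace (Im (RtoC (2 * PI) * f p)) with (2 * PI * Im (f p)) by (unfold Im; simpl; ring).
    apply (G Im); auto. intros; now apply Rder_is_derive. intros; now apply continuous_Im.
    intros s Hs Hn. apply (Rder_is_derive _ _ _ (HD s Hs Hn)).
Qed.

Definition Clim (f : C -> C) (a l : C) : Prop :=
  forall e, 0 < e -> exists d, 0 < d /\ forall v, 0 < Cmod (v - a) < d -> Cmod (f v - l) < e.

(** Points are filled one at a time; changing the value at [a] does not disturb continuity at the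
    other points. Continuity at the filled points is what [mean_value_continuous] asks for. *)
Lemma fill_removable (f : C -> C) (L : list C) :
  (forall a, In a L -> exists l, Clim f a l) ->
  exists g, (forall v, ~ In v L -> g v = f v) /\ (forall a, In a L -> Ccont g a).
Proof.
  induction L as [|a L IH]; intros H.
  - exists f; split; auto. intros a [].
  - destruct IH as [g [Hg Hc]]. { intros; apply H; now right. }
    destruct (in_dec C_eq_dec a L) as [Hi|Hi].
    + exists g. split. intros v Hv. apply Hg. intros K; apply Hv; now right.
      intros c [E|E]; subst; auto.
    + destruct (H a) as [l Hl]; [now left|].
      exists (fun v => if C_eq_dec v a then l else g v). split.
      * intros v Hv. destruct (C_eq_dec v a) as [E|E]. exfalso; apply Hv; now left.
        apply Hg. intros K; apply Hv; now right.
      * intros c [E|E].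
        -- subst c. apply Ccont_eps. intros e He. destruct (C_eq_dec a a) as [_|]; [|tauto].
           destruct (Hl e He) as [d [Hd Hb]].
           apply (filter_imp (fun v => ~ In v L /\ Cmod (v - a) < d)).
           2:{ apply filter_and. now apply locally_not_In. apply locally_Cmod. exists d; auto. }
           intros v [V1 V2]. destruct (C_eq_dec v a) as [E|E].
           { replace (l - l)%C with (RtoC 0) by ring. now rewrite Cmod_0. }
           rewrite Hg by auto. apply Hb. split; auto. apply Cmod_gt_0. intros Fdd. apply E.
           replace v with (v - a + a)%C by ring. rewrite Fdd; ring.
        -- assert (c <> a) by (intros ->; auto).
           assert (K : ~ In c (a :: nil)) by (intros [?|[]]; auto).
           assert (HE : locally (T := C_UniformSpace) c (fun v => g v = if C_eq_dec v a then l else g v)).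
           { generalize (locally_not_In _ _ K). apply filter_imp. intros v Hv.
             destruct (C_eq_dec v a) as [E'|]; auto. exfalso; apply Hv; now left. }
           apply Ccont_eps. intros e He. rewrite <- (locally_singleton _ _ HE).
           generalize (filter_and _ _ HE (proj1 (Ccont_eps _ _) (Hc c E) e He)). apply filter_imp.
           intros v [E1 E2]. now rewrite <- E1.
Qed.

(** * Absolutely convergent complex series *)

Definition csummable (c : nat -> C) : Prop := ex_series (fun n => Cmod (c n)).

Lemma csummable_le (c : nat -> C) (m : nat -> R) :
  (forall n, Cmod (c n) <= m n) -> ex_series m -> csummable c.
Proof.
  intros H Hm. apply (ex_series_le (K := R_AbsRing) (V := R_CompleteNormedModule)) with m; auto.
  intros n. change (Rabs (Cmod (c n)) <= m n). rewrite Rabs_right; auto. apply Rle_ge, Cmod_ge_0.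
Qed.

Lemma csummable_Re c : csummable c -> ex_series (fun n => Re (c n)).
Proof. intros H. apply (ex_series_le (K := R_AbsRing) (V := R_CompleteNormedModule)) with (2 := H). intros n. apply Rabs_Re_le. Qed.
Lemma csummable_Im c : csummable c -> ex_series (fun n => Im (c n)).
Proof. intros H. apply (ex_series_le (K := R_AbsRing) (V := R_CompleteNormedModule)) with (2 := H). intros n. apply Rabs_Im_le. Qed.

Lemma CSeries_ext a c : (forall n, a n = c n) -> CSeries a = CSeries c.
Proof. intros H. unfold CSeries. f_equal; apply Series_ext; intros; now rewrite H. Qed.

Lemma CSeries_scal k c : csummable c -> CSeries (fun n => k * c n)%C = (k * CSeries c)%C.
Proof.
  intros Hc. assert (H1 := csummable_Re _ Hc). assert (H2 := csummable_Im _ Hc).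
  assert (S1 : forall (r : R) a, ex_series a -> ex_series (fun n => r * a n)) by (intros; now apply (ex_series_scal (V := R_NormedModule))).
  unfold CSeries. apply C_ext; unfold Re, Im; simpl.
  - rewrite Series_minus, !Series_scal_l; auto.
  - rewrite Series_plus, !Series_scal_l; auto.
Qed.

Lemma CSeries_minus a c : csummable a -> csummable c -> CSeries (fun n => a n - c n)%C = (CSeries a - CSeries c)%C.
Proof.
  intros Ha Hc. unfold CSeries. apply C_ext; unfold Re, Im; simpl.
  - apply (Series_minus (fun n => Re (a n)) (fun n => Re (c n))); now apply csummable_Re.
  - apply (Series_minus (fun n => Im (a n)) (fun n => Im (c n))); now apply csummable_Im.
Qed.

Lemma Series_abs_le (a m : nat -> R) : (forall n, Rabs (a n) <= m n) -> ex_series m -> Rabs (Series a) <= Series m.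
Proof.
  intros H Hm. eapply Rle_trans. apply Series_Rabs.
  - apply (ex_series_le (K := R_AbsRing) (V := R_CompleteNormedModule)) with m; auto.
    intros n. change (Rabs (Rabs (a n)) <= m n). now rewrite Rabs_Rabsolu.
  - apply Series_le; auto. intros n; split; auto. apply Rabs_pos.
Qed.

Lemma CSeries_bound c m : (forall n, Cmod (c n) <= m n) -> ex_series m -> Cmod (CSeries c) <= 2 * Series m.
Proof.
  intros H Hm. eapply Rle_trans. apply Cmod_le_abs.
  assert (Rabs (Re (CSeries c)) <= Series m).
  { apply Series_abs_le; auto. intros; eapply Rle_trans; [apply Rabs_Re_le|auto]. }
  assert (Rabs (Im (CSeries c)) <= Series m).
  { apply Series_abs_le; auto. intros; eapply Rle_trans; [apply Rabs_Im_le|auto]. }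
  lra.
Qed.

Lemma CSeries_conj c : CSeries (fun n => Cconj (c n)) = Cconj (CSeries c).
Proof. unfold CSeries, Cconj, Re, Im; simpl. f_equal. apply (Series_opp (fun n => snd (c n))). Qed.

(** * Divided differences of the rising factorial *)

(* [dd (v :: L) n] is the divided difference of [a |-> (a)_n] at the nodes [v :: L];
   the recursion in [n] is the Leibniz rule for [(a)_(n+1) = (a)_n (a + n)]. *)
Fixpoint dd (L : list C) (n : nat) : C :=
  match L with
  | nil => RtoC 0
  | v :: L' =>
    match n with
    | O => match L' with nil => RtoC 1 | _ => RtoC 0 end
    | S m => (dd L m * (v + RtoC (INR m)) + dd L' m)%C
    end
  end.

Lemma dd_S v L n : dd (v :: L) (S n) = (dd (v :: L) n * (v + RtoC (INR n)) + dd L n)%C.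
Proof. reflexivity. Qed.

Lemma dd_nil n : dd nil n = RtoC 0.
Proof. now destruct n. Qed.

Lemma dd_single v n : dd (v :: nil) n = Cpoch v n.
Proof. induction n as [|n IH]. reflexivity. rewrite dd_S, IH, dd_nil. simpl. ring. Qed.

Lemma dd_diff v v' L n : (dd (v :: L) n - dd (v' :: L) n = (v - v') * dd (v :: v' :: L) n)%C.
Proof.
  induction n as [|n IH].
  - destruct L; simpl; ring.
  - rewrite !dd_S. transitivity ((dd (v :: L) n - dd (v' :: L) n) * (v + RtoC (INR n)) + (v - v') * dd (v' :: L) n)%C. ring.
    rewrite IH. ring.
Qed.

Fixpoint rpoch (a : R) (n : nat) : R :=
  match n with O => 1 | S m => rpoch a m * (a + INR m) end.

Lemma rpoch_pos a n : 0 < a -> 0 < rpoch a n.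
Proof. intros Ha; induction n; simpl. lra. apply Rmult_lt_0_compat; auto. generalize (pos_INR n); lra. Qed.

Lemma Cpoch_RtoC a n : Cpoch (RtoC a) n = RtoC (rpoch a n).
Proof. induction n; simpl. reflexivity. rewrite IHn, RtoC_mult, RtoC_plus. reflexivity. Qed.

(** A step of the Leibniz recursion multiplies by at most [M + n] and adds one more divided
    difference, hence costs the factor [(M + 1) + n], whatever the number of nodes. *)
Lemma dd_bound M L n : 0 <= M -> List.Forall (fun v => Cmod v <= M) L -> Cmod (dd L n) <= rpoch (M + 1) n.
Proof.
  intros HM. revert L. induction n as [|n IH]; intros L HL.
  - destruct L as [|v [|]]; simpl; rewrite ?Cmod_0, ?Cmod_1; lra.
  - assert (Hp := rpoch_pos (M + 1) n ltac:(lra)). assert (Hn := pos_INR n).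
    destruct L as [|v L]. { rewrite dd_nil, Cmod_0. left; apply rpoch_pos; lra. }
    rewrite dd_S. inversion_clear HL. eapply Rle_trans. apply Cmod_triangle. rewrite Cmod_mult.
    assert (Cmod (v + RtoC (INR n)) <= M + INR n).
    { eapply Rle_trans. apply Cmod_triangle. rewrite Cmod_R, (Rabs_right (INR n)) by lra. lra. }
    assert (K1 := IH (v :: L) (List.Forall_cons v H H0)). assert (K2 := IH L H0). simpl rpoch.
    assert (Cmod (dd (v :: L) n) * Cmod (v + RtoC (INR n)) <= rpoch (M + 1) n * (M + INR n)).
    { apply Rmult_le_compat; auto; apply Cmod_ge_0. }
    nra.
Qed.

Lemma dd_conj L n : dd (map Cconj L) n = Cconj (dd L n).
Proof.
  revert L; induction n as [|n IH]; intros [|v L]; try (simpl; apply C_ext; unfold Re, Im; simpl; ring).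
  - destruct L; simpl; apply C_ext; unfold Re, Im; simpl; ring.
  - change (map Cconj (v :: L)) with (Cconj v :: map Cconj L). rewrite !dd_S.
    change (Cconj v :: map Cconj L) with (map Cconj (v :: L)). rewrite !IH.
    rewrite Cplus_conj, Cmult_conj, Cplus_conj. f_equal. f_equal. f_equal.
    apply C_ext; unfold Re, Im; simpl; ring.
Qed.

(** * The confluent hypergeometric series *)

Definition Phi_beta (b : R) (n : nat) : R := / (rpoch b n * INR (fact n)).

Lemma Phi_beta_pos b n : 0 < b -> 0 < Phi_beta b n.
Proof. intros Hb. apply Rinv_0_lt_compat, Rmult_lt_0_compat. now apply rpoch_pos. apply INR_fact_lt_0. Qed.

Lemma Phi_beta_S b n : 0 < b -> INR (S n) * (b + INR n) * Phi_beta b (S n) = Phi_beta b n.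
Proof.
  intros Hb. unfold Phi_beta. rewrite fact_simpl, mult_INR. simpl rpoch.
  assert (H1 := rpoch_pos b n Hb). assert (H2 := INR_fact_lt_0 n). assert (H3 := pos_INR n).
  assert (0 < INR (S n)) by (apply lt_0_INR; lia). field. repeat split; lra.
Qed.

Definition Fdd_majorant (b M : R) (n : nat) : R := rpoch (M + 1) n * Phi_beta b n.

Lemma Fdd_majorant_pos b M n : 0 < b -> 0 <= M -> 0 < Fdd_majorant b M n.
Proof. intros. apply Rmult_lt_0_compat. apply rpoch_pos; lra. now apply Phi_beta_pos. Qed.

Lemma Fdd_majorant_radius b M : 0 < b -> 0 <= M -> CV_radius (Fdd_majorant b M) = p_infty.
Proof.
  intros Hb HM. apply CV_radius_infinite_DAlembert.
  - intros n. generalize (Fdd_majorant_pos b M n Hb HM). lra.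
  (* The ratio of consecutive coefficients is [(M + 1 + n) / ((b + n) (n + 1))], rewritten so that
     both limits are visible. *)
  - apply is_lim_seq_ext with (fun n => (1 + (M + 1 - b) * / (b + INR n)) * / INR (S n)).
    { intros n. assert (H := pos_INR n). assert (H1 : 0 < INR (S n)) by (apply lt_0_INR; lia).
      assert (H2 := rpoch_pos (M + 1) n ltac:(lra)). assert (H3 := rpoch_pos b n Hb). assert (H4 := INR_fact_lt_0 n).
      rewrite Rabs_right.
      2:{ apply Rle_ge, Rlt_le, Rdiv_lt_0_compat; now apply Fdd_majorant_pos. }
      unfold Fdd_majorant, Phi_beta. rewrite fact_simpl, mult_INR. simpl rpoch. field. repeat split; lra. }
    assert (L1 : is_lim_seq (fun n => / INR (S n)) 0).
    { apply (is_lim_seq_incr_1 (fun n => / INR n)).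
      replace (Finite 0) with (Rbar_inv p_infty) by reflexivity.
      apply is_lim_seq_inv. apply is_lim_seq_INR. discriminate. }
    assert (L2 : is_lim_seq (fun n => / (b + INR n)) 0).
    { replace (Finite 0) with (Rbar_inv p_infty) by reflexivity.
      apply is_lim_seq_inv; [|discriminate].
      apply (is_lim_seq_plus (fun _ => b) INR b p_infty); [apply is_lim_seq_const|apply is_lim_seq_INR|reflexivity]. }
    replace 0 with ((1 + (M + 1 - b) * 0) * 0) by ring.
    apply (is_lim_seq_mult' _ _ (1 + (M + 1 - b) * 0) 0); auto.
    apply (is_lim_seq_plus' (fun _ => 1)). apply is_lim_seq_const.
    apply (is_lim_seq_mult' (fun _ => M + 1 - b)); auto. apply is_lim_seq_const.
Qed.

Lemma Fdd_majorant_summable b M x : 0 < b -> 0 <= M -> 0 <= x -> ex_series (fun n => Fdd_majorant b M n * x ^ n).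
Proof.
  intros Hb HM Hx. apply (ex_pseries_R (Fdd_majorant b M) x). apply CV_radius_inside. now rewrite Fdd_majorant_radius.
Qed.

Definition Fdd_coef (b : R) (L : list C) (n : nat) : C := (dd L n * RtoC (Phi_beta b n))%C.

(** Divided difference in the parameter of [v |-> Phi(v, b, x)] at the nodes [L]: one node gives the
    function, the nodes [w, w] its derivative at [w]. *)
Definition Fdd (b x : R) (L : list C) : C := CSeries (fun n => Fdd_coef b L n * RtoC (x ^ n))%C.

Lemma Fdd_coef_bound b M L n : 0 < b -> 0 <= M -> List.Forall (fun v => Cmod v <= M) L -> Cmod (Fdd_coef b L n) <= Fdd_majorant b M n.
Proof.
  intros Hb HM HL. unfold Fdd_coef, Fdd_majorant. assert (H := Phi_beta_pos b n Hb). rewrite Cmod_mult, Cmod_R, (Rabs_right (Phi_beta b n)) by lra.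
  apply Rmult_le_compat_r. lra. now apply dd_bound.
Qed.

Lemma Forall_Cmod_bound (L : list C) : exists M, 0 <= M /\ List.Forall (fun v => Cmod v <= M) L.
Proof.
  induction L as [|v L [M [H0 H]]].
  - exists 0. split; auto; lra.
  - exists (M + Cmod v). assert (K := Cmod_ge_0 v). split. lra. constructor. lra.
    revert H. apply List.Forall_impl. intros; lra.
Qed.

Lemma Fdd_term_bound b x M L n : 0 < b -> 0 <= x -> 0 <= M -> List.Forall (fun v => Cmod v <= M) L ->
  Cmod (Fdd_coef b L n * RtoC (x ^ n)) <= Fdd_majorant b M n * x ^ n.
Proof.
  intros. assert (Hx : 0 <= x ^ n) by now apply pow_le.
  rewrite Cmod_mult, Cmod_R, (Rabs_right (x ^ n)) by lra. apply Rmult_le_compat_r; auto. now apply Fdd_coef_bound.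
Qed.

Lemma Fdd_summable b x L : 0 < b -> 0 <= x -> csummable (fun n => Fdd_coef b L n * RtoC (x ^ n))%C.
Proof.
  intros Hb Hx. destruct (Forall_Cmod_bound L) as [M [HM HL]].
  apply csummable_le with (fun n => Fdd_majorant b M n * x ^ n). intros; now apply Fdd_term_bound. now apply Fdd_majorant_summable.
Qed.

(** The bound is uniform over lists of every length; with three nodes it controls second
    differences. *)
Lemma Fdd_bound b x M : 0 < b -> 0 <= x -> 0 <= M ->
  exists K, 0 < K /\ forall L, List.Forall (fun v => Cmod v <= M) L -> Cmod (Fdd b x L) <= K.
Proof.
  intros Hb Hx HM. exists (2 * Rabs (Series (fun n => Fdd_majorant b M n * x ^ n)) + 1). split.
  - generalize (Rabs_pos (Series (fun n => Fdd_majorant b M n * x ^ n))). lra.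
  - intros L HL. eapply Rle_trans. apply (CSeries_bound _ (fun n => Fdd_majorant b M n * x ^ n)).
    intros; now apply Fdd_term_bound. now apply Fdd_majorant_summable.
    generalize (Rle_abs (Series (fun n => Fdd_majorant b M n * x ^ n))). lra.
Qed.

Lemma Fdd_diff b x v v' L : 0 < b -> 0 <= x -> (Fdd b x (v :: L) - Fdd b x (v' :: L) = (v - v') * Fdd b x (v :: v' :: L))%C.
Proof.
  intros Hb Hx. unfold Fdd. rewrite <- CSeries_minus, <- CSeries_scal by now apply Fdd_summable.
  apply CSeries_ext. intros n. unfold Fdd_coef.
  transitivity ((dd (v :: L) n - dd (v' :: L) n) * RtoC (Phi_beta b n) * RtoC (x ^ n))%C. ring.
  rewrite dd_diff. ring.
Qed.

(** For distinct nodes both sides are the same difference quotient, while the recursive definition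
    singles out the head of the list. *)
Lemma Fdd_sym b x v w : 0 < b -> 0 <= x -> Fdd b x (v :: w :: nil) = Fdd b x (w :: v :: nil).
Proof.
  intros Hb Hx. destruct (C_eq_dec v w) as [->|E]; auto.
  assert (N : (v - w <> 0)%C). { intros K. apply E. replace v with (v - w + w)%C by ring. rewrite K; ring. }
  assert (H1 := Fdd_diff b x v w nil Hb Hx). assert (H2 := Fdd_diff b x w v nil Hb Hx).
  replace (Fdd b x (v :: w :: nil)) with ((Fdd b x (v :: nil) - Fdd b x (w :: nil)) / (v - w))%C by (rewrite H1; field; auto).
  replace (Fdd b x (v :: nil) - Fdd b x (w :: nil))%C with (- (Fdd b x (w :: nil) - Fdd b x (v :: nil)))%C by ring.
  rewrite H2. field; auto.
Qed.

Lemma Fdd_conj b x L : Fdd b x (map Cconj L) = Cconj (Fdd b x L).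
Proof.
  unfold Fdd. rewrite <- CSeries_conj. apply CSeries_ext. intros n. unfold Fdd_coef. rewrite dd_conj, !Cmult_conj.
  f_equal; [f_equal|]; apply C_ext; unfold Re, Im; simpl; ring.
Qed.

(** The error is [v - v'] times the change of a first divided difference from the nodes [v, v'] to
    [w, w]. Moving one node at a time turns this change into small factors times bounded second
    divided differences. *)
Lemma Fdd_sder b x w : 0 < b -> 0 <= x -> sder (fun v => Fdd b x (v :: nil)) w (Fdd b x (w :: w :: nil)).
Proof.
  intros Hb Hx. destruct (Fdd_bound b x (Cmod w + 1)) as [K [HK HF]]; auto. { generalize (Cmod_ge_0 w); lra. }
  assert (Hw : Cmod w <= Cmod w + 1) by lra.
  apply sder_of_bound. intros e He. exists (Rmin 1 (e / (2 * K))).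
  assert (A1 := Rmin_l 1 (e / (2 * K))). assert (A2 := Rmin_r 1 (e / (2 * K))).
  split. { apply Rmin_glb_lt. lra. apply Rdiv_lt_0_compat; lra. }
  intros v v' Hv Hv'. rewrite Fdd_diff by auto.
  assert (Hn : forall y, Cmod (y - w) <= 1 -> Cmod y <= Cmod w + 1).
  { intros y Hy. generalize (Cmod_triangle (y - w) w). replace (y - w + w)%C with y by ring. lra. }
  assert (N := Hn v ltac:(lra)). assert (N' := Hn v' ltac:(lra)).
  replace ((v - v') * Fdd b x (v :: v' :: nil) - Fdd b x (w :: w :: nil) * (v - v'))%C with
    ((v - v') * ((Fdd b x (v :: v' :: nil) - Fdd b x (w :: v' :: nil)) + (Fdd b x (v' :: w :: nil) - Fdd b x (w :: w :: nil))))%C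
    by (rewrite (Fdd_sym b x v' w) by auto; ring).
  rewrite !Fdd_diff by auto. rewrite Cmod_mult, Rmult_comm. apply Rmult_le_compat_r. apply Cmod_ge_0.
  eapply Rle_trans. apply Cmod_triangle. rewrite !Cmod_mult.
  assert (B1 : Cmod (Fdd b x (v :: w :: v' :: nil)) <= K) by (apply HF; repeat (apply List.Forall_cons; [assumption|]); apply List.Forall_nil).
  assert (B2 : Cmod (Fdd b x (v' :: w :: w :: nil)) <= K) by (apply HF; repeat (apply List.Forall_cons; [assumption|]); apply List.Forall_nil).
  assert (Cmod (v - w) * Cmod (Fdd b x (v :: w :: v' :: nil)) <= e / (2 * K) * K) by (apply Rmult_le_compat; try apply Cmod_ge_0; lra).
  assert (Cmod (v' - w) * Cmod (Fdd b x (v' :: w :: w :: nil)) <= e / (2 * K) * K) by (apply Rmult_le_compat; try apply Cmod_ge_0; lra).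
  replace (e / (2 * K) * K) with (e / 2) in * by (field; lra). lra.
Qed.

Lemma Fdd_shol b x w : 0 < b -> 0 <= x -> shol (fun v => Fdd b x (v :: nil)) w.
Proof. intros. eexists. now apply Fdd_sder. Qed.

Lemma Phi_Fdd b x v : 0 < b -> Phi v (RtoC b) (RtoC x) = Fdd b x (v :: nil).
Proof.
  intros Hb. unfold Phi, Fdd. apply CSeries_ext. intros n. unfold Fdd_coef, Phi_beta.
  rewrite dd_single, Cpoch_RtoC, <- RtoC_pow, <- RtoC_mult, RtoC_inv. reflexivity.
  apply Rgt_not_eq, Rmult_lt_0_compat. now apply rpoch_pos. apply INR_fact_lt_0.
Qed.

(** * Kummer's equation in self-adjoint form *)

Lemma CV_radius_dominated (a m : nat -> R) :
  (forall n, Rabs (a n) <= m n) -> CV_radius m = p_infty -> CV_radius a = p_infty.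
Proof.
  intros H Hm. destruct (Rbar_lt_le_dec (CV_radius a) p_infty) as [K|K].
  2:{ destruct (CV_radius a); simpl in K; tauto. }
  exfalso. assert (K0 := CV_radius_ge_0 a). destruct (CV_radius a) as [r| |] eqn:E; simpl in K, K0; try tauto.
  apply (CV_disk_outside a (r + 1)). { rewrite E. simpl. rewrite Rabs_right; lra. }
  apply ex_series_lim_0.
  apply (ex_series_le (K := R_AbsRing) (V := R_CompleteNormedModule)) with (fun n => m n * (r + 1) ^ n).
  - intros n. change (Rabs (a n * (r + 1) ^ n) <= m n * (r + 1) ^ n).
    assert (0 <= (r + 1) ^ n) by (apply pow_le; lra).
    rewrite Rabs_mult, (Rabs_right ((r + 1) ^ n)) by lra. apply Rmult_le_compat_r; auto.
  - apply (ex_pseries_R m (r + 1)). apply CV_radius_inside. now rewrite Hm.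
Qed.

(** The hypothesis compares the coefficients of [x^n]: [x r''] and [b r'] together give
    [(n + 1) (b + n) r_(n+1)], and [x r'] gives [n r_n]. *)
Lemma kummer_real (b : R) (r g : nat -> R) (x : R) : CV_radius r = p_infty ->
  (forall n, INR (S n) * (b + INR n) * r (S n) - INR n * r n = g n) ->
  x * PSeries (PS_derive (PS_derive r)) x + (b - x) * PSeries (PS_derive r) x = PSeries g x.
Proof.
  intros Hr Hg.
  assert (C1 : CV_radius (PS_derive r) = p_infty) by now rewrite CV_radius_derive.
  assert (C2 : CV_radius (PS_derive (PS_derive r)) = p_infty) by now rewrite CV_radius_derive.
  assert (E : forall a, CV_radius a = p_infty -> ex_pseries a x).
  { intros a Ha. apply CV_radius_inside. now rewrite Ha. }
  transitivity (x * PSeries (PS_derive (PS_derive r)) x + b * PSeries (PS_derive r) x - x * PSeries (PS_derive r) x); [ring|].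
  rewrite <- !PSeries_incr_1, <- PSeries_scal, <- PSeries_plus, <- PSeries_minus.
  - apply PSeries_ext. intros n. rewrite <- Hg. unfold PS_minus, PS_plus, PS_opp, PS_scal, PS_incr_1, PS_derive.
    change plus with Rplus; change opp with Ropp; change scal with Rmult. destruct n as [|n].
    + change (zero : R_NormedModule) with 0. rewrite S_INR. simpl. ring.
    + rewrite !S_INR. ring.
  - apply ex_pseries_plus. apply ex_pseries_incr_1; auto. apply (ex_pseries_scal (V := R_NormedModule)); [apply Rmult_comm|auto].
  - apply ex_pseries_incr_1; auto.
  - apply ex_pseries_incr_1; auto.
  - apply (ex_pseries_scal (V := R_NormedModule)); [apply Rmult_comm|auto].
Qed.

Definition Fdd_re (b : R) (L : list C) (n : nat) : R := Re (Fdd_coef b L n).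
Definition Fdd_im (b : R) (L : list C) (n : nat) : R := Im (Fdd_coef b L n).

Lemma Fdd_PSeries b x L : Fdd b x L = (PSeries (Fdd_re b L) x, PSeries (Fdd_im b L) x).
Proof.
  unfold Fdd, CSeries, PSeries. f_equal; apply Series_ext; intros n; unfold Fdd_re, Fdd_im, Re, Im; simpl; ring.
Qed.

Lemma Fdd_re_radius b L : 0 < b -> CV_radius (Fdd_re b L) = p_infty.
Proof.
  intros Hb. destruct (Forall_Cmod_bound L) as [M [HM HL]].
  apply CV_radius_dominated with (Fdd_majorant b M); [|now apply Fdd_majorant_radius].
  intros n. eapply Rle_trans. apply Rabs_Re_le. now apply Fdd_coef_bound.
Qed.
Lemma Fdd_im_radius b L : 0 < b -> CV_radius (Fdd_im b L) = p_infty.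
Proof.
  intros Hb. destruct (Forall_Cmod_bound L) as [M [HM HL]].
  apply CV_radius_dominated with (Fdd_majorant b M); [|now apply Fdd_majorant_radius].
  intros n. eapply Rle_trans. apply Rabs_Im_le. now apply Fdd_coef_bound.
Qed.

Definition dFdd (b x : R) (L : list C) : C := (PSeries (PS_derive (Fdd_re b L)) x, PSeries (PS_derive (Fdd_im b L)) x).
Definition ddFdd (b x : R) (L : list C) : C :=
  (PSeries (PS_derive (PS_derive (Fdd_re b L))) x, PSeries (PS_derive (PS_derive (Fdd_im b L))) x).

Lemma Rder_Fdd b x L : 0 < b -> Rder (fun x => Fdd b x L) x (dFdd b x L).
Proof.
  intros Hb. apply Rder_ext with (fun x => (PSeries (Fdd_re b L) x, PSeries (Fdd_im b L) x)).
  { intros; now rewrite Fdd_PSeries. }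
  apply Rder_pair; apply is_derive_PSeries; [rewrite Fdd_re_radius|rewrite Fdd_im_radius]; simpl; auto.
Qed.

Lemma Rder_dFdd b x L : 0 < b -> Rder (fun x => dFdd b x L) x (ddFdd b x L).
Proof.
  intros Hb. apply Rder_pair; apply is_derive_PSeries; rewrite CV_radius_derive;
  [rewrite Fdd_re_radius|rewrite Fdd_im_radius]; simpl; auto.
Qed.

Lemma Fdd_coef_S b v L n : 0 < b ->
  (RtoC (INR (S n)) * RtoC (b + INR n) * Fdd_coef b (v :: L) (S n) = (v + RtoC (INR n)) * Fdd_coef b (v :: L) n + Fdd_coef b L n)%C.
Proof.
  intros Hb. unfold Fdd_coef. rewrite dd_S, <- (Phi_beta_S b n Hb), !RtoC_mult. ring.
Qed.

(** This is the divided difference, in the parameter, of Kummer's equation. An empty [L] gives the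
    homogeneous equation; [L = m :: nil] with [v = m] gives the equation of the parameter
    derivative, whose source term is the solution itself. *)
Lemma kummer_Fdd b x v L : 0 < b ->
  (RtoC x * ddFdd b x (v :: L) + RtoC (b - x) * dFdd b x (v :: L) = v * Fdd b x (v :: L) + Fdd b x L)%C.
Proof.
  intros Hb. rewrite !Fdd_PSeries.
  assert (E : forall a, CV_radius a = p_infty -> ex_pseries a x).
  { intros a Ha. apply CV_radius_inside. now rewrite Ha. }
  assert (E1 := E _ (Fdd_re_radius b (v :: L) Hb)). assert (E2 := E _ (Fdd_im_radius b (v :: L) Hb)).
  assert (E3 := E _ (Fdd_re_radius b L Hb)). assert (E4 := E _ (Fdd_im_radius b L Hb)).
  assert (SC : forall (c : R) (a : nat -> R), ex_pseries (V := R_NormedModule) a x -> ex_pseries (V := R_NormedModule) (PS_scal c a) x).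
  { intros c a Ha. apply (ex_pseries_scal (V := R_NormedModule)); [apply Rmult_comm|auto]. }
  assert (R1 : forall n, INR (S n) * (b + INR n) * Fdd_re b (v :: L) (S n) - INR n * Fdd_re b (v :: L) n =
     Re v * Fdd_re b (v :: L) n - Im v * Fdd_im b (v :: L) n + Fdd_re b L n).
  { intros n. generalize (f_equal Re (Fdd_coef_S b v L n Hb)). unfold Fdd_re, Fdd_im.
    generalize (Fdd_coef b (v :: L) (S n)) (Fdd_coef b (v :: L) n) (Fdd_coef b L n) (INR (S n)) (INR n). intros p q r k m.
    unfold Re, Im; cbn -[Rmult Rplus Rminus]; intros H.
    match type of H with ?l = _ => transitivity (l - m * fst q) end. ring. rewrite H. ring. }
  assert (R2 : forall n, INR (S n) * (b + INR n) * Fdd_im b (v :: L) (S n) - INR n * Fdd_im b (v :: L) n =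
     Re v * Fdd_im b (v :: L) n + Im v * Fdd_re b (v :: L) n + Fdd_im b L n).
  { intros n. generalize (f_equal Im (Fdd_coef_S b v L n Hb)). unfold Fdd_re, Fdd_im.
    generalize (Fdd_coef b (v :: L) (S n)) (Fdd_coef b (v :: L) n) (Fdd_coef b L n) (INR (S n)) (INR n). intros p q r k m.
    unfold Re, Im; cbn -[Rmult Rplus Rminus]; intros H.
    match type of H with ?l = _ => transitivity (l - m * snd q) end. ring. rewrite H. ring. }
  assert (K1 := kummer_real b _ _ x (Fdd_re_radius b (v :: L) Hb) R1).
  assert (K2 := kummer_real b _ _ x (Fdd_im_radius b (v :: L) Hb) R2).
  assert (G1 : PSeries (fun n => Re v * Fdd_re b (v :: L) n - Im v * Fdd_im b (v :: L) n + Fdd_re b L n) x =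
    Re v * PSeries (Fdd_re b (v :: L)) x - Im v * PSeries (Fdd_im b (v :: L)) x + PSeries (Fdd_re b L) x).
  { rewrite <- !PSeries_scal, <- PSeries_minus, <- PSeries_plus; auto.
    apply (ex_pseries_minus (V := R_NormedModule)); auto. }
  assert (G2 : PSeries (fun n => Re v * Fdd_im b (v :: L) n + Im v * Fdd_re b (v :: L) n + Fdd_im b L n) x =
    Re v * PSeries (Fdd_im b (v :: L)) x + Im v * PSeries (Fdd_re b (v :: L)) x + PSeries (Fdd_im b L) x).
  { rewrite <- !PSeries_scal, <- !PSeries_plus; auto.
    apply (ex_pseries_plus (V := R_NormedModule)); auto. }
  unfold dFdd, ddFdd. apply C_ext; unfold Re, Im in *; simpl.
  - rewrite G1 in K1. match goal with |- ?l = ?r => transitivity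
      (x * PSeries (PS_derive (PS_derive (Fdd_re b (v :: L)))) x + (b - x) * PSeries (PS_derive (Fdd_re b (v :: L))) x) end.
    ring. rewrite K1. ring.
  - rewrite G2 in K2. match goal with |- ?l = ?r => transitivity
      (x * PSeries (PS_derive (PS_derive (Fdd_im b (v :: L)))) x + (b - x) * PSeries (PS_derive (Fdd_im b (v :: L))) x) end.
    ring. rewrite K2. ring.
Qed.

(* The Sturm-Liouville coefficient [x^b e^(-x)] and the weight [x^(b-1) e^(-x)]. *)
Definition pw (b x : R) : R := exp (b * ln x - x).
Definition wt (b x : R) : R := pw b x / x.

Lemma pw_pos b x : 0 < pw b x.
Proof. apply exp_pos. Qed.

Lemma wt_pos b x : 0 < x -> 0 < wt b x.
Proof. intros. apply Rdiv_lt_0_compat; auto. apply pw_pos. Qed.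

Lemma is_derive_pw b x : 0 < x -> is_derive (pw b) x ((b / x - 1) * pw b x).
Proof. intros Hx. unfold pw. auto_derive; auto. unfold Rminus. field; lra. Qed.

Lemma Rder_pw b x : 0 < x -> Rder (fun x => RtoC (pw b x)) x (RtoC ((b / x - 1) * pw b x)).
Proof. intros Hx. apply Rder_pair. now apply is_derive_pw. apply (is_derive_const (V := R_NormedModule)). Qed.

(** Since [pw' / pw = b / x - 1], multiplication by [pw / x] turns the operator [x y'' + (b - x) y']
    into [(pw y')']. *)
Lemma Rder_pw_dFdd b x v L : 0 < b -> 0 < x ->
  Rder (fun x => RtoC (pw b x) * dFdd b x (v :: L))%C x (RtoC (wt b x) * (v * Fdd b x (v :: L) + Fdd b x L))%C.
Proof.
  intros Hb Hx. assert (K := Rder_mult _ _ _ _ _ (Rder_pw b x Hx) (Rder_dFdd b x (v :: L) Hb)).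
  rewrite <- kummer_Fdd by auto.
  match type of K with Rder _ _ ?l => match goal with |- Rder _ _ ?r => replace r with l end end. exact K.
  unfold wt. assert (Hx' : RtoC x <> 0%R) by (intros E; injection E; lra).
  replace (RtoC ((b / x - 1) * pw b x)) with (RtoC (pw b x / x) * RtoC (b - x))%C.
  2:{ rewrite <- RtoC_mult. f_equal. field. lra. }
  replace (RtoC (pw b x)) with (RtoC (pw b x / x) * RtoC x)%C.
  2:{ rewrite <- RtoC_mult. f_equal. field. lra. }
  ring.
Qed.

Lemma pw_lim_0 b : 0 < b -> forall e, 0 < e -> exists d, 0 < d /\ forall x, 0 < x < d -> pw b x < e.
Proof.
  intros Hb e He. exists (exp (ln e / b)). split. apply exp_pos. intros x [H1 H2].
  unfold pw. apply Rlt_trans with (exp (b * ln x)). apply exp_increasing; lra.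
  replace e with (exp (ln e)) by (now apply exp_ln). apply exp_increasing.
  apply ln_increasing in H2; auto. rewrite ln_exp in H2.
  apply Rmult_lt_compat_l with (r := b) in H2; auto. replace (b * (ln e / b)) with (ln e) in H2 by (field; lra). auto.
Qed.

(** * Improper integrals against the weight *)

(* [J b z g v]: the integral of [wt b * g] over [(0, z]] is [v], expressed
   through a primitive vanishing at [0+]. *)
Definition J (b z : R) (g : R -> R) (v : R) : Prop :=
  exists I : R -> R, (forall x, 0 < x -> is_derive I x (wt b x * g x)) /\
    (forall e, 0 < e -> exists d, 0 < d /\ forall x, 0 < x < d -> Rabs (I x) < e) /\ I z = v.

Lemma J_plus b z g h u v : J b z g u -> J b z h v -> J b z (fun x => g x + h x) (u + v).
Proof.
  intros [I [H1 [H2 H3]]] [K [H1' [H2' H3']]]. exists (fun x => I x + K x). split; [|split].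
  - intros x Hx. replace (wt b x * (g x + h x)) with (wt b x * g x + wt b x * h x) by ring.
    apply (is_derive_plus (V := R_NormedModule)); auto.
  - intros e He. destruct (H2 (e/2)) as [d [Hd Hb]]; [lra|]. destruct (H2' (e/2)) as [d' [Hd' Hb']]; [lra|].
    exists (Rmin d d'). split. now apply Rmin_glb_lt. intros x Hx.
    assert (A1 := Rmin_l d d'). assert (A2 := Rmin_r d d').
    eapply Rle_lt_trans. apply Rabs_triang. specialize (Hb x ltac:(lra)). specialize (Hb' x ltac:(lra)). lra.
  - congruence.
Qed.

Lemma J_scal b z c g v : J b z g v -> J b z (fun x => c * g x) (c * v).
Proof.
  intros [I [H1 [H2 H3]]]. exists (fun x => c * I x). split; [|split].
  - intros x Hx. replace (wt b x * (c * g x)) with (c * (wt b x * g x)) by ring.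
    apply (is_derive_scal I); auto.
  - intros e He. assert (Hc : 0 < Rabs c + 1) by (generalize (Rabs_pos c); lra).
    destruct (H2 (e / (Rabs c + 1))) as [d [Hd Hb]]. now apply Rdiv_lt_0_compat.
    exists d; split; auto. intros x Hx. rewrite Rabs_mult. specialize (Hb x Hx).
    apply Rle_lt_trans with ((Rabs c + 1) * Rabs (I x)). generalize (Rabs_pos (I x)); lra.
    replace e with ((Rabs c + 1) * (e / (Rabs c + 1))) by (field; lra). now apply Rmult_lt_compat_l.
  - congruence.
Qed.

Lemma J_ext b z g h v : (forall x, 0 < x -> g x = h x) -> J b z g v -> J b z h v.
Proof. intros E [I [H1 H2]]. exists I. split; auto. intros x Hx. rewrite <- E; auto. Qed.

(** A negative value of the primitive would persist, by monotonicity, all the way down to 0, where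
    the primitive vanishes. *)
Lemma J_primitive_increasing b z g v : 0 < z -> (forall x, 0 < x -> 0 <= g x) -> J b z g v ->
  exists I, (forall x, 0 < x -> is_derive I x (wt b x * g x)) /\ I z = v /\
    (forall x, 0 < x -> 0 <= I x) /\ (forall x y, 0 < x <= y -> I x <= I y).
Proof.
  intros Hz Hg [I [H1 [H2 H3]]]. exists I. split; [auto|split;[auto|]].
  assert (M : forall x y, 0 < x <= y -> I x <= I y).
  { intros x y Hxy. destruct (Req_dec x y) as [->|N]; [lra|].
    destruct (MVT_gen I x y (fun t => wt b t * g t)) as [c [Hc E]].
    - rewrite Rmin_left, Rmax_right by lra. intros; apply H1; lra.
    - rewrite Rmin_left, Rmax_right by lra. intros t Ht. apply continuity_pt_filterlim.
      apply (ex_derive_continuous (V := R_NormedModule)). eexists. apply H1; lra.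
    - rewrite Rmin_left, Rmax_right in Hc by lra.
      assert (0 <= wt b c * g c * (y - x)).
      { apply Rmult_le_pos; [apply Rmult_le_pos|lra]. left; apply wt_pos; lra. apply Hg; lra. }
      lra. }
  split; auto. intros x Hx. apply Rnot_lt_le. intros K.
  destruct (H2 (- I x)) as [d [Hd Hb]]; [lra|].
  set (y := Rmin d x / 2). assert (A1 := Rmin_l d x). assert (A2 := Rmin_r d x).
  assert (A3 : 0 < Rmin d x) by now apply Rmin_glb_lt.
  assert (Hy := Hb y ltac:(unfold y; lra)). assert (Hm := M y x ltac:(unfold y; lra)).
  apply Rabs_lt_between in Hy. lra.
Qed.

Lemma J_pos b z g v : 0 < z -> (forall x, 0 < x -> 0 <= g x) -> J b z g v -> 0 <= v.
Proof.
  intros Hz Hg HJ. destruct (J_primitive_increasing b z g v Hz Hg HJ) as [I [_ [E [H _]]]].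
  rewrite <- E. auto.
Qed.

Lemma J_strict_pos b z g v d : 0 < z -> 0 < d -> (forall x, 0 < x -> 0 <= g x) -> (forall x, 0 < x < d -> 0 < g x) ->
  J b z g v -> 0 < v.
Proof.
  intros Hz Hd Hg Hs HJ. destruct (J_primitive_increasing b z g v Hz Hg HJ) as [I [H1 [E [H2 H3]]]].
  rewrite <- E. set (y := Rmin d z / 2). assert (A1 := Rmin_l d z). assert (A2 := Rmin_r d z).
  assert (A3 : 0 < Rmin d z) by now apply Rmin_glb_lt.
  assert (Hy : 0 < y < d /\ y <= z) by (unfold y; lra).
  assert (M1 := H3 y z ltac:(lra)). assert (M2 := H2 (y/2) ltac:(lra)).
  destruct (MVT_gen I (y/2) y (fun t => wt b t * g t)) as [c [Hc Ec]].
  - rewrite Rmin_left, Rmax_right by lra. intros; apply H1; lra.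
  - rewrite Rmin_left, Rmax_right by lra. intros t Ht. apply continuity_pt_filterlim.
    apply (ex_derive_continuous (V := R_NormedModule)). eexists. apply H1; lra.
  - rewrite Rmin_left, Rmax_right in Hc by lra.
    assert (0 < wt b c * g c * (y - y/2)).
    { apply Rmult_lt_0_compat; [apply Rmult_lt_0_compat|lra]. apply wt_pos; lra. apply Hs; lra. }
    lra.
Qed.

Fixpoint psum (f : nat -> R) (N : nat) : R := match N with O => 0 | S n => psum f n + f n end.

(** Induction on [N] by subtracting the projection onto the last function; orthogonality leaves the
    earlier coefficients unchanged. The pair [A, B], meant as real and imaginary part, must be
    arbitrary because the projection changes it. *)
Lemma bessel b z (eig : nat -> R -> R) (eig_norm : nat -> R) (N : nat) : 0 < z ->
  (forall k, (k < N)%nat -> 0 < eig_norm k /\ J b z (fun x => eig k x * eig k x) (eig_norm k)) ->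
  (forall j k, (j < N)%nat -> (k < N)%nat -> j <> k -> J b z (fun x => eig j x * eig k x) 0) ->
  forall (A B : R -> R) (a c : nat -> R) (v : R),
  J b z (fun x => A x * A x + B x * B x) v ->
  (forall k, (k < N)%nat -> J b z (fun x => A x * eig k x) (a k)) ->
  (forall k, (k < N)%nat -> J b z (fun x => B x * eig k x) (c k)) ->
  psum (fun k => (a k * a k + c k * c k) / eig_norm k) N <= v.
Proof.
  intros Hz. induction N as [|N IH]; intros Hn Ho A B a c v Hv Ha Hc; simpl.
  - apply (J_pos b z _ v Hz) with (2 := Hv). intros; nra.
  - destruct (Hn N) as [Hp HN]; [lia|].
    assert (Ha' := Ha N ltac:(lia)). assert (Hc' := Hc N ltac:(lia)).
    set (s := a N / eig_norm N). set (t := c N / eig_norm N).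
    assert (K : psum (fun k => (a k * a k + c k * c k) / eig_norm k) N <= v - (a N * a N + c N * c N) / eig_norm N).
    { apply (IH ltac:(intros; apply Hn; lia) ltac:(intros; apply Ho; lia)
        (fun x => A x - s * eig N x) (fun x => B x - t * eig N x) a c).
      - assert (K1 := J_plus _ _ _ _ _ _ Hv (J_plus _ _ _ _ _ _ (J_scal _ _ (- 2 * s) _ _ Ha')
          (J_plus _ _ _ _ _ _ (J_scal _ _ (- 2 * t) _ _ Hc') (J_scal _ _ (s * s + t * t) _ _ HN)))).
        cbv beta in K1.
        replace (v - (a N * a N + c N * c N) / eig_norm N) with
          (v + (-2 * s * a N + (-2 * t * c N + (s * s + t * t) * eig_norm N))).
        + revert K1. apply J_ext. intros; ring.
        + unfold s, t. field. lra.
      - intros k Hk. assert (K1 := J_plus _ _ _ _ _ _ (Ha k ltac:(lia)) (J_scal _ _ (- s) _ _ (Ho N k ltac:(lia) ltac:(lia) ltac:(lia)))).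
        replace (a k) with (a k + - s * 0) by ring. revert K1. apply J_ext. intros; ring.
      - intros k Hk. assert (K1 := J_plus _ _ _ _ _ _ (Hc k ltac:(lia)) (J_scal _ _ (- t) _ _ (Ho N k ltac:(lia) ltac:(lia) ltac:(lia)))).
        replace (c k) with (c k + - t * 0) by ring. revert K1. apply J_ext. intros; ring. }
    lra.
Qed.

Definition JC (b z : R) (g : R -> C) (v : C) : Prop :=
  J b z (fun x => Re (g x)) (Re v) /\ J b z (fun x => Im (g x)) (Im v).

(** The boundary term at 0 disappears because [pw] tends to 0 there while [K] stays bounded. *)
Lemma JC_of_primitive b z (g K : R -> C) : 0 < b ->
  (forall x, 0 < x -> Rder (fun x => RtoC (pw b x) * K x)%C x (RtoC (wt b x) * g x)%C) -> Ccont K 0 ->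
  JC b z g (RtoC (pw b z) * K z)%C.
Proof.
  intros Hb HK HC.
  assert (Hlim : forall e, 0 < e -> exists d, 0 < d /\ forall x, 0 < x < d -> Cmod (RtoC (pw b x) * K x) < e).
  { intros e He. set (m := Cmod (K 0) + 1). assert (Hm : 0 < m) by (unfold m; generalize (Cmod_ge_0 (K 0)); lra).
    destruct (pw_lim_0 b Hb (e / m)) as [d [Hd Hp]]; [now apply Rdiv_lt_0_compat|].
    destruct (proj1 (Ccont_eps _ _) HC 1 Rlt_0_1) as [d' Hd'].
    exists (Rmin d d'). split. { apply Rmin_glb_lt; auto. apply cond_pos. }
    intros x Hx. assert (A1 := Rmin_l d d'). assert (A2 := Rmin_r d d').
    assert (E1 := Hp x ltac:(lra)). assert (E2 : Cmod (K x - K 0) < 1).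
    { apply Hd'. change (Rabs (x - 0) < d'). rewrite Rabs_right; lra. }
    assert (E3 := Cmod_ge_sub (K x) (K 0)). rewrite Cmod_mult, Cmod_R, Rabs_right.
    2:{ left. apply pw_pos. }
    apply Rle_lt_trans with (pw b x * m). { apply Rmult_le_compat_l. left; apply pw_pos. unfold m; lra. }
    apply Rmult_lt_compat_r with (r := m) in E1; auto. replace (e / m * m) with e in E1 by (field; lra). auto. }
  split.
  - exists (fun x => Re (RtoC (pw b x) * K x)). split; [|split]; auto.
    + intros x Hx. destruct (Rder_is_derive _ _ _ (HK x Hx)) as [D _].
      replace (wt b x * Re (g x)) with (Re (RtoC (wt b x) * g x)) by (unfold Re; simpl; ring). exact D.
    + intros e He. destruct (Hlim e He) as [d [Hd H]]. exists d; split; auto. intros x Hx.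
      eapply Rle_lt_trans. apply Rabs_Re_le. auto.
  - exists (fun x => Im (RtoC (pw b x) * K x)). split; [|split]; auto.
    + intros x Hx. destruct (Rder_is_derive _ _ _ (HK x Hx)) as [_ D].
      replace (wt b x * Im (g x)) with (Im (RtoC (wt b x) * g x)) by (unfold Im; simpl; ring). exact D.
    + intros e He. destruct (Hlim e He) as [d [Hd H]]. exists d; split; auto. intros x Hx.
      eapply Rle_lt_trans. apply Rabs_Im_le. auto.
Qed.

(** * Green's identities for Kummer functions *)

Lemma Fdd_nil b x : Fdd b x nil = 0%R.
Proof.
  assert (E : forall n, (Fdd_coef b nil n * RtoC (x ^ n) = 0)%C) by (intros n; unfold Fdd_coef; rewrite dd_nil; ring).
  unfold Fdd. rewrite (CSeries_ext _ _ E). unfold CSeries.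
  assert (Z : Series (fun _ => 0) = 0) by (rewrite (Series_ext _ (fun _ => 0 * 0)) by (intros; ring); rewrite Series_scal_l; ring).
  apply C_ext; exact Z.
Qed.

(** Lagrange's identity: the derivative of [pw (y_v' y_m - y_v y_m')] is [(v - m) wt y_v y_m]. *)
Lemma JC_product b z v m : 0 < b -> v <> m ->
  JC b z (fun x => Fdd b x (v :: nil) * Fdd b x (m :: nil))%C
    (RtoC (pw b z) * ((dFdd b z (v :: nil) * Fdd b z (m :: nil) - Fdd b z (v :: nil) * dFdd b z (m :: nil)) / (v - m)))%C.
Proof.
  intros Hb N. assert (N' : (v - m <> 0)%C). { intros K. apply N. replace v with (v - m + m)%C by ring. rewrite K; ring. }
  apply (JC_of_primitive b z _ (fun x => (dFdd b x (v :: nil) * Fdd b x (m :: nil) - Fdd b x (v :: nil) * dFdd b x (m :: nil)) / (v - m))%C); auto.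
  - intros x Hx.
    assert (K1 := Rder_mult _ _ _ _ _ (Rder_pw_dFdd b x v nil Hb Hx) (Rder_Fdd b x (m :: nil) Hb)).
    assert (K2 := Rder_mult _ _ _ _ _ (Rder_pw_dFdd b x m nil Hb Hx) (Rder_Fdd b x (v :: nil) Hb)).
    assert (K3 := Rder_mult _ _ _ _ _ (Rder_plus _ _ _ _ _ K1 (Rder_mult _ _ _ _ _ (Rder_const (- RtoC 1)%C x) K2)) (Rder_const (/ (v - m))%C x)).
    cbv beta in K3.
    match type of K3 with Rder _ _ ?l => replace (RtoC (wt b x) * (Fdd b x (v :: nil) * Fdd b x (m :: nil)))%C with l end.
    + revert K3. apply Rder_ext. intros s. unfold Cdiv. ring.
    + rewrite Fdd_nil. field. auto.
  - apply Ccont_div; [|apply Ccont_const|auto].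
    apply Ccont_minus; apply Ccont_mult; eapply Rder_cont; try (now apply Rder_Fdd); now apply Rder_dFdd.
Qed.

(** The confluent case of Lagrange's identity. The parameter derivative of the solution replaces the
    difference quotient, and the source term of its equation supplies the square. *)
Lemma JC_square b z m : 0 < b ->
  JC b z (fun x => Fdd b x (m :: nil) * Fdd b x (m :: nil))%C
    (RtoC (pw b z) * (dFdd b z (m :: m :: nil) * Fdd b z (m :: nil) - Fdd b z (m :: m :: nil) * dFdd b z (m :: nil)))%C.
Proof.
  intros Hb.
  apply (JC_of_primitive b z _ (fun x => dFdd b x (m :: m :: nil) * Fdd b x (m :: nil) - Fdd b x (m :: m :: nil) * dFdd b x (m :: nil))%C); auto.
  - intros x Hx.
    assert (K1 := Rder_mult _ _ _ _ _ (Rder_pw_dFdd b x m (m :: nil) Hb Hx) (Rder_Fdd b x (m :: nil) Hb)).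
    assert (K2 := Rder_mult _ _ _ _ _ (Rder_pw_dFdd b x m nil Hb Hx) (Rder_Fdd b x (m :: m :: nil) Hb)).
    assert (K3 := Rder_plus _ _ _ _ _ K1 (Rder_mult _ _ _ _ _ (Rder_const (- RtoC 1)%C x) K2)).
    cbv beta in K3.
    match type of K3 with Rder _ _ ?l => replace (RtoC (wt b x) * (Fdd b x (m :: nil) * Fdd b x (m :: nil)))%C with l end.
    + revert K3. apply Rder_ext. intros s. ring.
    + rewrite Fdd_nil. ring.
  - apply Ccont_minus; apply Ccont_mult; eapply Rder_cont; try (now apply Rder_Fdd); now apply Rder_dFdd.
Qed.

Lemma Csub_neq_0 (x y : C) : x <> y -> (x - y <> 0)%C.
Proof. intros N K. apply N. replace x with (x - y + y)%C by ring. rewrite K; ring. Qed.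

Lemma Clim_of_cont (f g : C -> C) (a : C) (d : R) : 0 < d ->
  (forall v, v <> a -> Cmod (v - a) < d -> f v = g v) -> Ccont g a -> Clim f a (g a).
Proof.
  intros Hd Hfg Hg e He.
  destruct (proj1 (locally_Cmod _ _) (proj1 (Ccont_eps _ _) Hg e He)) as [d' [Hd' H]].
  exists (Rmin d d'). split. now apply Rmin_glb_lt. intros v [V1 V2].
  assert (A1 := Rmin_l d d'). assert (A2 := Rmin_r d d').
  rewrite Hfg; [apply H; lra| |lra]. intros ->. replace (a - a)%C with (RtoC 0) in V1 by ring. rewrite Cmod_0 in V1. lra.
Qed.

Lemma Cmod_sqr_conj (v : C) : (v * Cconj v)%C = RtoC (Cmod v * Cmod v).
Proof. rewrite Cmod_sqr. apply C_ext; unfold Re, Im, Cconj; simpl; ring. Qed.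

Lemma Cconj_inj_neq0 (v : C) : v <> 0%R -> Cconj v <> 0%R.
Proof. intros H. apply Cmod_gt_0. rewrite Cmod_conj. now apply Cmod_gt_0. Qed.

(** * A Harnack inequality from the sign of Im (v K(v)) on a circle *)

Section Harnack.
Variables (K : C -> C) (L : list C) (r r' : R).
Hypothesis Hr : 0 < r < r'.
Hypothesis Hhol : forall v, Cmod v < r' -> ~ In v L -> shol K v.
Hypothesis Hcont : forall v, In v L -> Cmod v < r' -> Ccont K v.

Let zt (t : R) : C := (RtoC r * cis t)%C.

Lemma circle_mod t : Cmod (zt t) = r.
Proof. unfold zt. rewrite Cmod_mult, Cmod_cis, Cmod_R, Rabs_right; lra. Qed.

Lemma circle_neq_0 t : zt t <> 0%R.
Proof. apply Cmod_gt_0. rewrite circle_mod. lra. Qed.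

Lemma harnack_mean (g : C -> C) : (forall v, Cmod v < r' -> shol g v) ->
  isCInt (fun t => K (zt t) * g (zt t))%C 0 (2 * PI) (RtoC (2 * PI) * (K 0 * g 0))%C.
Proof.
  intros Hg. apply isCInt_ext with (fun t => K (0 + RtoC r * cis t) * g (0 + RtoC r * cis t))%C.
  { intros t _. unfold zt. now rewrite Cplus_0_l. }
  apply (mean_value_continuous (fun v => K v * g v)%C 0 r r' L Hr).
  - intros v Hv Hn. replace (v - 0)%C with v in Hv by ring. apply shol_mult; auto.
  - intros v Hi Hv. replace (v - 0)%C with v in Hv by ring. apply Ccont_mult; auto. apply shol_cont; auto.
Qed.

(** On the circle the conjugate of [zt] is [r^2 / zt], so the integrand is the conjugate of
    [r^2 / (r^2 - conj(w) zt)]. That function is holomorphic beyond the circle and equals 1 at the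
    centre. *)
Lemma circle_kernel (w : C) : Cmod w < r -> isCInt (fun t => zt t / (zt t - w))%C 0 (2 * PI) (RtoC (2 * PI)).
Proof.
  intros Hw.
  assert (Hrr : RtoC (r * r) <> 0%R). { intros E. injection E. nra. }
  (* The pole of the conjugated kernel has modulus [r^2 / |w| > r]; the case distinction avoids the
     quotient when [w = 0]. *)
  set (r2 := if Rle_dec (Cmod w) 0 then r + 1 else Rmin (r + 1) (r * r / Cmod w)).
  assert (Hr2 : r < r2 /\ forall v, Cmod v < r2 -> (RtoC (r * r) - Cconj w * v)%C <> 0%R).
  { assert (G : forall v, Cmod v * Cmod w < r * r -> (RtoC (r * r) - Cconj w * v)%C <> 0%R).
    { intros v Hv E.
      assert (E2 : RtoC (r * r) = (Cconj w * v)%C). { replace (RtoC (r * r)) with (RtoC (r * r) - Cconj w * v + Cconj w * v)%C by ring. rewrite E; ring. }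
      apply (f_equal Cmod) in E2. rewrite Cmod_mult, Cmod_conj, Cmod_R, Rabs_right in E2 by nra. lra. }
    unfold r2. assert (A2 := Cmod_ge_0 w). destruct (Rle_dec (Cmod w) 0) as [D|D].
    - split. lra. intros v Hv. apply G. replace (Cmod w) with 0 by lra. nra.
    - split.
      + apply Rmin_glb_lt. lra. apply Rmult_lt_reg_r with (Cmod w). lra.
        unfold Rdiv. rewrite Rmult_assoc, Rinv_l by lra. nra.
      + intros v Hv. apply G. assert (A3 := Rmin_r (r + 1) (r * r / Cmod w)).
        apply Rlt_le_trans with (r * r / Cmod w * Cmod w). apply Rmult_lt_compat_r; lra.
        right. field. lra. }
  assert (M : isCInt (fun t => RtoC (r * r) / (RtoC (r * r) - Cconj w * (0 + RtoC r * cis t)))%C 0 (2 * PI)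
     (RtoC (2 * PI) * (RtoC (r * r) / (RtoC (r * r) - Cconj w * 0)))%C).
  { apply (mean_value_continuous (fun v => RtoC (r * r) / (RtoC (r * r) - Cconj w * v))%C 0 r r2 nil ltac:(lra)); [|intros v []].
    intros v Hv _; replace (v - 0)%C with v in Hv by ring.
    apply shol_div; [apply shol_const|apply shol_minus; [apply shol_const|apply shol_mult; [apply shol_const|apply shol_id]]|now apply Hr2]. }
  assert (M' := isCInt_conj _ _ _ _ M).
  cbv beta in M'.
  replace (RtoC (2 * PI)) with (Cconj (RtoC (2 * PI) * (RtoC (r * r) / (RtoC (r * r) - Cconj w * 0)))).
  2:{ replace (RtoC (r * r) / (RtoC (r * r) - Cconj w * 0))%C with (RtoC 1).
      apply C_ext; unfold Re, Im; simpl; ring. field. intros E; apply Hrr. rewrite <- E. ring. }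
  revert M'. apply isCInt_ext. intros t _. rewrite Cplus_0_l. fold (zt t).
  assert (Hc : Cconj (RtoC (r * r)) = RtoC (r * r)) by (apply C_ext; unfold Re, Im; simpl; ring).
  assert (E := Cmod_sqr_conj (zt t)). rewrite circle_mod in E.
  unfold Cdiv. rewrite Cmult_conj, Hc.
  assert (Nz := circle_neq_0 t). assert (Nc := Cconj_inj_neq0 _ Nz).
  assert (Nw : (zt t - w <> 0)%C). { apply Csub_neq_0. intros E3. apply (f_equal Cmod) in E3. rewrite circle_mod in E3. lra. }
  rewrite Cinv_conj. 2:{ apply Hr2. rewrite circle_mod. lra. }
  rewrite Cminus_conj, Cmult_conj, Cconj_conj, Hc, <- E.
  Ceq_type. field. repeat split; auto.
  replace (zt t * Cconj (zt t) - w * Cconj (zt t))%C with ((zt t - w) * Cconj (zt t))%C by ring. now apply Cmult_neq_0.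
Qed.

(** The function [v (K v - K w) / (v - w)] has a removable singularity at [w] and vanishes at the
    centre, so its mean is 0. Adding [K w] times [circle_kernel] gives Cauchy's formula. *)
Lemma cauchy_circle (w : C) : w <> 0%R -> Cmod w < r -> ~ In w L ->
  isCInt (fun t => K (zt t) * (zt t / (zt t - w)))%C 0 (2 * PI) (RtoC (2 * PI) * K w)%C.
Proof.
  intros Hw0 Hw Hn.
  destruct (Hhol w ltac:(lra) Hn) as [l Hl]. assert (Hl' := Hl). destruct Hl as [D [HD [Dl HE]]].
  apply locally_CC in HE. destruct HE as [d [Hd HE]].
  set (f := fun v => ((K v - K w) / (v - w) * v)%C).
  assert (Hf : forall v, v <> w -> Cmod v < r' -> ~ In v L -> shol f v).
  { intros v N Hv Hi. apply shol_mult; [|apply shol_id]. apply shol_div.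
    apply shol_minus; auto. apply shol_const. apply shol_minus. apply shol_id. apply shol_const. now apply Csub_neq_0. }
  destruct (fill_removable f (w :: nil)) as [g [Hg Hgc]].
  { intros a [<-|[]]. exists (D (w, w) * w)%C.
    apply (Clim_of_cont f (fun v => D (v, w) * v)%C w d Hd).
    - intros v N Hv. unfold f. assert (E := HE v w Hv). simpl in E. rewrite E. field. now apply Csub_neq_0.
      replace (w - w)%C with (RtoC 0) by ring. now rewrite Cmod_0.
    - apply Ccont_mult; [|apply Ccont_id].
      apply Ccont_eps. intros e He. assert (K0 := proj1 (Ccont_eps _ _) HD e He). apply locally_CC in K0.
      destruct K0 as [d0 [Hd0 K0]]. apply locally_Cmod. exists d0; split; auto. intros v Hv. apply K0; auto.
      replace (w - w)%C with (RtoC 0) by ring. now rewrite Cmod_0. }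
  assert (Hgf : forall v, v <> w -> g v = f v) by (intros v N; apply Hg; intros [E|[]]; auto).
  assert (Hloc : forall v, v <> w -> locally (T := C_UniformSpace) v (fun y => f y = g y)).
  { intros v N. generalize (locally_not_In (w :: nil) v (fun E => match E with or_introl Fdd => N (eq_sym Fdd) | or_intror Fdd => Fdd end)).
    apply filter_imp. intros y Hy. symmetry. apply Hg. exact Hy. }
  assert (M := mean_value_continuous g 0 r r' (w :: L) Hr).
  assert (Z : isCInt (fun t : R => f (zt t)) 0 (2 * PI) (RtoC 0)).
  { assert (E0 : (RtoC (2 * PI) * g 0 = 0)%C).
    { rewrite Hgf; auto. unfold f. ring. }
    rewrite <- E0. apply isCInt_ext with (fun t => g (0 + RtoC r * cis t)%C).
    { intros t _. rewrite Cplus_0_l. fold (zt t). apply Hgf. intros E. apply (f_equal Cmod) in E. rewrite circle_mod in E. lra. }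
    apply M.
    - intros v Hv Hi. replace (v - 0)%C with v in Hv by ring.
      assert (N : v <> w) by (intros ->; apply Hi; now left).
      apply shol_ext_loc with f; auto. apply Hf; auto. intros I; apply Hi; now right.
    - intros v Hi Hv. replace (v - 0)%C with v in Hv by ring.
      destruct (C_eq_dec v w) as [->|N]. apply Hgc; now left.
      destruct Hi as [E|Hi]; [congruence|].
      assert (Cf : Ccont f v).
      { apply Ccont_mult; [|apply Ccont_id]. apply Ccont_div. apply Ccont_minus; auto. apply Ccont_const.
        apply Ccont_minus. apply Ccont_id. apply Ccont_const. now apply Csub_neq_0. }
      apply Ccont_eps. intros e He.
      assert (HL := Hloc v N). rewrite <- (locally_singleton _ _ HL).
      generalize (filter_and _ _ HL (proj1 (Ccont_eps _ _) Cf e He)). apply filter_imp. intros y [E1 E2]. now rewrite <- E1. }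
  assert (S := isCInt_plus _ _ _ _ _ _ Z (isCInt_scal (K w) _ _ _ _ (circle_kernel w Hw))). cbv beta in S.
  replace (RtoC (2 * PI) * K w)%C with (0 + K w * RtoC (2 * PI))%C by ring.
  revert S. apply isCInt_ext. intros t _. unfold f.
  assert (N : (zt t - w <> 0)%C). { apply Csub_neq_0. intros E. apply (f_equal Cmod) in E. rewrite circle_mod in E. lra. }
  Ceq_type. field. auto.
Qed.

Hypothesis Hpos : forall v, Cmod v = r -> 0 <= Im (v * K v) * Im v.
Hypothesis Hreal : Im (K 0) = 0.

(** The function [v K(v)] on the circle; its imaginary part has the sign of [sin t] by [Hpos]. *)
Let En (t : R) : C := (zt t * K (zt t))%C.

Lemma circle_conj t : Cconj (zt t) = (RtoC (r * r) / zt t)%C.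
Proof.
  assert (E := Cmod_sqr_conj (zt t)). rewrite circle_mod in E. rewrite <- E. field. apply circle_neq_0.
Qed.

Lemma circle_Im t : Im (zt t) = r * sin t.
Proof. unfold zt. rewrite cis_eq. unfold Im; simpl; ring. Qed.

(* To be used with [k2 t = k1 (- t)]: it replaces [E] by its imaginary part without
   reparametrizing the circle. *)
Lemma circle_antisym (k1 k2 : R -> C) (X Y : C) :
  isCInt (fun t => En t * k1 t)%C 0 (2 * PI) X ->
  isCInt (fun t => En t * k2 t)%C 0 (2 * PI) (RtoC 0) ->
  isCInt (fun t => En t * Cconj (k1 t))%C 0 (2 * PI) (RtoC 0) ->
  isCInt (fun t => En t * Cconj (k2 t))%C 0 (2 * PI) Y ->
  isCInt (fun t => (En t - Cconj (En t)) * (k1 t - k2 t))%C 0 (2 * PI) (X + Cconj Y)%C.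
Proof.
  intros H1 H2 H3 H4. apply isCInt_conj in H3. apply isCInt_conj in H4.
  assert (S := isCInt_plus _ _ _ _ _ _ (isCInt_minus _ _ _ _ _ _ H1 H2) (isCInt_minus _ _ _ _ _ _ H4 H3)).
  cbv beta in S.
  replace (X + Cconj Y)%C with (X - 0 + (Cconj Y - Cconj 0))%C.
  2:{ apply C_ext; unfold Re, Im; simpl; ring. }
  revert S. apply isCInt_ext. intros t _. rewrite !Cmult_conj, !Cconj_conj.
  Ceq_type. ring.
Qed.

Lemma sub_conj (v : C) : (v - Cconj v = 2 * Ci * RtoC (Im v))%C.
Proof. apply C_ext; unfold Re, Im, Cconj; simpl; ring. Qed.

(** [circle_antisym] with [k1 = 1 / zt] and its conjugate as [k2]: the product of the two
    differences is [4 Im En sin t / r], with integral [4 PI Re (K 0)]. This is the mass of the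
    non-negative density that dominates everything below. *)
Lemma harnack_at_0 : is_RInt (fun t => Im (En t) * sin t) 0 (2 * PI) (PI * r * Re (K 0)).
Proof.
  assert (Hrr : RtoC (r * r) <> 0%R). { intros E. injection E. nra. }
  assert (M1 := harnack_mean (fun _ => 1)%C (fun v _ => shol_const _ v)). cbv beta in M1.
  assert (M2 := harnack_mean (fun v => v * v / RtoC (r * r))%C (fun v _ => shol_div _ _ v (shol_mult _ _ v (shol_id v) (shol_id v)) (shol_const _ v) Hrr)). cbv beta in M2.
  assert (N := circle_neq_0).
  assert (A1 : isCInt (fun t => En t * (/ zt t))%C 0 (2 * PI) (RtoC (2 * PI) * K 0)%C).
  { replace (RtoC (2 * PI) * K 0)%C with (RtoC (2 * PI) * (K 0 * 1))%C by ring.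
    revert M1. apply isCInt_ext. intros t _. unfold En.
    Ceq_type. fold (zt t). field. auto. }
  assert (A2 : isCInt (fun t => En t * (Cconj (/ zt t)))%C 0 (2 * PI) (RtoC 0)).
  { replace (RtoC 0) with (RtoC (2 * PI) * (K 0 * (0 * 0 / RtoC (r * r))))%C by (field; auto).
    revert M2. apply isCInt_ext. intros t _. unfold En. fold (zt t). rewrite Cinv_conj, circle_conj by auto.
    Ceq_type. field. split; auto. }
  assert (S := circle_antisym (fun t => / zt t)%C (fun t => Cconj (/ zt t))%C _ (RtoC (2 * PI) * K 0) A1 A2 A2).
  assert (A3 : isCInt (fun t => En t * Cconj (Cconj (/ zt t)))%C 0 (2 * PI) (RtoC (2 * PI) * K 0)%C).
  { revert A1. apply isCInt_ext. intros t _. now rewrite Cconj_conj. }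
  specialize (S A3). cbv beta in S. apply isCInt_pair in S. destruct S as [S _].
  assert (S' := is_RInt_scal (V := R_NormedModule) _ _ _ (r / 4) _ S).
  replace (PI * r * Re (K 0)) with (scal (r / 4) (Re (RtoC (2 * PI) * K 0 + Cconj (RtoC (2 * PI) * K 0))%C)).
  - revert S'. apply (is_RInt_ext (V := R_NormedModule)). intros t _.
    change (r / 4 * Re ((En t - Cconj (En t)) * (/ zt t - Cconj (/ zt t)))%C = Im (En t) * sin t).
    rewrite !sub_conj.
    replace (Im (/ zt t)%C) with (- sin t / r).
    + generalize (Im (En t)). intros e. unfold Re; simpl. field. lra.
    + assert (E : (/ zt t = Cconj (zt t) / RtoC (r * r))%C) by (rewrite circle_conj; field; auto).
      rewrite E. unfold Cdiv. rewrite <- RtoC_inv by nra.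
      assert (G : forall x q, Im (Cconj x * RtoC q) = - Im x * q) by (intros; unfold Im; simpl; ring).
      rewrite G, circle_Im. field. lra.
  - change (r / 4 * Re (RtoC (2 * PI) * K 0 + Cconj (RtoC (2 * PI) * K 0))%C = PI * r * Re (K 0)).
    unfold Re; simpl. field.
Qed.

Lemma harnack_nonneg : 0 <= Re (K 0).
Proof.
  assert (H : 0 <= PI * r * Re (K 0)).
  { apply (is_RInt_ge_0 (fun t => Im (En t) * sin t) 0 (2 * PI)).
    - generalize PI_RGT_0; lra.
    - apply harnack_at_0.
    - intros t _. assert (H := Hpos (zt t) (circle_mod t)). rewrite circle_Im in H. fold (En t) in H. nra. }
  assert (HP := PI_RGT_0). assert (0 < PI * r) by nra. nra.
Qed.

(** [K w - K 0] is the mean of [En] against [w / (zt (zt - w))]. Antisymmetrizing replaces [En] by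
    its imaginary part and the kernel by one with the factor [zt - conj(zt)], that is [sin t]. The
    integrand is thus at most a multiple of [|w|] times the density of [harnack_at_0]. *)
Lemma harnack_inequality (w : C) : w <> 0%R -> Cmod w <= r / 2 -> ~ In w L -> ~ In (Cconj w) L ->
  K (Cconj w) = Cconj (K w) -> Cmod (K w - K 0) <= 20 * Cmod w * Re (K 0) / r.
Proof.
  intros Hw0 Hw Hn Hn' HKc.
  assert (Hrr : RtoC (r * r) <> 0%R). { intros E. injection E. nra. }
  assert (N := circle_neq_0).
  assert (Hcau : forall x : C, x <> 0%R -> Cmod x <= r / 2 -> ~ In x L ->
     isCInt (fun t => En t * (x / (zt t * (zt t - x))))%C 0 (2 * PI) (RtoC (2 * PI) * (K x - K 0))%C).
  { intros x Hx0 Hx Hxn.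
    assert (M1 := harnack_mean (fun _ => 1)%C (fun v _ => shol_const _ v)). cbv beta in M1.
    assert (M2 := cauchy_circle x Hx0 ltac:(lra) Hxn).
    assert (S := isCInt_minus _ _ _ _ _ _ M2 M1). cbv beta in S.
    replace (RtoC (2 * PI) * (K x - K 0))%C with (RtoC (2 * PI) * K x - RtoC (2 * PI) * (K 0 * 1))%C by ring.
    revert S. apply isCInt_ext. intros t _. unfold En. fold (zt t).
    assert (Nx : (zt t - x <> 0)%C). { apply Csub_neq_0. intros E. apply (f_equal Cmod) in E. rewrite circle_mod in E. lra. }
    Ceq_type. field. split; auto. }
  (* On the circle the integrand equals [K(v) v^3 x / (r^2 (r^2 - x v))], which vanishes at 0. The
     denominator has no zero of modulus below [2 r], since [|x| <= r / 2]. *)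
  assert (Hvan : forall x : C, Cmod x <= r / 2 ->
     isCInt (fun t => En t * Cconj (Cconj x / (zt t * (zt t - Cconj x))))%C 0 (2 * PI) (RtoC 0)).
  { intros x Hx.
    assert (Hd : forall v, Cmod v < Rmin r' (2 * r) -> (RtoC (r * r) - x * v)%C <> 0%R).
    { intros v Hv E. assert (A1 := Rmin_r r' (2 * r)).
      assert (E2 : RtoC (r * r) = (x * v)%C). { replace (RtoC (r * r)) with (RtoC (r * r) - x * v + x * v)%C by ring. rewrite E; ring. }
      apply (f_equal Cmod) in E2. rewrite Cmod_mult, Cmod_R, Rabs_right in E2 by nra.
      assert (A3 := Cmod_ge_0 v). assert (A2 := Cmod_ge_0 x). nra. }
    assert (Hr2 : 0 < r < Rmin r' (2 * r)). { split. lra. apply Rmin_glb_lt; lra. }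
    assert (M : isCInt (fun t => K (0 + RtoC r * cis t) * ((0 + RtoC r * cis t) * (0 + RtoC r * cis t) * (0 + RtoC r * cis t) * x / (RtoC (r * r) * (RtoC (r * r) - x * (0 + RtoC r * cis t)))))%C 0 (2 * PI)
       (RtoC (2 * PI) * (K 0 * (0 * 0 * 0 * x / (RtoC (r * r) * (RtoC (r * r) - x * 0)))))%C).
    { apply (mean_value_continuous (fun v => K v * (v * v * v * x / (RtoC (r * r) * (RtoC (r * r) - x * v))))%C 0 r _ L Hr2).
      - intros v Hv Hi. replace (v - 0)%C with v in Hv by ring. assert (A1 := Rmin_l r' (2 * r)).
        apply shol_mult. apply Hhol; auto; lra.
        apply shol_div. repeat (apply shol_mult; [|try apply shol_id; apply shol_const]); apply shol_id.
        apply shol_mult; [apply shol_const|]. apply shol_minus; [apply shol_const|apply shol_mult; [apply shol_const|apply shol_id]].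
        apply Cmult_neq_0; auto.
      - intros v Hi Hv. replace (v - 0)%C with v in Hv by ring. assert (A1 := Rmin_l r' (2 * r)).
        apply Ccont_mult. apply Hcont; auto; lra. apply shol_cont.
        apply shol_div. repeat (apply shol_mult; [|try apply shol_id; apply shol_const]); apply shol_id.
        apply shol_mult; [apply shol_const|]. apply shol_minus; [apply shol_const|apply shol_mult; [apply shol_const|apply shol_id]].
        apply Cmult_neq_0; auto. }
    match type of M with isCInt _ _ _ ?X => replace X with (RtoC 0) in M end.
    2:{ unfold Cdiv. ring. }
    revert M. apply isCInt_ext. intros t _. rewrite !Cplus_0_l. fold (zt t). unfold En.
    assert (Hdt := Hd (zt t) ltac:(rewrite circle_mod; lra)).
    assert (Nx : (zt t - Cconj x <> 0)%C). { apply Csub_neq_0. intros E. apply (f_equal Cmod) in E. rewrite circle_mod, Cmod_conj in E. lra. }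
    unfold Cdiv. rewrite Cmult_conj, Cconj_conj, Cinv_conj by (now apply Cmult_neq_0).
    rewrite Cmult_conj, Cminus_conj, Cconj_conj, circle_conj.
    Ceq_type. field. repeat split; auto. }
  assert (Nw' : Cconj w <> 0%R) by now apply Cconj_inj_neq0.
  assert (Hw' : Cmod (Cconj w) <= r / 2) by now rewrite Cmod_conj.
  assert (S := circle_antisym (fun t => w / (zt t * (zt t - w)))%C (fun t => Cconj (Cconj w / (zt t * (zt t - Cconj w))))%C
     _ (RtoC (2 * PI) * (K (Cconj w) - K 0)) (Hcau w Hw0 Hw Hn) (Hvan w Hw)).
  assert (V2 := Hvan (Cconj w) Hw'). rewrite Cconj_conj in V2. specialize (S V2). cbv beta in S.
  assert (V3 : isCInt (fun t => En t * Cconj (Cconj (Cconj w / (zt t * (zt t - Cconj w)))))%C 0 (2 * PI) (RtoC (2 * PI) * (K (Cconj w) - K 0))%C).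
  { generalize (Hcau (Cconj w) Nw' Hw' Hn'). apply isCInt_ext. intros t _. now rewrite Cconj_conj. }
  specialize (S V3).
  (* The factor 40 arises from [2 |Im En|], [|zt - conj(zt)| = 2 r |sin t|],
     [|zt + conj(zt) - w| <= 5 r / 2] and a denominator of modulus at least [r^2 (r / 2)^2].
     [isCInt_bound] doubles the result and the left side carries [4 PI], which leaves 20. *)
  assert (B := is_RInt_scal (V := R_NormedModule) _ _ _ (40 * Cmod w / (r * r)) _ harnack_at_0).
  assert (HPI := PI_RGT_0).
  assert (Q := isCInt_bound _ _ 0 (2 * PI) _ _ ltac:(lra) S B).
  assert (Q' : Cmod (RtoC (2 * PI) * (K w - K 0) + Cconj (RtoC (2 * PI) * (K (Cconj w) - K 0))) <= 2 * (40 * Cmod w / (r * r) * (PI * r * Re (K 0)))).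
  { refine (Q _). intros t _. change (Cmod ((En t - Cconj (En t)) * (w / (zt t * (zt t - w)) - Cconj (Cconj w / (zt t * (zt t - Cconj w))))) <= 40 * Cmod w / (r * r) * (Im (En t) * sin t)).
    assert (Nx : (zt t - w <> 0)%C). { apply Csub_neq_0. intros E. apply (f_equal Cmod) in E. rewrite circle_mod in E. lra. }
    assert (Ny : (zt t - Cconj w <> 0)%C). { apply Csub_neq_0. intros E. apply (f_equal Cmod) in E. rewrite circle_mod, Cmod_conj in E. lra. }
    assert (Nz : (Cconj (zt t) - w <> 0)%C).
    { apply Csub_neq_0. intros E. apply (f_equal Cmod) in E. rewrite Cmod_conj, circle_mod in E. lra. }
    assert (Nc := Cconj_inj_neq0 _ (N t)).
    assert (Ek : (w / (zt t * (zt t - w)) - Cconj (Cconj w / (zt t * (zt t - Cconj w))) =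
       - w * (zt t - Cconj (zt t)) * (zt t + Cconj (zt t) - w) / (zt t * Cconj (zt t) * ((zt t - w) * (Cconj (zt t) - w))))%C).
    { unfold Cdiv at 2. rewrite Cmult_conj, Cconj_conj, Cinv_conj by (now apply Cmult_neq_0).
      rewrite Cmult_conj, Cminus_conj, Cconj_conj. field. repeat split; auto. }
    rewrite Ek, !sub_conj, circle_Im. unfold Cdiv. rewrite !Cmod_mult, Cmod_inv.
    2:{ apply Cmult_neq_0; apply Cmult_neq_0; auto. }
    rewrite !Cmod_mult, Cmod_opp, Cmod_conj, circle_mod, !Cmod_R.
    rewrite Cmod_Ci.
    assert (D1 : r / 2 <= Cmod (zt t - w)). { generalize (Cmod_ge_sub (zt t) w). rewrite circle_mod. lra. }
    assert (D2 : r / 2 <= Cmod (Cconj (zt t) - w)). { generalize (Cmod_ge_sub (Cconj (zt t)) w). rewrite Cmod_conj, circle_mod. lra. }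
    assert (D3 : Cmod (zt t + Cconj (zt t) - w) <= 5 / 2 * r).
    { eapply Rle_trans. apply Cmod_triangle. rewrite Cmod_opp.
      generalize (Cmod_triangle (zt t) (Cconj (zt t))). rewrite Cmod_conj, circle_mod. lra. }
    assert (HV := Hpos (zt t) (circle_mod t)). rewrite circle_Im in HV. fold (En t) in HV.
    assert (HV' : 0 <= Im (En t) * sin t) by nra.
    assert (HA : Rabs (Im (En t)) * Rabs (r * sin t) = r * (Im (En t) * sin t)).
    { rewrite <- Rabs_mult. rewrite Rabs_right; [ring|]. apply Rle_ge. nra. }
    rewrite (Rabs_right 2) by lra.
    match goal with |- ?l <= _ => replace l with
      (4 * Cmod w * (Rabs (Im (En t)) * Rabs (r * sin t)) * Cmod (zt t + Cconj (zt t) - w) * / (r * r * (Cmod (zt t - w) * Cmod (Cconj (zt t) - w)))) by ring end.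
    rewrite HA.
    assert (I1 : / (r * r * (Cmod (zt t - w) * Cmod (Cconj (zt t) - w))) <= / (r * r * (r / 2 * (r / 2)))).
    { apply Rinv_le_contravar. repeat apply Rmult_lt_0_compat; lra. apply Rmult_le_compat_l. nra. apply Rmult_le_compat; lra. }
    assert (I2 : 4 * Cmod w * (r * (Im (En t) * sin t)) * Cmod (zt t + Cconj (zt t) - w) <= 4 * Cmod w * (r * (Im (En t) * sin t)) * (5 / 2 * r)).
    { apply Rmult_le_compat_l; auto. assert (A := Cmod_ge_0 w). apply Rmult_le_pos; [lra|]. nra. }
    apply Rle_trans with (4 * Cmod w * (r * (Im (En t) * sin t)) * (5 / 2 * r) * / (r * r * (r / 2 * (r / 2)))).
    - apply Rmult_le_compat; auto.
      + assert (A := Cmod_ge_0 w). apply Rmult_le_pos. apply Rmult_le_pos; [lra|nra]. apply Cmod_ge_0.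
      + left. apply Rinv_0_lt_compat. repeat apply Rmult_lt_0_compat; lra.
    - right. field. lra. }
  rewrite HKc in Q'.
  match type of Q' with Cmod ?X <= _ => replace X with (RtoC (4 * PI) * (K w - K 0))%C in Q' end.
  2:{ assert (E0 : Cconj (K 0) = K 0). { apply C_ext; unfold Re, Im, Cconj; simpl; auto. unfold Im in Hreal. rewrite Hreal. ring. }
      rewrite Cmult_conj, Cminus_conj, Cconj_conj, E0.
      assert (E1 : Cconj (RtoC (2 * PI)) = RtoC (2 * PI)) by (apply C_ext; unfold Re, Im; simpl; ring). rewrite E1.
      replace (RtoC (4 * PI)) with (RtoC (2 * PI) + RtoC (2 * PI))%C by (rewrite <- RtoC_plus; f_equal; ring). ring. }
  rewrite Cmod_mult, Cmod_R, Rabs_right in Q' by lra.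
  apply Rmult_le_reg_l with (4 * PI). lra. eapply Rle_trans. exact Q'. right. field. lra.
Qed.

End Harnack.

(** * The logarithmic derivative of the Kummer function as a Stieltjes function *)

Lemma Cpoch_shift v n : (Cpoch v (S n) = v * Cpoch (v + RtoC 1) n)%C.
Proof.
  induction n as [|n IH]. simpl; ring.
  change (Cpoch v (S (S n))) with (Cpoch v (S n) * (v + RtoC (INR (S n))))%C.
  rewrite IH, S_INR, RtoC_plus. simpl. ring.
Qed.

Lemma rpoch_shift b n : rpoch b (S n) = b * rpoch (b + 1) n.
Proof.
  induction n as [|n IH]. simpl; ring.
  change (rpoch b (S (S n))) with (rpoch b (S n) * (b + INR (S n))). rewrite IH, S_INR. simpl. ring.
Qed.

Lemma Fdd_coef_shift b v n : 0 < b ->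
  (RtoC (INR (S n)) * Fdd_coef b (v :: nil) (S n) = v * RtoC (/ b) * Fdd_coef (b + 1) (v + RtoC 1 :: nil) n)%C.
Proof.
  intros Hb. unfold Fdd_coef, Phi_beta. rewrite !dd_single, Cpoch_shift.
  assert (E : INR (S n) * / (rpoch b (S n) * INR (fact (S n))) = / b * / (rpoch (b + 1) n * INR (fact n))).
  { rewrite rpoch_shift, fact_simpl, mult_INR. assert (H1 := rpoch_pos (b + 1) n ltac:(lra)).
    assert (H2 := INR_fact_lt_0 n). assert (0 < INR (S n)) by (apply lt_0_INR; lia). field. repeat split; lra. }
  transitivity (v * Cpoch (v + RtoC 1) n * RtoC (INR (S n) * / (rpoch b (S n) * INR (fact (S n)))))%C.
  rewrite RtoC_mult; ring. rewrite E, RtoC_mult. ring.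
Qed.

Lemma dFdd_shift b x v : 0 < b -> 0 <= x ->
  dFdd b x (v :: nil) = (v * RtoC (/ b) * Fdd (b + 1) x (v + RtoC 1 :: nil))%C.
Proof.
  intros Hb Hx. unfold Fdd. rewrite <- CSeries_scal by (apply Fdd_summable; lra).
  assert (E : forall n, (v * RtoC (/ b) * (Fdd_coef (b + 1) (v + RtoC 1 :: nil) n * RtoC (x ^ n)) =
     RtoC (INR (S n) * x ^ n) * Fdd_coef b (v :: nil) (S n))%C).
  { intros n. rewrite RtoC_mult. transitivity ((v * RtoC (/ b) * Fdd_coef (b + 1) (v + RtoC 1 :: nil) n) * RtoC (x ^ n))%C.
    ring. rewrite <- Fdd_coef_shift by auto. ring. }
  rewrite (CSeries_ext _ _ E). unfold dFdd, CSeries, PSeries. f_equal; apply Series_ext; intros n;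
  unfold PS_derive, Fdd_re, Fdd_im; generalize (Fdd_coef b (v :: nil) (S n)) (INR (S n)) (x ^ n); intros; unfold Re, Im; simpl; ring.
Qed.

Lemma Fdd_real b x L : map Cconj L = L -> Im (Fdd b x L) = 0.
Proof. intros E. assert (K := f_equal Im (Fdd_conj b x L)). rewrite E in K. unfold Cconj, Im in *; simpl in *. lra. Qed.

Lemma Cconj_RtoC (r : R) : Cconj (RtoC r) = RtoC r.
Proof. apply C_ext; unfold Re, Im; simpl; ring. Qed.

Lemma C_real (x : C) : Im x = 0 -> x = RtoC (Re x).
Proof. intros H. now apply C_ext. Qed.

Lemma Im_div (x y : C) : y <> 0%R -> Im (x / y)%C = Im (x * Cconj y)%C / (Cmod y * Cmod y).
Proof.
  intros Hy. assert (Hp := proj1 (Cmod_gt_0 y) Hy). assert (E := Cmod_sqr_conj y).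
  assert (E2 : (x / y = (x * Cconj y) * RtoC (/ (Cmod y * Cmod y)))%C).
  { rewrite RtoC_inv by nra. rewrite <- E. field. split; auto. now apply Cconj_inj_neq0. }
  rewrite E2. unfold Im; simpl. field. lra.
Qed.

Lemma Fdd_at_0 b L : Fdd b 0 L = Fdd_coef b L 0.
Proof. rewrite Fdd_PSeries, !PSeries_0. unfold Fdd_re, Fdd_im. now destruct (Fdd_coef b L 0). Qed.

Lemma Fdd_cont_head b x L w : 0 < b -> 0 <= x -> Ccont (fun v => Fdd b x (v :: L)) w.
Proof.
  intros Hb Hx. destruct (Forall_Cmod_bound (w :: L)) as [M [HM HL]]. inversion_clear HL.
  destruct (Fdd_bound b x (M + 1) Hb Hx ltac:(lra)) as [K [HK HF]].
  apply Ccont_eps. intros e He. apply locally_Cmod. exists (Rmin 1 (e / K)).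
  split. { apply Rmin_glb_lt. lra. now apply Rdiv_lt_0_compat. }
  intros v Hv. assert (A1 := Rmin_l 1 (e / K)). assert (A2 := Rmin_r 1 (e / K)).
  rewrite Fdd_diff by auto. rewrite Cmod_mult.
  assert (B : Cmod (Fdd b x (v :: w :: L)) <= K).
  { apply HF. apply List.Forall_cons; [|apply List.Forall_cons].
    - generalize (Cmod_triangle (v - w) w). replace (v - w + w)%C with v by ring. lra.
    - lra.
    - revert H0. apply List.Forall_impl. intros; lra. }
  apply Rle_lt_trans with (Cmod (v - w) * K). apply Rmult_le_compat_l; auto. apply Cmod_ge_0.
  replace e with (e / K * K) by (field; lra). apply Rmult_lt_compat_r; lra.
Qed.

Fixpoint csum (f : nat -> C) (N : nat) : C := match N with O => RtoC 0 | S n => (csum f n + f n)%C end.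

Lemma csum_closed (Pr : (C -> C) -> C -> Prop) (f : nat -> C -> C) w N :
  Pr (fun _ => 0%R) w -> (forall g h, Pr g w -> Pr h w -> Pr (fun v => g v + h v)%C w) ->
  (forall k, (k < N)%nat -> Pr (f k) w) -> Pr (fun v => csum (fun k => f k v) N) w.
Proof.
  intros H0 Hp. induction N as [|N IH]; intros H; simpl; auto.
  apply (Hp (fun v => csum (fun k => f k v) N) (f N)); auto.
Qed.

Lemma psum_ext f g N : (forall k, (k < N)%nat -> f k = g k) -> psum f N = psum g N.
Proof. induction N; intros H; simpl; auto. rewrite IHN, H; auto. Qed.

Lemma psum_scal c f N : psum (fun k => c * f k) N = c * psum f N.
Proof. induction N; simpl. ring. rewrite IHN; ring. Qed.

Lemma psum_nonneg f N : (forall k, (k < N)%nat -> 0 <= f k) -> 0 <= psum f N.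
Proof. induction N; intros H; simpl. lra. assert (0 <= psum f N) by auto. assert (0 <= f N) by auto. lra. Qed.

Lemma Im_csum f N : Im (csum f N) = psum (fun k => Im (f k)) N.
Proof. induction N; simpl. reflexivity. rewrite <- IHN. reflexivity. Qed.
Lemma Re_csum f N : Re (csum f N) = psum (fun k => Re (f k)) N.
Proof. induction N; simpl. reflexivity. rewrite <- IHN. reflexivity. Qed.

Lemma csum_ext f g N : (forall k, (k < N)%nat -> f k = g k) -> csum f N = csum g N.
Proof. induction N; intros H; simpl; auto. rewrite IHN, H; auto. Qed.

Lemma csum_scal c f N : csum (fun k => c * f k)%C N = (c * csum f N)%C.
Proof. induction N; simpl. ring. rewrite IHN; ring. Qed.

Lemma csum_conj f N : Cconj (csum f N) = csum (fun k => Cconj (f k)) N.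
Proof. induction N; simpl. apply Cconj_RtoC. now rewrite Cplus_conj, IHN. Qed.

(** * Eigenfunctions at the zeros and the truncated partial fractions *)

Section PartialFractions.
Variables (b z : R) (nu : nat -> R).
Hypothesis hb : 0 < b.
Hypothesis hz : 0 < z.
Hypothesis hnu : zeros_of_Phi b z nu.

Let hb1 : 0 < b + 1. Proof. lra. Qed.
Let hz0 : 0 <= z. Proof. lra. Qed.

Definition Phi_den (v : C) : C := Fdd b z (v :: nil).
Definition Phi_num (v : C) : C := Fdd (b + 1) z ((v + RtoC 1)%C :: nil).

Lemma zero_iff (w : C) : Phi_den w = 0%R <-> exists k, w = RtoC (nu k).
Proof. destruct hnu as [_ [_ H]]. unfold Phi_den. rewrite <- Phi_Fdd by auto. apply H. Qed.

Lemma nu_decr j k : (j < k)%nat -> nu k < nu j.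
Proof. destruct hnu as [_ [H _]]. induction 1. apply H. eapply Rlt_trans; [apply H|auto]. Qed.

Lemma nu_neg k : nu k < 0.
Proof. destruct hnu as [H0 _]. destruct k; auto. eapply Rlt_trans; [apply (nu_decr 0); lia|auto]. Qed.

Lemma nu_inj j k : RtoC (nu j) = RtoC (nu k) -> j = k.
Proof.
  intros E. injection E as E. destruct (Nat.lt_trichotomy j k) as [H|[H|H]]; auto;
  apply nu_decr in H; lra.
Qed.

Lemma Phi_den_nu k : Phi_den (RtoC (nu k)) = 0%R.
Proof. apply zero_iff. eauto. Qed.

Lemma Phi_den_shol w : shol Phi_den w.
Proof. now apply Fdd_shol. Qed.

Lemma Phi_num_shol w : shol Phi_num w.
Proof.
  apply (shol_comp (fun v => v + RtoC 1)%C (fun v => Fdd (b + 1) z (v :: nil))).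
  apply shol_plus. apply shol_id. apply shol_const. now apply Fdd_shol.
Qed.

Lemma Phi_den_conj (v : C) : Phi_den (Cconj v) = Cconj (Phi_den v).
Proof. apply (Fdd_conj b z (v :: nil)). Qed.

Lemma Phi_num_conj (v : C) : Phi_num (Cconj v) = Cconj (Phi_num v).
Proof.
  unfold Phi_num. rewrite <- (Fdd_conj (b + 1) z ((v + RtoC 1)%C :: nil)). simpl. rewrite Cplus_conj, Cconj_RtoC. reflexivity.
Qed.

Lemma dFdd_Phi_num (v : C) : dFdd b z (v :: nil) = (v * RtoC (/ b) * Phi_num v)%C.
Proof. now apply dFdd_shift. Qed.

Lemma dFdd_conj (v : C) : dFdd b z (Cconj v :: nil) = Cconj (dFdd b z (v :: nil)).
Proof. rewrite !dFdd_Phi_num, Phi_num_conj, !Cmult_conj, Cconj_RtoC. reflexivity. Qed.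

(** A finite limit of the zeros would be a zero by continuity, hence some [nu k]; but the limit lies
    at or below [nu (S k) < nu k]. *)
Lemma nu_unbounded M : exists N, forall k, (N <= k)%nat -> nu k < - M.
Proof.
  destruct (Classical_Prop.classic (exists N, nu N < - M)) as [[N HN]|H].
  - exists N. intros k Hk. destruct (Nat.eq_dec N k) as [->|E]; auto.
    assert (nu k < nu N) by (apply nu_decr; lia). lra.
  - exfalso. assert (HM : forall n, - M <= nu n).
    { intros n. apply Rnot_lt_le. intros K; apply H; eauto. }
    destruct (ex_finite_lim_seq_decr nu (- M)) as [l Hl].
    { intros n. left. apply nu_decr; lia. } { auto. }
    assert (Hle : forall n, l <= nu n).
    { intros n. apply (is_lim_seq_decr_compare nu l Hl). intros m. left. apply nu_decr; lia. }
    assert (HQ : Phi_den (RtoC l) = 0%R).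
    { apply Cmod_eq_0. apply Rle_antisym; [|apply Cmod_ge_0]. apply Rnot_lt_le. intros Hp.
      assert (Hc := shol_cont _ _ (Phi_den_shol (RtoC l))).
      destruct (proj1 (locally_Cmod _ _) (proj1 (Ccont_eps _ _) Hc _ Hp)) as [d [Hd Hb]].
      apply is_lim_seq_spec in Hl. destruct (Hl (mkposreal d Hd)) as [n Hn]. specialize (Hn n (Nat.le_refl n)). simpl in Hn.
      assert (K := Hb (RtoC (nu n))). rewrite <- RtoC_minus, Cmod_R in K. specialize (K Hn).
      rewrite Phi_den_nu, Cmod_sub_sym in K. replace (Phi_den (RtoC l) - 0)%C with (Phi_den (RtoC l)) in K by ring. lra. }
    apply zero_iff in HQ. destruct HQ as [k Hk]. injection Hk as Hk.
    assert (K := Hle (S k)). assert (nu (S k) < nu k) by (apply nu_decr; lia). lra.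
Qed.

Definition eig (k : nat) (x : R) : R := Re (Fdd b x (RtoC (nu k) :: nil)).
Definition eig_slope (k : nat) : R := Re (dFdd b z (RtoC (nu k) :: nil)).
Definition eig_nu_slope (k : nat) : R := Re (Fdd b z (RtoC (nu k) :: RtoC (nu k) :: nil)).
(** The squared weighted norm of [eig k]: in [JC_square] the term with the value at [z] vanishes,
    and this product remains. *)
Definition eig_norm (k : nat) : R := - pw b z * eig_nu_slope k * eig_slope k.

Lemma Fdd_eig k x : Fdd b x (RtoC (nu k) :: nil) = RtoC (eig k x).
Proof. apply C_real. apply Fdd_real. simpl. now rewrite Cconj_RtoC. Qed.

Lemma dFdd_eig_slope k : dFdd b z (RtoC (nu k) :: nil) = RtoC (eig_slope k).
Proof.
  apply C_real. assert (K := f_equal Im (dFdd_conj (RtoC (nu k)))). rewrite Cconj_RtoC in K.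
  unfold Cconj, Im in *; simpl in *. lra.
Qed.

Lemma Fdd_eig_nu_slope k : Fdd b z (RtoC (nu k) :: RtoC (nu k) :: nil) = RtoC (eig_nu_slope k).
Proof. apply C_real. apply Fdd_real. simpl. now rewrite !Cconj_RtoC. Qed.

Lemma J_eig_square k : J b z (fun x => eig k x * eig k x) (eig_norm k).
Proof.
  destruct (JC_square b z (RtoC (nu k)) hb) as [H _].
  assert (E := Phi_den_nu k). unfold Phi_den in E. rewrite E, Fdd_eig_nu_slope, dFdd_eig_slope in H.
  match type of H with J _ _ _ ?X => replace X with (eig_norm k) in H by (unfold eig_norm, Re; simpl; ring) end.
  revert H. apply J_ext. intros x _. rewrite Fdd_eig. unfold Re; simpl. ring.
Qed.

Lemma J_eig_orth j k : j <> k -> J b z (fun x => eig j x * eig k x) 0.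
Proof.
  intros N. destruct (JC_product b z (RtoC (nu j)) (RtoC (nu k)) hb) as [H _]. { intros E; apply N; now apply nu_inj. }
  assert (Ej := Phi_den_nu j). assert (Ek := Phi_den_nu k). unfold Phi_den in Ej, Ek. rewrite Ej, Ek in H.
  match type of H with J _ _ _ (Re ?X) => replace X with (RtoC 0) in H by (unfold Cdiv; ring) end.
  revert H. apply J_ext. intros x _. rewrite !Fdd_eig. unfold Re; simpl. ring.
Qed.

(** The normalization [y(0) = 1] keeps the solution positive near 0, which will make its norm
    strictly positive. *)
Lemma eig_near_0 k : exists d, 0 < d /\ forall x, 0 < x < d -> 0 < eig k x.
Proof.
  assert (Hc := continuous_Re _ _ (Rder_cont _ _ _ (Rder_Fdd b 0 (RtoC (nu k) :: nil) hb))). simpl in Hc.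
  assert (E : Re (Fdd b 0 (RtoC (nu k) :: nil)) = 1).
  { rewrite Fdd_at_0. unfold Fdd_coef, Phi_beta. simpl. unfold Re; simpl. field. }
  destruct (Hc (ball (Re (Fdd b 0 (RtoC (nu k) :: nil))) (mkposreal 1 Rlt_0_1)) (locally_ball _ _)) as [d Hd].
  exists d. split. apply cond_pos. intros x Hx. specialize (Hd x).
  assert (K : ball 0 d x). { change (Rabs (x - 0) < d). rewrite Rabs_right; lra. }
  specialize (Hd K). change (Rabs (eig k x - Re (Fdd b 0 (RtoC (nu k) :: nil))) < 1) in Hd. rewrite E in Hd.
  apply Rabs_lt_between in Hd. lra.
Qed.

Lemma eig_norm_pos k : 0 < eig_norm k.
Proof.
  destruct (eig_near_0 k) as [d [Hd H]].
  apply (J_strict_pos b z (fun x => eig k x * eig k x) (eig_norm k) d); auto.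
  - intros; nra.
  - intros x Hx. specialize (H x Hx). nra.
  - apply J_eig_square.
Qed.

(** Simplicity of the zeros: the parameter derivative is a factor of a positive norm. *)
Lemma eig_nu_slope_neq_0 k : eig_nu_slope k <> 0.
Proof. intros E. generalize (eig_norm_pos k). unfold eig_norm. rewrite E. lra. Qed.

(* Minus the residue of [pw b z * y'(z) / y(z)] at [nu k]. *)
Definition eig_weight (k : nat) : R := - pw b z * eig_slope k / eig_nu_slope k.

Lemma eig_weight_pos k : 0 < eig_weight k.
Proof.
  replace (eig_weight k) with (eig_norm k / (eig_nu_slope k * eig_nu_slope k)). 2:{ unfold eig_weight, eig_norm. field. apply eig_nu_slope_neq_0. }
  apply Rdiv_lt_0_compat. apply eig_norm_pos. assert (H := eig_nu_slope_neq_0 k). destruct (Rdichotomy _ _ H); nra.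
Qed.

Lemma nonreal_not_zero (v : C) : Im v <> 0 -> Phi_den v <> 0%R.
Proof. intros H E. apply zero_iff in E. destruct E as [k ->]. apply H. reflexivity. Qed.

(** Bessel's inequality for [y_v]. Lagrange's identity with parameters [v] and [conj(v)] gives the
    squared norm on the right; with [v] and [nu k] it gives the coefficients, whose squares divided
    by [eig_norm k] are the terms on the left. *)
Lemma herglotz_bessel (v : C) N : Im v <> 0 ->
  psum (fun k => eig_weight k / (Cmod (v - RtoC (nu k)) * Cmod (v - RtoC (nu k)))) N * (Cmod (Phi_den v) * Cmod (Phi_den v)) <=
  pw b z * Im (dFdd b z (v :: nil) * Cconj (Phi_den v)) / Im v.
Proof.
  intros Hv.
  assert (Nc : v <> Cconj v). { intros E. apply (f_equal Im) in E. unfold Im, Cconj in *; simpl in *. lra. }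
  assert (Nk : forall k, (v - RtoC (nu k) <> 0)%C). { intros k. apply Csub_neq_0. intros ->. apply Hv. reflexivity. }
  set (A := fun x => Re (Fdd b x (v :: nil))). set (B := fun x => Im (Fdd b x (v :: nil))).
  assert (HAB : J b z (fun x => A x * A x + B x * B x) (pw b z * Im (dFdd b z (v :: nil) * Cconj (Phi_den v)) / Im v)).
  { destruct (JC_product b z v (Cconj v) hb Nc) as [H _].
    assert (EF : Fdd b z (Cconj v :: nil) = Cconj (Phi_den v)) by apply Phi_den_conj.
    rewrite dFdd_conj, EF in H. fold (Phi_den v) in H.
    match type of H with J _ _ _ ?X => replace X with (pw b z * Im (dFdd b z (v :: nil) * Cconj (Phi_den v)) / Im v) in H end.
    - revert H. apply J_ext. intros x _. assert (E := Fdd_conj b x (v :: nil)). simpl in E. rewrite E.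
      unfold A, B, Re, Im, Cconj; simpl; ring.
    - set (X := (dFdd b z (v :: nil) * Cconj (Phi_den v))%C).
      replace (Phi_den v * Cconj (dFdd b z (v :: nil)))%C with (Cconj X) by (unfold X; rewrite Cmult_conj, Cconj_conj; ring).
      rewrite !sub_conj.
      replace (2 * Ci * RtoC (Im X) / (2 * Ci * RtoC (Im v)))%C with (RtoC (Im X / Im v)).
      + unfold Re; simpl. field. auto.
      + rewrite RtoC_div by auto. field. repeat split.
        * intros E; apply Hv; injection E; auto.
        * intros E; injection E; lra. }
  assert (Hk : forall k, JC b z (fun x => Fdd b x (v :: nil) * RtoC (eig k x))%C (- RtoC (pw b z * eig_slope k) * Phi_den v / (v - RtoC (nu k)))%C).
  { intros k. assert (H := JC_product b z v (RtoC (nu k)) hb (fun E => Nk k (eq_ind_r (fun x => (x - RtoC (nu k) = 0)%C) (Cplus_opp_r _) E))).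
    assert (Ek := Phi_den_nu k). unfold Phi_den in Ek. rewrite Ek, dFdd_eig_slope in H. fold (Phi_den v) in H.
    match type of H with JC _ _ _ ?X => replace X with (- RtoC (pw b z * eig_slope k) * Phi_den v / (v - RtoC (nu k)))%C in H end.
    - destruct H as [H1 H2]. split; [revert H1|revert H2]; apply J_ext; intros x _; now rewrite Fdd_eig.
    - rewrite RtoC_mult. field. apply Nk. }
  set (a := fun k => Re (- RtoC (pw b z * eig_slope k) * Phi_den v / (v - RtoC (nu k)))%C).
  set (c := fun k => Im (- RtoC (pw b z * eig_slope k) * Phi_den v / (v - RtoC (nu k)))%C).
  assert (Bs := bessel b z eig eig_norm N hz (fun k _ => conj (eig_norm_pos k) (J_eig_square k)) (fun j k _ _ E => J_eig_orth j k E)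
     A B a c _ HAB).
  rewrite Rmult_comm, <- psum_scal.
  rewrite (psum_ext _ (fun k => (a k * a k + c k * c k) / eig_norm k)).
  - apply Bs.
    + intros k _. destruct (Hk k) as [H _]. revert H. apply J_ext. intros x _. unfold A, Re; simpl; ring.
    + intros k _. destruct (Hk k) as [_ H]. revert H. apply J_ext. intros x _. unfold B, Im; simpl; ring.
  - intros k _. unfold a, c. rewrite <- Cmod_sqr. rewrite Cmod_div, Cmod_mult, Cmod_opp, Cmod_R by apply Nk.
    assert (Hp := proj1 (Cmod_gt_0 _) (Nk k)). set (m := Cmod (v - RtoC (nu k))) in *. set (q := Cmod (Phi_den v)).
    replace (Rabs (pw b z * eig_slope k) * q / m * (Rabs (pw b z * eig_slope k) * q / m)) with
      ((Rabs (pw b z * eig_slope k) * Rabs (pw b z * eig_slope k)) * (q * q) / (m * m)) by (field; lra).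
    rewrite <- Rabs_mult, (Rabs_right (pw b z * eig_slope k * (pw b z * eig_slope k))) by nra.
    unfold eig_norm, eig_weight. assert (D0 := eig_nu_slope_neq_0 k). assert (P0 := pw_pos b z).
    assert (Y0 : eig_slope k <> 0). { intros E. generalize (eig_norm_pos k). unfold eig_norm. rewrite E. lra. }
    field. repeat split; auto; lra.
Qed.

(* Truncated partial-fraction remainder of [pw b z * y'(z) / (v y(z))]. *)
Definition pf_rem (N : nat) (v : C) : C :=
  (RtoC (pw b z) * (Phi_num v / (RtoC b * Phi_den v)) - csum (fun k => RtoC (eig_weight k / nu k) / (RtoC (nu k) - v)) N)%C.

(** The last two alternatives are the points where a denominator of the formula vanishes and
    conjugation cannot be carried through the inverse. *)
Lemma pf_rem_conj N (v : C) : pf_rem N (Cconj v) = Cconj (pf_rem N v) \/ Phi_den v = 0%R \/ exists k, (RtoC (nu k) = v)%C.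
Proof.
  destruct (C_eq_dec (Phi_den v) 0) as [E|E]; [now right; left|]. left.
  assert (Nb : RtoC b <> 0%R) by (intros E'; injection E'; lra).
  assert (Nk : forall k, (RtoC (nu k) - v <> 0)%C).
  { intros k. apply Csub_neq_0. intros <-. apply E. apply Phi_den_nu. }
  unfold pf_rem. rewrite Cminus_conj, csum_conj, Cmult_conj, Cconj_RtoC, Phi_num_conj, Phi_den_conj. f_equal.
  - f_equal. unfold Cdiv. rewrite Cmult_conj, Cinv_conj, Cmult_conj, Cconj_RtoC; auto. now apply Cmult_neq_0.
  - apply csum_ext. intros k _. unfold Cdiv. rewrite Cmult_conj, Cinv_conj, Cminus_conj, !Cconj_RtoC; auto.
Qed.

(** For one fraction, [Im (v (d / nu) / (nu - v)) = d Im v / |v - nu|^2]. The subtracted sum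
    therefore contributes exactly the Bessel sum of [herglotz_bessel]. *)
Lemma pf_rem_herglotz N (v : C) : 0 <= Im (v * pf_rem N v)%C * Im v.
Proof.
  (* On the real axis the product is 0, whatever default value a quotient takes at a pole. *)
  destruct (Req_dec (Im v) 0) as [E|Hv]. rewrite E; lra.
  assert (HQ := nonreal_not_zero v Hv). assert (Hq := proj1 (Cmod_gt_0 _) HQ).
  assert (Nb : RtoC b <> 0%R) by (intros E'; injection E'; lra).
  assert (Nk : forall k, (RtoC (nu k) - v <> 0)%C). { intros k. apply Csub_neq_0. intros <-. apply Hv. reflexivity. }
  assert (HB := herglotz_bessel v N Hv).
  assert (E : (v * pf_rem N v = RtoC (pw b z) * (dFdd b z (v :: nil) / Phi_den v) - csum (fun k => v * (RtoC (eig_weight k / nu k) / (RtoC (nu k) - v))) N)%C).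
  { unfold pf_rem. rewrite csum_scal, dFdd_Phi_num, RtoC_inv by lra. field. split; auto. }
  assert (EI : Im (v * pf_rem N v)%C = pw b z * (Im (dFdd b z (v :: nil) * Cconj (Phi_den v)) / (Cmod (Phi_den v) * Cmod (Phi_den v)))
     - Im v * psum (fun k => eig_weight k / (Cmod (v - RtoC (nu k)) * Cmod (v - RtoC (nu k)))) N).
  { rewrite E. transitivity (pw b z * Im (dFdd b z (v :: nil) / Phi_den v)%C - Im (csum (fun k => v * (RtoC (eig_weight k / nu k) / (RtoC (nu k) - v)))%C N)).
    unfold Im; simpl; ring. rewrite Im_div by auto. f_equal. rewrite Im_csum, <- psum_scal. apply psum_ext. intros k _.
    replace (v * (RtoC (eig_weight k / nu k) / (RtoC (nu k) - v)))%C with (RtoC (eig_weight k / nu k) * (v / (RtoC (nu k) - v)))%C by (field; auto).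
    transitivity (eig_weight k / nu k * Im (v / (RtoC (nu k) - v))%C). unfold Im; simpl; ring.
    rewrite Im_div, Cmod_sub_sym by auto. assert (Hp := proj1 (Cmod_gt_0 _) (Nk k)). rewrite Cmod_sub_sym in Hp.
    assert (nu k <> 0) by (generalize (nu_neg k); lra).
    replace (Im (v * Cconj (RtoC (nu k) - v))) with (nu k * Im v) by (unfold Im, Cconj; simpl; ring). field. split; lra. }
  rewrite EI. set (S := psum _ N) in *. set (q := Cmod (Phi_den v)) in *. set (X := Im (dFdd b z (v :: nil) * Cconj (Phi_den v))) in *.
  assert (Hq2 : 0 < q * q) by nra.
  replace ((pw b z * (X / (q * q)) - Im v * S) * Im v) with
    ((pw b z * X / Im v - S * (q * q)) * ((Im v * Im v) / (q * q))) by (field; split; lra).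
  apply Rmult_le_pos. lra. apply Rlt_le, Rdiv_lt_0_compat; auto. destruct (Rdichotomy _ _ Hv); nra.
Qed.

Lemma pf_rem_shol N (v : C) : Phi_den v <> 0%R -> shol (pf_rem N) v.
Proof.
  intros HQ. assert (Nb : RtoC b <> 0%R) by (intros E'; injection E'; lra). unfold pf_rem. apply shol_minus.
  - apply shol_mult. apply shol_const. apply shol_div. apply Phi_num_shol. apply shol_mult. apply shol_const. apply Phi_den_shol.
    now apply Cmult_neq_0.
  - apply (csum_closed shol). apply shol_const. intros; now apply shol_plus.
    intros k _. apply shol_div. apply shol_const. apply shol_minus. apply shol_const. apply shol_id.
    apply Csub_neq_0. intros <-. apply HQ, Phi_den_nu.
Qed.

(** [Phi_den v] is [v - nu k] times a divided difference that is continuous in [v] and tends to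
    [eig_nu_slope k]. *)
Lemma zeros_isolated k : exists d, 0 < d /\ forall v, v <> RtoC (nu k) -> Cmod (v - RtoC (nu k)) < d -> Phi_den v <> 0%R.
Proof.
  assert (K := Ccont_neq0 (T := C_UniformSpace) _ _ (Fdd_cont_head b z (RtoC (nu k) :: nil) (RtoC (nu k)) hb hz0)).
  cbv beta in K. rewrite Fdd_eig_nu_slope in K.
  destruct (proj1 (locally_Cmod _ _) (K (fun E => eig_nu_slope_neq_0 k (f_equal fst E)))) as [d [Hd Hb]].
  exists d. split; auto. intros v N Hv E.
  assert (D := Fdd_diff b z v (RtoC (nu k)) nil hb hz0). fold (Phi_den v) in D. fold (Phi_den (RtoC (nu k))) in D. rewrite Phi_den_nu, E in D.
  replace (0 - 0)%C with (RtoC 0) in D by ring. symmetry in D. apply Cmult_eq_0 in D. destruct D as [D|D].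
  now apply Csub_neq_0 in N. now apply (Hb v).
Qed.

(** The choice of [eig_weight] makes the principal parts at [nu k] cancel; divided differences give
    the quotient that is left in closed form. *)
Lemma pf_rem_removable N k : (k < N)%nat -> exists l, Clim (pf_rem N) (RtoC (nu k)) l.
Proof.
  intros Hk. set (a := RtoC (nu k)).
  assert (Nb : RtoC b <> 0%R) by (intros E'; injection E'; lra).
  assert (Na : a <> 0%R). { intros E; injection E. generalize (nu_neg k); lra. }
  assert (ND : Fdd b z (a :: a :: nil) <> 0%R). { unfold a. rewrite Fdd_eig_nu_slope. intros E; injection E. apply eig_nu_slope_neq_0. }
  set (ps := fun v => csum (fun j => if Nat.eq_dec j k then 0%R else (RtoC (eig_weight j / nu j) / (RtoC (nu j) - v))%C) N).
  assert (Hps : forall v, csum (fun j => RtoC (eig_weight j / nu j) / (RtoC (nu j) - v))%C N = (RtoC (eig_weight k / nu k) / (a - v) + ps v)%C).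
  { intros v. unfold ps. clear - Hk. unfold a. induction N as [|N IH]; [lia|]. simpl.
    destruct (Nat.eq_dec N k) as [E|E].
    - subst N. replace (csum _ k) with (csum (fun j : nat => if Nat.eq_dec j k then RtoC 0 else (RtoC (eig_weight j / nu j) / (RtoC (nu j) - v))%C) k).
      ring. apply csum_ext. intros j Hj. destruct (Nat.eq_dec j k); [lia|auto].
    - rewrite IH by lia. ring. }
  (* With [D v] the divided difference at [v, a], the bracket is [(P v - P a) / (v - a)] minus
     [P a / D a] times [(D v - D a) / (v - a)], both written as divided differences so that [v = a]
     is allowed; here [P] is [Phi_num]. *)
  set (g := fun v => (RtoC (pw b z / b) * (Fdd (b + 1) z (v + RtoC 1 :: a + RtoC 1 :: nil) - Phi_num a / Fdd b z (a :: a :: nil) * Fdd b z (v :: a :: a :: nil)) / Fdd b z (v :: a :: nil) - ps v)%C).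
  destruct (zeros_isolated k) as [d [Hd Hiso]]. fold a in Hiso.
  exists (g a). apply (Clim_of_cont _ _ _ d Hd).
  - intros v Nv Hv. specialize (Hiso v Nv Hv). assert (Nav := Csub_neq_0 _ _ Nv).
    assert (EQ : Phi_den v = ((v - a) * Fdd b z (v :: a :: nil))%C).
    { assert (D := Fdd_diff b z v a nil hb hz0). fold (Phi_den v) in D. fold (Phi_den a) in D. unfold a in D at 1. rewrite Phi_den_nu in D.
      rewrite <- D. ring. }
    assert (ND2 : Fdd b z (v :: a :: nil) <> 0%R). { intros E. apply Hiso. rewrite EQ, E. ring. }
    unfold pf_rem, g. rewrite Hps, EQ.
    assert (E1 : (Fdd (b + 1) z (v + RtoC 1 :: a + RtoC 1 :: nil) = (Phi_num v - Phi_num a) / (v - a))%C).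
    { assert (D := Fdd_diff (b + 1) z (v + RtoC 1) (a + RtoC 1) nil hb1 hz0). fold (Phi_num v) in D. fold (Phi_num a) in D. rewrite D.
      field. auto. }
    assert (E2 : (Fdd b z (v :: a :: a :: nil) = (Fdd b z (v :: a :: nil) - Fdd b z (a :: a :: nil)) / (v - a))%C).
    { rewrite (Fdd_diff b z v a (a :: nil) hb hz0). field. auto. }
    assert (E3 : RtoC (eig_weight k / nu k) = (- RtoC (pw b z) * (Phi_num a / RtoC b) / Fdd b z (a :: a :: nil))%C).
    { assert (D := dFdd_eig_slope k). fold a in D. rewrite dFdd_Phi_num in D.
      assert (H0 : nu k <> 0) by (generalize (nu_neg k); lra). assert (HD := eig_nu_slope_neq_0 k).
      assert (EP : Phi_num a = RtoC (eig_slope k * b / nu k)).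
      { rewrite RtoC_div, RtoC_mult by auto. rewrite <- D, RtoC_inv by lra. fold a. field. split; auto. }
      replace (Fdd b z (a :: a :: nil)) with (RtoC (eig_nu_slope k)) by (unfold a; now rewrite Fdd_eig_nu_slope).
      rewrite EP, <- RtoC_div, <- RtoC_opp, <- RtoC_mult, <- RtoC_div by (auto; lra).
      f_equal. unfold eig_weight. field. repeat split; auto; lra. }
    rewrite E1, E2, E3, RtoC_div by lra. field.
    repeat split; auto. replace (a - v)%C with (- (v - a))%C by ring. intros E. apply Nav. replace (v - a)%C with (- - (v - a))%C by ring. rewrite E. ring.
  - unfold g. apply Ccont_minus.
    + apply Ccont_div; auto; [|now apply Fdd_cont_head]. apply Ccont_mult. apply Ccont_const. apply Ccont_minus.
      * apply (Ccont_comp (T := C_UniformSpace) (fun v => v + RtoC 1)%C (fun v => Fdd (b + 1) z (v :: (a + RtoC 1)%C :: nil))).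
        apply Ccont_plus. apply Ccont_id. apply Ccont_const. now apply Fdd_cont_head.
      * apply Ccont_mult. apply Ccont_const. now apply Fdd_cont_head.
    + unfold ps. apply (csum_closed (fun f w => Ccont f w)). apply Ccont_const. intros; now apply (Ccont_plus (T := C_UniformSpace)).
      intros j Hj. destruct (Nat.eq_dec j k) as [E|E]. apply Ccont_const.
      apply Ccont_div. apply Ccont_const. apply Ccont_minus. apply Ccont_const. apply Ccont_id.
      apply Csub_neq_0. intros E'. apply E. now apply nu_inj.
Qed.

End PartialFractions.

(** * Decay of the logarithmic derivative and of the remainder *)

Lemma PSeries_nonneg (a : nat -> R) (x : R) : 0 <= x -> (forall n, 0 <= a n) -> ex_pseries a x -> 0 <= PSeries a x.
Proof.
  intros Hx Ha He. unfold PSeries. apply ex_pseries_R in He.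
  replace 0 with (Series (fun _ => 0 * 0)) by (rewrite Series_scal_l; ring).
  apply Series_le; auto. intros n. assert (0 <= x ^ n) by now apply pow_le. specialize (Ha n). split; nra.
Qed.

(* The right-hand side is the sum of [(n - A)^2 r_n x^n]. *)
Lemma PSeries_variance (r : nat -> R) (x A : R) : 0 <= x -> (forall n, 0 <= r n) -> CV_radius r = p_infty ->
  0 <= x * (x * PSeries (PS_derive (PS_derive r)) x) + (1 - 2 * A) * (x * PSeries (PS_derive r) x) + A * A * PSeries r x.
Proof.
  intros Hx Hr Hc.
  assert (C1 : CV_radius (PS_derive r) = p_infty) by now rewrite CV_radius_derive.
  assert (C2 : CV_radius (PS_derive (PS_derive r)) = p_infty) by now rewrite CV_radius_derive.
  assert (E : forall a, CV_radius a = p_infty -> ex_pseries a x).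
  { intros a Ha. apply CV_radius_inside. now rewrite Ha. }
  assert (SC : forall (c : R) (a : nat -> R), ex_pseries (V := R_NormedModule) a x -> ex_pseries (V := R_NormedModule) (PS_scal c a) x).
  { intros c a Ha. apply (ex_pseries_scal (V := R_NormedModule)); [apply Rmult_comm|auto]. }
  assert (I1 : ex_pseries (PS_incr_1 (PS_incr_1 (PS_derive (PS_derive r)))) x) by (apply ex_pseries_incr_1, ex_pseries_incr_1; auto).
  assert (I2 : ex_pseries (PS_scal (1 - 2 * A) (PS_incr_1 (PS_derive r))) x) by (apply SC, ex_pseries_incr_1; auto).
  assert (I3 : ex_pseries (PS_scal (A * A) r) x) by auto.
  assert (I12 := ex_pseries_plus (V := R_NormedModule) _ _ _ I1 I2).
  rewrite <- !PSeries_incr_1, <- !PSeries_scal, <- !PSeries_plus; auto.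
  apply PSeries_nonneg; auto. 2:{ now apply (ex_pseries_plus (V := R_NormedModule)). }
  intros n. unfold PS_plus, PS_scal, PS_incr_1, PS_derive.
  change plus with Rplus; change scal with Rmult.
  assert (K : forall m, 0 <= (INR m - A) * (INR m - A) * r m).
  { intros m. apply Rmult_le_pos; auto. apply Rle_0_sqr. }
  specialize (K n). destruct n as [|[|n]].
  - change (zero : R_NormedModule) with 0. simpl in K. eapply Rle_trans. exact K. right. simpl. ring.
  - change (zero : R_NormedModule) with 0. simpl in K. eapply Rle_trans. exact K. right. simpl. ring.
  - eapply Rle_trans. exact K. right. rewrite !S_INR. ring.
Qed.

Section PartialFractionsLimit.
Variables (b z : R) (nu : nat -> R).
Hypothesis hb : 0 < b.
Hypothesis hz : 0 < z.
Hypothesis hnu : zeros_of_Phi b z nu.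

Let hz0 : 0 <= z. Proof. lra. Qed.
Let Nb : RtoC b <> 0%R. Proof. intros E'; injection E'; lra. Qed.

Let Q := Phi_den b z.
Let P := Phi_num b z.
Let d := eig_weight b z nu.
Let KK := pf_rem b z nu.

Lemma nonneg_not_zero (x : R) : 0 <= x -> Q (RtoC x) <> 0%R.
Proof.
  intros Hx E. apply (zero_iff b z nu hb hnu) in E. destruct E as [k E]. injection E as E.
  generalize (nu_neg b z nu hnu k). lra.
Qed.

(** For real [X > 0] all coefficients of [y_X] are positive. Inserting Kummer's equation into the
    variance inequality gives [z y' (2 A + b - 1 - z) <= (z X + A^2) y]; with [X = A^2] this makes
    [y' / y] of order [sqrt X], hence [y' / (X y)] small. *)
Lemma log_derivative_small e : 0 < e -> exists X, 0 < X /\ Re (RtoC (pw b z) * (P (RtoC X) / (RtoC b * Q (RtoC X)))) <= e.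
Proof.
  intros He. assert (Hp := pw_pos b z).
  (* With [X = A^2] the quotient is at most [(z + 1) pw / (z (2 A + b - 1 - z))], and this [A] makes
     that at most [e]. *)
  set (A := Rabs (b - 1 - z) + (z + 1) * pw b z / (z * e)).
  assert (Ha := Rle_abs (- (b - 1 - z))). rewrite Rabs_Ropp in Ha.
  assert (Hpos : 0 < (z + 1) * pw b z / (z * e)).
  { apply Rdiv_lt_0_compat. apply Rmult_lt_0_compat; lra. now apply Rmult_lt_0_compat. }
  assert (HA : 0 < A) by (unfold A; generalize (Rabs_pos (b - 1 - z)); lra).
  assert (HA2 : (z + 1) * pw b z / (z * e) <= 2 * A + b - 1 - z).
  { unfold A in *. generalize (Rabs_pos (b - 1 - z)). lra. }
  set (X := A * A). assert (HX : 0 < X) by (unfold X; nra).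
  exists X. split; auto.
  set (L := RtoC X :: nil).
  assert (Hr : forall n, 0 <= Fdd_re b L n).
  { intros n. unfold Fdd_re, Fdd_coef, L. rewrite dd_single, Cpoch_RtoC, <- RtoC_mult.
    apply Rmult_le_pos; left. now apply rpoch_pos. now apply Phi_beta_pos. }
  assert (V := PSeries_variance (Fdd_re b L) z A hz0 Hr (Fdd_re_radius b L hb)).
  assert (K := f_equal Re (kummer_Fdd b z (RtoC X) nil hb)). fold L in K.
  assert (HI : Im (Fdd b z L) = 0). { apply Fdd_real. unfold L; simpl. now rewrite Cconj_RtoC. }
  assert (HQ := nonneg_not_zero X ltac:(lra)).
  assert (EQ : Q (RtoC X) = Fdd b z L) by reflexivity.
  assert (ED : dFdd b z L = (RtoC X * RtoC (/ b) * P (RtoC X))%C) by (unfold L; apply dFdd_shift; lra).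
  rewrite Fdd_nil in K. rewrite Fdd_PSeries in HI. unfold Im in HI; simpl in HI.
  assert (HID : Im (dFdd b z L) = 0).
  { assert (HC : P (RtoC X) = Cconj (P (RtoC X))). { unfold P. rewrite <- Phi_num_conj. now rewrite Cconj_RtoC. }
    apply (f_equal Im) in HC. rewrite ED. unfold Im, Cconj in *; simpl in *. nra. }
  rewrite Fdd_PSeries in K. unfold ddFdd, dFdd, Re in K. simpl in K. rewrite HI in K.
  set (y := PSeries (Fdd_re b L) z) in *. set (y' := PSeries (PS_derive (Fdd_re b L)) z) in *. set (y'' := PSeries (PS_derive (PS_derive (Fdd_re b L))) z) in *.
  assert (HQy : Q (RtoC X) = RtoC y). { rewrite EQ, Fdd_PSeries, HI. reflexivity. }
  assert (Hy0 : 0 <= y). { apply PSeries_nonneg; auto. apply CV_radius_inside. rewrite Fdd_re_radius; simpl; auto. }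
  assert (Hy : 0 < y). { destruct (Req_dec y 0) as [E|]; [|lra]. exfalso. apply HQ. rewrite HQy, E. reflexivity. }
  assert (HD : dFdd b z L = RtoC y'). { apply C_real in HID. rewrite HID. reflexivity. }
  assert (M : z * y' * (2 * A + b - 1 - z) <= (z * X + A * A) * y).
  { assert (K' : z * y'' = X * y - (b - z) * y') by lra. rewrite K' in V. nra. }
  assert (EP : (P (RtoC X) / (RtoC b * Q (RtoC X)) = RtoC (y' / (X * y)))%C).
  { assert (NX : RtoC X <> 0%R) by (intros E; injection E; lra). assert (NY : RtoC y <> 0%R) by (intros E; injection E; lra).
    rewrite RtoC_div, RtoC_mult by (apply Rmult_integral_contrapositive_currified; lra). rewrite <- HD, ED, RtoC_inv, HQy by lra.
    field. auto. }
  rewrite EP, <- RtoC_mult. unfold Re; simpl.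
  apply Rmult_le_reg_r with (X * y * (z * (2 * A + b - 1 - z))).
  { repeat apply Rmult_lt_0_compat; lra. }
  replace (pw b z * (y' / (X * y)) * (X * y * (z * (2 * A + b - 1 - z)))) with (pw b z * (z * y' * (2 * A + b - 1 - z))) by (field; lra).
  apply Rle_trans with (pw b z * ((z * X + A * A) * y)). { apply Rmult_le_compat_l; lra. }
  apply Rle_trans with (e * (X * y * (z * ((z + 1) * pw b z / (z * e))))).
  { right. fold X. field. lra. }
  apply Rmult_le_compat_l; [lra|]. apply Rmult_le_compat_l; [left; apply Rmult_lt_0_compat; lra|].
  apply Rmult_le_compat_l; lra.
Qed.

(** Midway between [|nu n|] and [|nu (S n)|]: the circle encloses exactly the [n + 1] poles removed
    in [KK (S n)]. *)
Let RN (n : nat) : R := (- nu n - nu (S n)) / 2.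

(** After filling the removed poles, the remainder satisfies the hypotheses of the Harnack section
    in the disc up to the next zero, with the sign condition on the circle from
    [pf_rem_herglotz]. *)
Lemma pf_rem_harnack n : 0 <= Re (KK (S n) 0) /\
  forall w, Q w <> 0%R -> Cmod w <= RN n / 2 -> Cmod (KK (S n) w - KK (S n) 0) <= 20 * Cmod w * Re (KK (S n) 0) / RN n.
Proof.
  set (L := map (fun k => RtoC (nu k)) (seq 0 (S n))).
  assert (HL : forall v, In v L <-> exists k, (k < S n)%nat /\ v = RtoC (nu k)).
  { intros v. unfold L. rewrite in_map_iff. split.
    - intros [k [E I]]. apply in_seq in I. exists k. split; auto; lia.
    - intros [k [Hk E]]. exists k. split; auto. apply in_seq. lia. }
  destruct (fill_removable (KK (S n)) L) as [g [Hg Hc]].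
  { intros a Ha. apply HL in Ha. destruct Ha as [k [Hk ->]]. now apply (pf_rem_removable b z nu hb hz hnu). }
  assert (Hn0 := nu_neg b z nu hnu n). assert (Hn1 : nu (S n) < nu n) by (apply (nu_decr b z nu hnu); lia).
  assert (Hr : 0 < RN n < - nu (S n)) by (unfold RN; lra).
  assert (HQL : forall v, Q v <> 0%R -> ~ In v L).
  { intros v Hv I. apply HL in I. destruct I as [k [_ ->]]. apply Hv. apply (Phi_den_nu b z nu hb hnu). }
  assert (Hmod : forall k, Cmod (RtoC (nu k)) = - nu k).
  { intros k. rewrite Cmod_R, Rabs_left; auto. apply (nu_neg b z nu hnu). }
  assert (Hhol : forall v, Cmod v < - nu (S n) -> ~ In v L -> shol g v).
  { intros v Hv Hi. apply shol_ext_loc with (KK (S n)).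
    - generalize (locally_not_In L v Hi). apply filter_imp. intros y Hy. symmetry. now apply Hg.
    - apply (pf_rem_shol b z nu hb hz hnu). intros E. apply (zero_iff b z nu hb hnu) in E. destruct E as [k ->].
      apply Hi. apply HL. exists k. split; auto. rewrite Hmod in Hv.
      apply Nat.nle_gt. intros K. apply Nat.lt_eq_cases in K. destruct K as [K| <-]; [|lra].
      apply (nu_decr b z nu hnu) in K. lra. }
  assert (Hcont : forall v, In v L -> Cmod v < - nu (S n) -> Ccont g v) by auto.
  assert (H0L : ~ In (RtoC 0) L) by (apply HQL, nonneg_not_zero; lra).
  assert (Hpos : forall v, Cmod v = RN n -> 0 <= Im (v * g v) * Im v).
  { intros v Hv. rewrite Hg. apply (pf_rem_herglotz b z nu hb hz hnu).
    intros I. apply HL in I. destruct I as [k [Hk ->]]. rewrite Hmod in Hv. unfold RN in Hv.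
    destruct (Nat.eq_dec k n) as [->|E]. lra. assert (nu n < nu k) by (apply (nu_decr b z nu hnu); lia). lra. }
  assert (Hcj : forall v, Q v <> 0%R -> KK (S n) (Cconj v) = Cconj (KK (S n) v)).
  { intros v Hv. destruct (pf_rem_conj b z nu hb hnu (S n) v) as [E|[E|[k E]]]; auto. easy.
    exfalso. apply Hv. rewrite <- E. apply (Phi_den_nu b z nu hb hnu). }
  assert (Hreal : Im (g 0) = 0).
  { rewrite Hg by auto. assert (K := Hcj 0%R (nonneg_not_zero 0 ltac:(lra))). rewrite Cconj_RtoC in K.
    apply (f_equal Im) in K. unfold Im, Cconj in *; simpl in *. lra. }
  rewrite <- (Hg _ H0L). split.
  - apply (harnack_nonneg g L (RN n) (- nu (S n)) Hr Hhol Hcont Hpos).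
  - intros w Hw Hwr. rewrite <- (Hg w) by auto.
    destruct (C_eq_dec w 0) as [->|Hw0].
    { replace (g 0 - g 0)%C with (RtoC 0) by ring. rewrite Cmod_0. right. field. lra. }
    assert (Hwc : Q (Cconj w) <> 0%R). { unfold Q. rewrite Phi_den_conj. now apply Cconj_inj_neq0. }
    apply (harnack_inequality g L (RN n) (- nu (S n)) Hr Hhol Hcont Hpos Hreal w); auto.
    rewrite !Hg by auto. auto.
Qed.

Let h0 : R := Re (RtoC (pw b z) * (P 0 / (RtoC b * Q 0)))%C.

Lemma Re_pf_rem_real N (x : R) : 0 <= x ->
  Re (KK N (RtoC x)) = Re (RtoC (pw b z) * (P (RtoC x) / (RtoC b * Q (RtoC x))))%C - psum (fun k => d k / (nu k * (nu k - x))) N.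
Proof.
  intros Hx. unfold KK, pf_rem. fold P Q d.
  transitivity (Re (RtoC (pw b z) * (P (RtoC x) / (RtoC b * Q (RtoC x))))%C - Re (csum (fun k => RtoC (d k / nu k) / (RtoC (nu k) - RtoC x)) N)%C).
  unfold Re; simpl; ring. f_equal. rewrite Re_csum. apply psum_ext. intros k _.
  assert (Hk := nu_neg b z nu hnu k). rewrite <- RtoC_minus, <- RtoC_div by lra. unfold Re; simpl. field. lra.
Qed.

Lemma pf_terms_nonneg (x : R) k : 0 <= x -> 0 <= d k / (nu k * (nu k - x)).
Proof.
  intros Hx. assert (Hk := nu_neg b z nu hnu k). assert (Hd := eig_weight_pos b z nu hb hz hnu k). fold d in Hd.
  apply Rlt_le, Rdiv_lt_0_compat; auto. nra.
Qed.

Lemma residue_sum_bound n : psum (fun k => d k / (nu k * nu k)) (S n) <= h0.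
Proof.
  destruct (pf_rem_harnack n) as [H _]. rewrite Re_pf_rem_real in H by lra.
  rewrite (psum_ext _ (fun k => d k / (nu k * (nu k - 0)))). unfold h0; lra.
  intros k _. f_equal. ring.
Qed.

Lemma RN_unbounded M : exists N, forall n, (N <= n)%nat -> M < RN n.
Proof.
  destruct (nu_unbounded b z nu hb hz hnu M) as [N HN]. exists N. intros n Hn. unfold RN.
  assert (A1 := HN n Hn). assert (A2 := HN (S n) ltac:(lia)). lra.
Qed.

Lemma pf_rem_0_le n : Re (KK (S n) 0) <= h0.
Proof.
  rewrite Re_pf_rem_real by lra. assert (0 <= psum (fun k => d k / (nu k * (nu k - 0))) (S n)).
  { apply psum_nonneg. intros; apply pf_terms_nonneg; lra. } unfold h0; lra.
Qed.

(** At a real point [X > 0] the subtracted terms are non-negative, so the remainder there is below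
    the full quotient, which is small for suitable [X]. Harnack's inequality carries this back to 0
    once the radius is large compared with [X]. *)
Lemma pf_rem_0_lim e : 0 < e -> exists N, forall n, (N <= n)%nat -> Re (KK (S n) 0) <= e.
Proof.
  intros He. destruct (log_derivative_small (e / 2)) as [X [HX HK]]; [lra|].
  (* [2 X] puts [X] within half the radius; the second summand makes the Harnack error
     [20 X h0 / RN] at most [e / 2]. *)
  destruct (RN_unbounded (2 * X + 40 * X * Rabs h0 / e)) as [N HN].
  exists N. intros n Hn. specialize (HN n Hn). destruct (pf_rem_harnack n) as [Hp H].
  assert (HF : 0 <= 40 * X * Rabs h0 / e).
  { apply Rmult_le_pos. generalize (Rabs_pos h0). nra. left. now apply Rinv_0_lt_compat. }
  assert (EX : Cmod (RtoC X) = X) by (rewrite Cmod_R, Rabs_right; lra).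
  specialize (H (RtoC X) (nonneg_not_zero X ltac:(lra)) ltac:(rewrite EX; lra)). rewrite EX in H.
  assert (H1 := Rabs_Re_le (KK (S n) (RtoC X) - KK (S n) 0)).
  assert (H2 : Rabs (Re (KK (S n) (RtoC X) - KK (S n) 0)) <= e / 2).
  { eapply Rle_trans. exact H1. eapply Rle_trans. exact H.
    apply Rmult_le_reg_r with (RN n). lra. unfold Rdiv at 1. rewrite Rmult_assoc, Rinv_l, Rmult_1_r by lra.
    assert (B := pf_rem_0_le n). assert (B2 := Rle_abs h0).
    apply Rle_trans with (e / 2 * (40 * X * Rabs h0 / e)).
    - replace (e / 2 * (40 * X * Rabs h0 / e)) with (20 * X * Rabs h0) by (field; lra).
      apply Rmult_le_compat_l; lra.
    - apply Rmult_le_compat_l; lra. }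
  apply Rabs_le_between in H2.
  assert (HR : Re (KK (S n) (RtoC X)) <= e / 2).
  { rewrite Re_pf_rem_real by lra. assert (0 <= psum (fun k => d k / (nu k * (nu k - X))) (S n)).
    { apply psum_nonneg. intros; apply pf_terms_nonneg; lra. } lra. }
  replace (Re (KK (S n) (RtoC X) - KK (S n) 0)) with (Re (KK (S n) (RtoC X)) - Re (KK (S n) 0)) in H2 by (unfold Re; simpl; ring).
  lra.
Qed.

Lemma pf_rem_lim w e : Q w <> 0%R -> 0 < e -> exists N, forall n, (N <= n)%nat -> Cmod (KK n w) <= e.
Proof.
  (* Harnack's inequality costs at most 20 times the value at 0, to which that value itself is
     added. *)
  intros Hw He. destruct (pf_rem_0_lim (e / 21)) as [N1 H1]; [lra|].
  assert (Hm := Cmod_ge_0 w).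
  destruct (RN_unbounded (2 * Cmod w + 1)) as [N2 H2].
  exists (S (max N1 N2)). intros n Hn. destruct n as [|n]; [lia|].
  specialize (H1 n ltac:(lia)). specialize (H2 n ltac:(lia)).
  destruct (pf_rem_harnack n) as [Hp H]. specialize (H w Hw ltac:(lra)).
  assert (Hr : Im (KK (S n) 0) = 0).
  { destruct (pf_rem_conj b z nu hb hnu (S n) 0%R) as [E|[E|[k E]]].
    - rewrite Cconj_RtoC in E. fold KK in E. apply (f_equal Im) in E. unfold Im, Cconj in *; simpl in *. lra.
    - exfalso. now apply (nonneg_not_zero 0 ltac:(lra)).
    - injection E. intros. generalize (nu_neg b z nu hnu k). lra. }
  apply C_real in Hr.
  assert (E0 : Cmod (KK (S n) 0) = Re (KK (S n) 0)). { rewrite Hr at 1. rewrite Cmod_R, Rabs_right; lra. }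
  assert (T : Cmod (KK (S n) w) <= Cmod (KK (S n) w - KK (S n) 0) + Cmod (KK (S n) 0)).
  { generalize (Cmod_triangle (KK (S n) w - KK (S n) 0) (KK (S n) 0)).
    replace (KK (S n) w - KK (S n) 0 + KK (S n) 0)%C with (KK (S n) w) by ring. auto. }
  assert (20 * Cmod w * Re (KK (S n) 0) / RN n <= 20 * (e / 21)).
  { apply Rmult_le_reg_r with (RN n). lra. unfold Rdiv at 1. rewrite Rmult_assoc, Rinv_l, Rmult_1_r by lra.
    apply Rle_trans with (20 * RN n * (e / 21)). 2:{ right; ring. } apply Rmult_le_compat; nra. }
  lra.
Qed.

End PartialFractionsLimit.

(** * Bromwich integrals of simple fractions *)

Lemma Rder_increment_bound (Om Om' : R -> C) (E E' : R -> R) (a b : R) : a <= b ->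
  (forall s, a <= s <= b -> Rder Om s (Om' s)) -> (forall s, a <= s <= b -> is_derive E s (E' s)) ->
  (forall s, a <= s <= b -> Cmod (Om' s) <= E' s) -> Cmod (Om b - Om a) <= 2 * (E b - E a).
Proof.
  intros Hab HO HE HB.
  assert (G : forall g g' : R -> R, (forall s, a <= s <= b -> is_derive g s (g' s)) ->
     (forall s, a <= s <= b -> Rabs (g' s) <= E' s) -> Rabs (g b - g a) <= E b - E a).
  { intros g g' Hg Hb.
    assert (M : forall h h' : R -> R, (forall s, a <= s <= b -> is_derive h s (h' s)) -> (forall s, a <= s <= b -> 0 <= h' s) -> h a <= h b).
    { intros h h' Hh Hp. destruct (MVT_gen h a b h') as [x [Hx Ex]].
      - rewrite Rmin_left, Rmax_right by auto. intros; apply Hh; lra.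
      - rewrite Rmin_left, Rmax_right by auto. intros t Ht. apply continuity_pt_filterlim.
        apply (ex_derive_continuous (V := R_NormedModule)). eexists. now apply Hh.
      - rewrite Rmin_left, Rmax_right in Hx by auto. specialize (Hp x Hx).
        assert (0 <= h' x * (b - a)) by (apply Rmult_le_pos; lra). lra. }
    assert (M1 : E a - g a <= E b - g b).
    { apply (M (fun s => E s - g s) (fun s => E' s - g' s)).
      - intros s Hs. apply (is_derive_minus (V := R_NormedModule)); auto.
      - intros s Hs. specialize (Hb s Hs). apply Rabs_le_between in Hb. lra. }
    assert (M2 : E a + g a <= E b + g b).
    { apply (M (fun s => E s + g s) (fun s => E' s + g' s)).
      - intros s Hs. apply (is_derive_plus (V := R_NormedModule)); auto.
      - intros s Hs. specialize (Hb s Hs). apply Rabs_le_between in Hb. lra. }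
    apply Rabs_le. lra. }
  eapply Rle_trans. apply Cmod_le_abs.
  assert (G1 := G (fun s => Re (Om s)) (fun s => Re (Om' s)) (fun s Hs => proj1 (Rder_is_derive _ _ _ (HO s Hs)))
    (fun s Hs => Rle_trans _ _ _ (Rabs_Re_le _) (HB s Hs))).
  assert (G2 := G (fun s => Im (Om s)) (fun s => Im (Om' s)) (fun s Hs => proj2 (Rder_is_derive _ _ _ (HO s Hs)))
    (fun s Hs => Rle_trans _ _ _ (Rabs_Im_le _) (HB s Hs))).
  replace (Re (Om b - Om a)) with (Re (Om b) - Re (Om a)) by (unfold Re; simpl; ring).
  replace (Im (Om b - Om a)) with (Im (Om b) - Im (Om a)) by (unfold Im; simpl; ring).
  lra.
Qed.

Lemma xexp_le (t : R) : 0 <= t -> t * exp (- t) <= 1.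
Proof.
  intros Ht. assert (H := exp_ineq1_le t). assert (Hp := exp_pos (- t)).
  assert (exp t * exp (- t) = 1). { rewrite <- exp_plus. replace (t + - t) with 0 by ring. apply exp_0. }
  nra.
Qed.

(* [1 = sin^2 + cos^2] and [x e^(-x) <= 1] replace Jordan's inequality. *)
Lemma exp_cos_bound k x : 0 < k -> cos x <= 0 -> exp (k * cos x) <= exp (k * cos x) * Rabs (sin x) + / k.
Proof.
  intros Hk Hc. assert (H := sin2_cos2 x). unfold Rsqr in H. assert (Hp := exp_pos (k * cos x)).
  assert (Hs : Rabs (sin x) <= 1). { apply Rabs_le. generalize (SIN_bound x). lra. }
  assert (Hs2 : sin x * sin x <= Rabs (sin x)).
  { generalize (Rabs_pos (sin x)) (pow2_abs (sin x)). simpl. nra. }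
  assert (Hx := xexp_le (k * - cos x) ltac:(nra)). replace (- (k * - cos x)) with (k * cos x) in Hx by ring.
  assert (Hc1 : - 1 <= cos x) by (generalize (COS_bound x); lra).
  assert (Hcc : cos x * cos x * exp (k * cos x) <= / k).
  { apply Rmult_le_reg_l with k; auto. rewrite Rinv_r by lra.
    apply Rle_trans with (k * - cos x * exp (k * cos x) * - cos x). right; ring.
    assert (0 <= k * - cos x * exp (k * cos x)). { apply Rmult_le_pos; nra. } nra. }
  assert (exp (k * cos x) = exp (k * cos x) * (sin x * sin x) + cos x * cos x * exp (k * cos x)).
  { transitivity (exp (k * cos x) * (sin x * sin x + cos x * cos x)). rewrite H; ring. ring. }
  assert (exp (k * cos x) * (sin x * sin x) <= exp (k * cos x) * Rabs (sin x)) by (apply Rmult_le_compat_l; lra).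
  lra.
Qed.

Lemma Re_scal_cis (k t : R) : Re (RtoC k * cis t) = k * cos t.
Proof. rewrite cis_eq. unfold Re; simpl; ring. Qed.

Lemma Ccont_cis t : Ccont cis t.
Proof. eapply Rder_cont. apply Rder_cis. Qed.

Lemma is_derive_exp_cos k x : is_derive (fun x => exp (k * cos x)) x (- (k * (exp (k * cos x) * sin x))).
Proof. auto_derive; auto. ring. Qed.

Lemma continuous_exp_cos_sin k x : continuous (fun x => exp (k * cos x) * sin x) x.
Proof.
  apply (ex_derive_continuous (V := R_NormedModule)). auto_derive. auto.
Qed.

(** In the bound of [exp_cos_bound], [exp (k cos t) sin t] has the primitive [- exp (k cos t) / k].
    Splitting at [PI], where the sine changes sign, gives at most [1 / k] from each quarter, plus
    its length over [k]. *)
Lemma left_half_circle k I : 0 < k ->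
  isCInt (fun t => Cexp (RtoC k * cis t)) (PI / 2) (3 * (PI / 2)) I -> Cmod I <= 2 * (2 + PI) / k.
Proof.
  intros Hk HI. assert (HP := PI_RGT_0).
  assert (Hex : forall a b, exists J, isCInt (fun t => Cexp (RtoC k * cis t)) a b J).
  { intros a b. apply ex_isCInt. intros t _. apply (Ccont_comp (fun t => RtoC k * cis t)%C Cexp).
    apply Ccont_mult. apply Ccont_const. apply Ccont_cis. apply Ccont_Cexp. }
  destruct (Hex (PI / 2) PI) as [I1 H1]. destruct (Hex PI (3 * (PI / 2))) as [I2 H2].
  assert (E := isCInt_unique _ _ _ _ _ HI (isCInt_Chasles _ _ _ _ _ _ H1 H2)). rewrite E.
  assert (Hcos : forall t, PI / 2 <= t <= 3 * (PI / 2) -> cos t <= 0) by (intros; apply cos_le_0; lra).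
  assert (B1 : is_RInt (fun t => exp (k * cos t) * sin t) (PI / 2) PI ((1 - exp (- k)) / k)).
  { replace ((1 - exp (- k)) / k) with (minus (- / k * exp (k * cos PI)) (- / k * exp (k * cos (PI / 2)))).
    - apply (is_RInt_derive (V := R_CompleteNormedModule) (fun t => - / k * exp (k * cos t)) (fun t => exp (k * cos t) * sin t)).
      + intros x _. replace (exp (k * cos x) * sin x) with (- / k * - (k * (exp (k * cos x) * sin x))) by (field; lra).
        apply (is_derive_scal (fun x => exp (k * cos x))). apply is_derive_exp_cos.
      + intros; apply continuous_exp_cos_sin.
    - change (- / k * exp (k * cos PI) - (- / k * exp (k * cos (PI / 2))) = (1 - exp (- k)) / k).
      rewrite cos_PI, cos_PI2, Rmult_0_r, exp_0. replace (k * -1) with (- k) by ring. field. lra. }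
  assert (B2 : is_RInt (fun t => - (exp (k * cos t) * sin t)) PI (3 * (PI / 2)) ((1 - exp (- k)) / k)).
  { replace ((1 - exp (- k)) / k) with (minus (/ k * exp (k * cos (3 * (PI / 2)))) (/ k * exp (k * cos PI))).
    - apply (is_RInt_derive (V := R_CompleteNormedModule) (fun t => / k * exp (k * cos t)) (fun t => - (exp (k * cos t) * sin t))).
      + intros x _. replace (- (exp (k * cos x) * sin x)) with (/ k * - (k * (exp (k * cos x) * sin x))) by (field; lra).
        apply (is_derive_scal (fun x => exp (k * cos x))). apply is_derive_exp_cos.
      + intros; apply (continuous_opp (V := R_NormedModule)). apply continuous_exp_cos_sin.
    - change (/ k * exp (k * cos (3 * (PI / 2))) - (/ k * exp (k * cos PI)) = (1 - exp (- k)) / k).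
      rewrite cos_PI, cos_3PI2, Rmult_0_r, exp_0. replace (k * -1) with (- k) by ring. field. lra. }
  assert (Ek : (1 - exp (- k)) / k <= / k).
  { unfold Rdiv. rewrite <- (Rmult_1_l (/ k)) at 2. apply Rmult_le_compat_r. left; now apply Rinv_0_lt_compat. generalize (exp_pos (- k)); lra. }
  assert (K1 := is_RInt_plus (V := R_NormedModule) _ _ _ _ _ _ B1 (is_RInt_const (V := R_NormedModule) (PI / 2) PI (/ k))).
  assert (K2 := is_RInt_plus (V := R_NormedModule) _ _ _ _ _ _ B2 (is_RInt_const (V := R_NormedModule) PI (3 * (PI / 2)) (/ k))).
  assert (N1 : Cmod I1 <= 2 * ((1 - exp (- k)) / k + (PI - PI / 2) * / k)).
  { refine (isCInt_bound _ _ (PI / 2) PI _ _ _ H1 K1 _). lra. intros t Ht. rewrite Cmod_Cexp, Re_scal_cis.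
    eapply Rle_trans. apply exp_cos_bound; auto. apply Hcos; lra. rewrite Rabs_right. apply Rle_refl.
    apply Rle_ge, sin_ge_0; lra. }
  assert (N2 : Cmod I2 <= 2 * ((1 - exp (- k)) / k + (3 * (PI / 2) - PI) * / k)).
  { refine (isCInt_bound _ _ PI (3 * (PI / 2)) _ _ _ H2 K2 _). lra. intros t Ht. rewrite Cmod_Cexp, Re_scal_cis.
    eapply Rle_trans. apply exp_cos_bound; auto. apply Hcos; lra. rewrite Rabs_left1.
    change (exp (k * cos t) * - sin t + / k <= - (exp (k * cos t) * sin t) + / k). right; ring.
    apply sin_le_0; lra. }
  eapply Rle_trans. apply Cmod_triangle.
  replace (2 * (2 + PI) / k) with (2 * (/ k + (PI - PI / 2) * / k) + 2 * (/ k + (3 * (PI / 2) - PI) * / k)) by (field; lra).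
  lra.
Qed.

(** The whole circle gives [2 PI] by the mean value property, and the left half is small. *)
Lemma right_half_circle k I : 0 < k ->
  isCInt (fun t => Cexp (RtoC k * cis t)) (- (PI / 2)) (PI / 2) I -> Cmod (I - RtoC (2 * PI)) <= 2 * (2 + PI) / k.
Proof.
  intros Hk HI. assert (HP := PI_RGT_0).
  destruct (ex_isCInt (fun t => Cexp (RtoC k * cis t)) (PI / 2) (3 * (PI / 2))) as [I2 H2].
  { intros t _. apply (Ccont_comp (fun t => RtoC k * cis t)%C Cexp).
    apply Ccont_mult. apply Ccont_const. apply Ccont_cis. apply Ccont_Cexp. }
  (* The rotation by [cis (- (PI / 2))] shifts the parameter interval to one that starts at
     [- (PI / 2)]. *)
  assert (M : isCInt (fun t => Cexp ((0 + RtoC k * cis t) * cis (- (PI / 2)))) 0 (2 * PI) (RtoC (2 * PI) * Cexp (0 * cis (- (PI / 2))))%C).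
  { apply (mean_value_continuous (fun v => Cexp (v * cis (- (PI / 2)))) 0 k (k + 1) nil); [lra| |intros v []].
    intros v _ _. apply (shol_comp (fun v => v * cis (- (PI / 2)))%C Cexp).
    apply shol_mult. apply shol_id. apply shol_const. eexists; apply sder_Cexp. }
  assert (S : isCInt (fun t => Cexp (RtoC k * cis t)) (- (PI / 2)) (3 * (PI / 2)) (RtoC (2 * PI))).
  { replace (RtoC (2 * PI) * Cexp (0 * cis (- (PI / 2))))%C with (RtoC (2 * PI)) in M.
    2:{ rewrite Cmult_0_l, Cexp_0. ring. }
    assert (M' : isCInt (fun t => Cexp ((0 + RtoC k * cis t) * cis (- (PI / 2)))) (1 * (- (PI / 2)) + PI / 2) (1 * (3 * (PI / 2)) + PI / 2) (RtoC (2 * PI))).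
    { replace (1 * (- (PI / 2)) + PI / 2) with 0 by ring. replace (1 * (3 * (PI / 2)) + PI / 2) with (2 * PI) by field. exact M. }
    apply (is_RInt_comp_lin (V := C_R_NormedModule)) in M'. revert M'. apply isCInt_ext. intros t _.
    rewrite (scal_one (V := C_R_NormedModule)). f_equal. rewrite Cplus_0_l, <- Cmult_assoc. f_equal.
    unfold cis. rewrite <- Cexp_add. f_equal. rewrite <- Cmult_plus_distr_l, <- RtoC_plus. f_equal. f_equal. ring. }
  assert (E := isCInt_unique _ _ _ _ _ S (isCInt_Chasles _ _ _ _ _ _ HI H2)). rewrite E.
  replace (I - (I + I2))%C with (- I2)%C by ring. rewrite Cmod_opp. now apply left_half_circle.
Qed.

Section Kernel.
Variables (c u gam : R).
Hypothesis Hc : 0 < c.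
Hypothesis Hu : 0 < u.
Hypothesis Hg : 0 < gam.

Let f (v : C) : C := (Cexp (v * RtoC u) / v)%C.
(** [al + s be] runs from the vertical segment of abscissa [c] at [s = 0] to the right half of the
    circle of radius [gam] about 0 at [s = 1]. *)
Let al (t : R) : C := (RtoC c + Ci * RtoC (gam * sin t))%C.
Let al' (t : R) : C := (Ci * RtoC (gam * cos t))%C.
Let be (t : R) : C := (RtoC (gam * cos t - c))%C.
Let be' (t : R) : C := (RtoC (- (gam * sin t)))%C.

(** During the deformation the end points slide horizontally from [c +- i gam] to [+- i gam]. There
    the integrand has modulus at most [exp (x u) / gam], with [x] the abscissa, which gives the
    first term; the second is the error of the half circle with [k = u gam]. *)
Lemma kernel_segment_arc I : isCInt (fun t => f (al t + RtoC 0 * be t) * (al' t + RtoC 0 * be' t))%C (- (PI / 2)) (PI / 2) I ->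
  Cmod (I - RtoC (2 * PI) * Ci) <= 4 * exp (c * u) / (u * gam) + 2 * (2 + PI) / (u * gam).
Proof.
  intros HI. assert (HP := PI_RGT_0).
  assert (Hal : forall t, Rder al t (al' t)).
  { intros t. apply Rder_ext with (fun t => (c, gam * sin t)).
    { intros s. apply C_ext; unfold al, Re, Im; simpl; ring. }
    replace (al' t) with ((0, gam * cos t) : C) by (apply C_ext; unfold al', Re, Im; simpl; ring).
    apply Rder_pair. apply (is_derive_const (V := R_NormedModule)). apply (is_derive_scal sin). apply is_derive_sin. }
  assert (Hbe : forall t, Rder be t (be' t)).
  { intros t. apply Rder_pair. 2: apply (is_derive_const (V := R_NormedModule)). auto_derive; auto. ring. }
  assert (Hal' : forall t, Ccont al' t).
  { intros t. apply Ccont_mult. apply Ccont_const. apply Ccont_RtoC. apply (ex_derive_continuous (V := R_NormedModule)). auto_derive. auto. }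
  assert (Hbe' : forall t, Ccont be' t).
  { intros t. apply Ccont_RtoC. apply (ex_derive_continuous (V := R_NormedModule)). auto_derive. auto. }
  (* A curve can meet 0 only at [t = 0], where it sits at [c + s (gam - c)]. This margin keeps that
     number positive on an open interval around [[0, 1]]. *)
  set (del := Rmin c gam / (2 * (Rabs (gam - c) + 1))).
  assert (Hm : 0 < Rmin c gam) by now apply Rmin_glb_lt. assert (A1 := Rmin_l c gam). assert (A2 := Rmin_r c gam).
  assert (Hab := Rabs_pos (gam - c)). assert (Hd : 0 < del) by (apply Rdiv_lt_0_compat; lra).
  assert (Hdel : del * Rabs (gam - c) <= Rmin c gam / 2).
  { unfold del. apply Rmult_le_reg_r with (2 * (Rabs (gam - c) + 1)). lra.
    replace (Rmin c gam / (2 * (Rabs (gam - c) + 1)) * Rabs (gam - c) * (2 * (Rabs (gam - c) + 1))) with (Rmin c gam * Rabs (gam - c)) by (field; lra).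
    nra. }
  assert (Hne : forall s t, - del < s < 1 + del -> - (PI / 2) <= t <= PI / 2 -> (al t + RtoC s * be t)%C <> 0%R).
  { intros s t Hs Ht E. assert (E1 := f_equal Re E). assert (E2 := f_equal Im E).
    unfold al, be, Re, Im in E1, E2. simpl in E1, E2.
    assert (E3 : sin t = 0). { apply Rmult_eq_reg_l with gam; lra. }
    assert (E4 : t = 0).
    { destruct (Rtotal_order t 0) as [K|[K|K]]; auto; exfalso.
      - assert (sin t < 0) by (apply sin_lt_0_var; lra). lra.
      - assert (0 < sin t) by (apply sin_gt_0; lra). lra. }
    subst t. rewrite cos_0, sin_0 in E1.
    assert (E5 : c + s * (gam - c) = 0) by lra.
    assert (Hab1 := Rle_abs (gam - c)). assert (Hab2 := Rle_abs (- (gam - c))). rewrite Rabs_Ropp in Hab2.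
    destruct (Rle_dec s 0) as [D|D]; [|destruct (Rle_dec s 1) as [D'|D']].
    - assert (- del * Rabs (gam - c) <= s * (gam - c)) by nra. lra.
    - assert (0 < (1 - s) * c + s * gam); [|lra]. destruct (Req_dec s 1) as [->|]; nra.
    - assert (gam + (s - 1) * (gam - c) = 0) by lra. assert (- del * Rabs (gam - c) <= (s - 1) * (gam - c)) by nra. lra. }
  assert (Hf : forall v : C, v <> 0%R -> shol f v).
  { intros v Hv. apply (shol_div (fun v => Cexp (v * RtoC u))%C (fun v => v)); [apply shol_Cexp_scal|apply shol_id|exact Hv]. }
  assert (H := homotopy_RInt f al al' be be' (- (PI / 2)) (PI / 2) (- del) (1 + del) ltac:(lra) Hal Hbe Hal' Hbe').
  cbv beta in H. assert (H' := H (fun s t Hs Ht => filter_imp _ _ Hf (Ccont_neq0 (T := C_UniformSpace) (fun v : C => v) _ (Ccont_id _) (Hne s t Hs Ht)))). clear H.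
  set (Om := fun s => (RInt (fun t => Re (f (al t + RtoC s * be t) * (al' t + RtoC s * be' t))%C) (- (PI / 2)) (PI / 2),
     RInt (fun t => Im (f (al t + RtoC s * be t) * (al' t + RtoC s * be' t))%C) (- (PI / 2)) (PI / 2)) : C) in H'.
  assert (HO : forall s, - del < s < 1 + del -> isCInt (fun t => f (al t + RtoC s * be t) * (al' t + RtoC s * be' t))%C (- (PI / 2)) (PI / 2) (Om s)).
  { intros s Hs. destruct (ex_isCInt (fun t => f (al t + RtoC s * be t) * (al' t + RtoC s * be' t))%C (- (PI / 2)) (PI / 2)) as [J HJ].
    { intros t Ht. rewrite Rmin_left, Rmax_right in Ht by lra. apply Ccont_mult.
      - apply (Ccont_comp (fun t => al t + RtoC s * be t)%C f).
        + apply Ccont_plus. eapply Rder_cont; apply Hal. apply Ccont_mult. apply Ccont_const. eapply Rder_cont; apply Hbe.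
        + apply shol_cont, Hf, Hne; auto.
      - apply Ccont_plus; auto. apply Ccont_mult; auto. apply Ccont_const. }
    replace (Om s) with J; auto. apply isCInt_pair in HJ. destruct HJ as [J1 J2].
    apply C_ext; symmetry; [exact (is_RInt_unique _ _ _ _ J1)|exact (is_RInt_unique _ _ _ _ J2)]. }
  assert (E0 : I = Om 0) by (eapply isCInt_unique; [exact HI|apply HO; lra]).
  assert (B1 : Cmod (Om 1 - RtoC (2 * PI) * Ci) <= 2 * (2 + PI) / (u * gam)).
  { destruct (ex_isCInt (fun t => Cexp (RtoC (u * gam) * cis t)) (- (PI / 2)) (PI / 2)) as [J HJ].
    { intros t _. apply (Ccont_comp (fun t => RtoC (u * gam) * cis t)%C Cexp).
      apply Ccont_mult. apply Ccont_const. apply Ccont_cis. apply Ccont_Cexp. }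
    assert (E1 : Om 1 = (Ci * J)%C).
    { eapply isCInt_unique. apply HO; lra. generalize (isCInt_scal Ci _ _ _ _ HJ). apply isCInt_ext. intros t _.
      assert (Ev : (al t + RtoC 1 * be t = RtoC gam * cis t)%C).
      { rewrite cis_eq. apply C_ext; unfold al, be, Re, Im; simpl; ring. }
      assert (Ew : (al' t + RtoC 1 * be' t = Ci * (RtoC gam * cis t))%C).
      { rewrite cis_eq. apply C_ext; unfold al', be', Re, Im; simpl; ring. }
      assert (Nz : (RtoC gam * cis t)%C <> 0%R).
      { apply Cmult_neq_0. intros E; injection E; lra. apply Cexp_neq_0. }
      rewrite Ev, Ew. unfold f. rewrite RtoC_mult.
      replace (RtoC gam * cis t * RtoC u)%C with (RtoC u * RtoC gam * cis t)%C by ring.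
      Ceq_type. field. split.
      apply Cexp_neq_0. intros E; injection E; lra. }
    rewrite E1. replace (Ci * J - RtoC (2 * PI) * Ci)%C with (Ci * (J - RtoC (2 * PI)))%C by ring.
    rewrite Cmod_mult. rewrite Cmod_Ci.
    rewrite Rmult_1_l. apply right_half_circle; auto. apply Rmult_lt_0_compat; auto. }
  assert (B2 : Cmod (Om 1 - Om 0) <= 2 * ((- (2 / (u * gam)) * exp ((1 - 1) * c * u)) - (- (2 / (u * gam)) * exp ((1 - 0) * c * u)))).
  { apply (Rder_increment_bound Om (fun s => f (al (PI / 2) + RtoC s * be (PI / 2)) * be (PI / 2) - f (al (- (PI / 2)) + RtoC s * be (- (PI / 2))) * be (- (PI / 2)))%C
      (fun s => - (2 / (u * gam)) * exp ((1 - s) * c * u)) (fun s => 2 * c / gam * exp ((1 - s) * c * u)) 0 1); [lra| | |].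
    - intros s Hs. apply H'. lra.
    - intros s Hs. auto_derive; auto. unfold Rminus. field. lra.
    - intros s Hs.
      assert (Q : forall sg, Rabs sg = 1 -> Cmod (f (RtoC ((1 - s) * c) + Ci * RtoC (gam * sg)) * RtoC (- c)) <= c / gam * exp ((1 - s) * c * u)).
      { intros sg Hsg. set (v := (RtoC ((1 - s) * c) + Ci * RtoC (gam * sg))%C).
        assert (Hv : gam <= Cmod v).
        { eapply Rle_trans. 2: apply Rabs_Im_le. unfold v, Im; simpl.
          replace (0 + (0 * 0 + 1 * (gam * sg))) with (gam * sg) by ring. rewrite Rabs_mult, Hsg, Rabs_right; lra. }
        assert (Nv : v <> 0%R). { apply Cmod_gt_0. lra. }
        unfold f. rewrite Cmod_mult, Cmod_div, Cmod_Cexp, Cmod_R, Rabs_Ropp, Rabs_right by (auto; lra).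
        replace (Re (v * RtoC u)) with ((1 - s) * c * u) by (unfold v, Re; simpl; ring).
        assert (He := exp_pos ((1 - s) * c * u)).
        apply Rle_trans with (exp ((1 - s) * c * u) / gam * c).
        - apply Rmult_le_compat_r. lra. apply Rmult_le_compat_l. lra. apply Rinv_le_contravar; lra.
        - right. field. lra. }
      assert (V1 : (al (PI / 2) + RtoC s * be (PI / 2) = RtoC ((1 - s) * c) + Ci * RtoC (gam * 1))%C).
      { unfold al, be. rewrite sin_PI2, cos_PI2. apply C_ext; unfold Re, Im; simpl; ring. }
      assert (V2 : (al (- (PI / 2)) + RtoC s * be (- (PI / 2)) = RtoC ((1 - s) * c) + Ci * RtoC (gam * - 1))%C).
      { unfold al, be. rewrite sin_neg, cos_neg, sin_PI2, cos_PI2. apply C_ext; unfold Re, Im; simpl; ring. }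
      assert (W1 : be (PI / 2) = RtoC (- c)) by (unfold be; rewrite cos_PI2; f_equal; ring).
      assert (W2 : be (- (PI / 2)) = RtoC (- c)) by (unfold be; rewrite cos_neg, cos_PI2; f_equal; ring).
      rewrite V1, V2, W1, W2. eapply Rle_trans. apply Cmod_triangle. rewrite Cmod_opp.
      assert (Q1 := Q 1 Rabs_R1). assert (Q2 := Q (-1) ltac:(rewrite Rabs_left; lra)). 
      replace (2 * c / gam * exp ((1 - s) * c * u)) with (c / gam * exp ((1 - s) * c * u) + c / gam * exp ((1 - s) * c * u)) by (field; lra).
      lra. }
  rewrite E0. replace (Om 0 - RtoC (2 * PI) * Ci)%C with (- (Om 1 - Om 0) + (Om 1 - RtoC (2 * PI) * Ci))%C by ring.
  eapply Rle_trans. apply Cmod_triangle. rewrite Cmod_opp. apply Rplus_le_compat; auto.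
  eapply Rle_trans. exact B2.
  replace ((1 - 1) * c * u) with 0 by ring. replace ((1 - 0) * c * u) with (c * u) by ring. rewrite exp_0.
  assert (0 < 2 / (u * gam)). { apply Rdiv_lt_0_compat. lra. apply Rmult_lt_0_compat; auto. }
  replace (4 * exp (c * u) / (u * gam)) with (2 * (2 / (u * gam) * exp (c * u))) by (field; lra). lra.
Qed.

End Kernel.

Notation vpoint eps gam t :=
  (RtoC eps - Ci * RtoC gam + RtoC t * (RtoC eps + Ci * RtoC gam - (RtoC eps - Ci * RtoC gam)))%C.

Notation vertical_int f eps gam := (is_segment_int f (RtoC eps - Ci * RtoC gam)%C (RtoC eps + Ci * RtoC gam)%C).

(** Translating the pole to 0 puts the segment at abscissa [c = eps - a] and brings out the factor
    [exp (a u) <= 1]. It turns [exp (c u)] into [exp (eps u)], so the bound does not depend on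
    [a]. *)
Lemma bromwich_kernel (a eps u gam : R) (I : C) : a <= 0 -> 0 < eps -> 0 < u -> 0 < gam ->
  vertical_int (fun v => Cexp (v * RtoC u) * / (v - RtoC a))%C eps gam I ->
  Cmod (I - RtoC (2 * PI) * Ci * Cexp (RtoC a * RtoC u)) <= (4 * exp (eps * u) + 2 * (2 + PI)) / (u * gam).
Proof.
  intros Ha He Hu Hg HI. assert (HP := PI_RGT_0). set (c := eps - a). assert (Hc : 0 < c) by (unfold c; lra).
  unfold is_segment_int in HI.
  set (g := fun t : R => (Cexp (vpoint eps gam t * RtoC u) *
         / (vpoint eps gam t - RtoC a) *
         (RtoC eps + Ci * RtoC gam - (RtoC eps - Ci * RtoC gam)))%C).
  change (isCInt g 0 1 I) in HI.
  assert (Hgc : forall t, Ccont g t).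
  { intros t. unfold g. apply Ccont_mult; [|apply Ccont_const]. apply Ccont_mult.
    - apply (Ccont_comp (fun t : R => vpoint eps gam t * RtoC u)%C Cexp).
      apply Ccont_mult; [|apply Ccont_const]. apply Ccont_plus. apply Ccont_const. apply Ccont_mult. apply Ccont_RtoC_id. apply Ccont_const.
      apply Ccont_Cexp.
    - apply Ccont_inv. apply Ccont_minus; [|apply Ccont_const]. apply Ccont_plus. apply Ccont_const. apply Ccont_mult. apply Ccont_RtoC_id. apply Ccont_const.
      intros E. apply (f_equal Re) in E. unfold Re in E. simpl in E. unfold c in Hc. lra. }
  (* The segment is reparametrized by the sine, to match the curve [al] of the deformation. *)
  set (w := fun t => (1 + sin t) / 2).
  assert (Hw : forall t, is_derive w t (cos t / 2)). { intros t. unfold w. auto_derive; auto. field. }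
  assert (Hwc : forall t, continuous (fun t => cos t / 2) t).
  { intros t. apply (ex_derive_continuous (V := R_NormedModule)). auto_derive. auto. }
  assert (W0 : w (- (PI / 2)) = 0) by (unfold w; rewrite sin_neg, sin_PI2; field).
  assert (W1 : w (PI / 2) = 1) by (unfold w; rewrite sin_PI2; field).
  assert (HS : isCInt (fun t => RtoC (cos t / 2) * g (w t))%C (- (PI / 2)) (PI / 2) I).
  { apply isCInt_pair in HI. destruct HI as [H1 H2]. apply isCInt_pair. split.
    - assert (K := is_RInt_comp (V := R_CompleteNormedModule) (fun t => Re (g t)) w (fun t => cos t / 2) (- (PI / 2)) (PI / 2)
        (fun x _ => continuous_Re g (w x) (Hgc (w x))) (fun x _ => conj (Hw x) (Hwc x))).
      rewrite W0, W1 in K. rewrite (is_RInt_unique _ _ _ _ H1) in K. revert K. apply (is_RInt_ext (V := R_NormedModule)). intros t _.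
      change (cos t / 2 * Re (g (w t)) = Re (RtoC (cos t / 2) * g (w t))). generalize (g (w t)). intros x. unfold Re; simpl; ring.
    - assert (K := is_RInt_comp (V := R_CompleteNormedModule) (fun t => Im (g t)) w (fun t => cos t / 2) (- (PI / 2)) (PI / 2)
        (fun x _ => continuous_Im g (w x) (Hgc (w x))) (fun x _ => conj (Hw x) (Hwc x))).
      rewrite W0, W1 in K. rewrite (is_RInt_unique _ _ _ _ H2) in K. revert K. apply (is_RInt_ext (V := R_NormedModule)). intros t _.
      change (cos t / 2 * Im (g (w t)) = Im (RtoC (cos t / 2) * g (w t))). generalize (g (w t)). intros x. unfold Im; simpl; ring. }
  assert (HS2 := isCInt_scal (Cexp (- (RtoC a * RtoC u))) _ _ _ _ HS).
  assert (KA := kernel_segment_arc c u gam Hc Hu Hg (Cexp (- (RtoC a * RtoC u)) * I)%C).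
  assert (HA : Cmod (Cexp (- (RtoC a * RtoC u)) * I - RtoC (2 * PI) * Ci) <= 4 * exp (c * u) / (u * gam) + 2 * (2 + PI) / (u * gam)).
  { apply KA. revert HS2. apply isCInt_ext. intros t _.
    set (V := (RtoC c + Ci * RtoC (gam * sin t) + RtoC 0 * RtoC (gam * cos t - c))%C).
    unfold g.
    assert (EW : (RtoC eps - Ci * RtoC gam + RtoC (w t) * (RtoC eps + Ci * RtoC gam - (RtoC eps - Ci * RtoC gam)) = V + RtoC a)%C).
    { unfold V, w, c. apply C_ext; unfold Re, Im; simpl; field. }
    rewrite EW. replace (V + RtoC a - RtoC a)%C with V by ring.
    assert (EE : Cexp (V * RtoC u) = (Cexp (- (RtoC a * RtoC u)) * Cexp ((V + RtoC a) * RtoC u))%C).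
    { rewrite <- Cexp_add. f_equal. ring. }
    rewrite EE.
    replace (Ci * RtoC (gam * cos t) + RtoC 0 * RtoC (- (gam * sin t)))%C with (RtoC (cos t / 2) * (RtoC eps + Ci * RtoC gam - (RtoC eps - Ci * RtoC gam)))%C.
    2:{ apply C_ext; unfold Re, Im; simpl; field. }
    unfold Cdiv. Ceq_type. ring. }
  replace (I - RtoC (2 * PI) * Ci * Cexp (RtoC a * RtoC u))%C with
    (Cexp (RtoC a * RtoC u) * (Cexp (- (RtoC a * RtoC u)) * I - RtoC (2 * PI) * Ci))%C.
  2:{ assert (E1 : (Cexp (RtoC a * RtoC u) * Cexp (- (RtoC a * RtoC u)) = 1)%C).
      { rewrite <- Cexp_add. replace (RtoC a * RtoC u + - (RtoC a * RtoC u))%C with (RtoC 0) by ring. apply Cexp_0. }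
      transitivity ((Cexp (RtoC a * RtoC u) * Cexp (- (RtoC a * RtoC u))) * I - RtoC (2 * PI) * Ci * Cexp (RtoC a * RtoC u))%C. ring.
      rewrite E1. ring. }
  rewrite Cmod_mult, Cmod_Cexp. replace (Re (RtoC a * RtoC u)) with (a * u) by (unfold Re; simpl; ring).
  assert (Hea := exp_pos (a * u)). assert (Hug : 0 < u * gam) by (apply Rmult_lt_0_compat; auto).
  apply Rle_trans with (exp (a * u) * (4 * exp (c * u) / (u * gam) + 2 * (2 + PI) / (u * gam))).
  { apply Rmult_le_compat_l; lra. }
  assert (EC : exp (a * u) * exp (c * u) = exp (eps * u)). { rewrite <- exp_plus. f_equal. unfold c. ring. }
  assert (E1 : exp (a * u) <= 1). { rewrite <- exp_0. destruct (Rle_lt_or_eq_dec (a * u) 0) as [K|K]. nra. left; now apply exp_increasing. rewrite K; lra. }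
  replace (exp (a * u) * (4 * exp (c * u) / (u * gam) + 2 * (2 + PI) / (u * gam))) with
    ((4 * (exp (a * u) * exp (c * u)) + 2 * (2 + PI) * exp (a * u)) / (u * gam)) by (field; lra).
  rewrite EC. apply Rmult_le_compat_r. left; now apply Rinv_0_lt_compat.
  apply Rplus_le_compat_l. rewrite <- (Rmult_1_r (2 * (2 + PI))) at 2. apply Rmult_le_compat_l; lra.
Qed.

(** * Residues and the inversion integral *)

(** On the circle the velocity is [i (v - p)], so the contour integral of [f] is [i] times the
    integral of [h], to which the mean value property applies with [p] as the only exceptional
    point. *)
Lemma is_residue_simple_pole (f h : C -> C) (p : C) (r1 : R) : 0 < r1 ->
  (forall v, 0 < Cmod (v - p) < r1 -> shol f v) ->
  (forall v, 0 < Cmod (v - p) < r1 -> (f v * (v - p))%C = h v) -> Ccont h p -> is_residue f p (h p).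
Proof.
  intros Hr Hf Hh Hc. exists r1. split; auto. split.
  - intros w Hw. apply shol_ex_derive. auto.
  - intros r Hrr. unfold is_circle_int.
    assert (Hn : forall v, ~ In v (p :: nil) -> 0 < Cmod (v - p)).
    { intros v Hv. apply Cmod_gt_0, Csub_neq_0. intros ->. apply Hv. now left. }
    assert (M : isCInt (fun t => h (p + RtoC r * cis t)%C) 0 (2 * PI) (RtoC (2 * PI) * h p)%C).
    { apply (mean_value_continuous h p r r1 (p :: nil) Hrr).
      - intros v Hv Hi. specialize (Hn v Hi). apply shol_ext_loc with (fun v => f v * (v - p))%C.
        + generalize (filter_and _ _ (locally_Cmod_lt p v r1 Hv) (locally_not_In (p :: nil) v Hi)).
          apply filter_imp. intros y [Y1 Y2]. apply Hh. split; auto. apply Cmod_gt_0, Csub_neq_0. intros ->. apply Y2. now left.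
        + apply shol_mult. apply Hf; auto. apply shol_minus. apply shol_id. apply shol_const.
      - intros v [<-|[]] _. exact Hc. }
    replace (RtoC (2 * PI) * Ci * h p)%C with (Ci * (RtoC (2 * PI) * h p))%C by ring.
    generalize (isCInt_scal Ci _ _ _ _ M). apply isCInt_ext. intros t _.
    fold (cis t). assert (E := Cmod_circle p r t ltac:(lra)).
    rewrite <- Hh by (rewrite E; lra).
    Ceq_type. ring.
Qed.

Lemma segment_int_ex (f : C -> C) (eps gam : R) : (forall v, Re v = eps -> Ccont f v) ->
  exists I, vertical_int f eps gam I.
Proof.
  intros Hf. apply ex_isCInt. intros t _. apply Ccont_mult; [|apply Ccont_const].
  apply (Ccont_comp (fun t : R => vpoint eps gam t)%C f).
  - apply Ccont_plus. apply Ccont_const. apply Ccont_mult. apply Ccont_RtoC_id. apply Ccont_const.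
  - apply Hf. unfold Re; simpl; ring.
Qed.

Lemma segment_Re (eps gam t : R) : Re (vpoint eps gam t) = eps.
Proof. unfold Re; simpl; ring. Qed.

Lemma segment_int_bound (f : C -> C) (eps gam M : R) (I : C) : 0 < gam -> (forall v, Re v = eps -> Cmod (f v) <= M) ->
  vertical_int f eps gam I -> Cmod I <= 4 * gam * M.
Proof.
  intros Hg Hf HI. assert (E := isCInt_bound_const _ 0 1 I (M * (2 * gam)) Rle_0_1 HI).
  replace (4 * gam * M) with (2 * ((1 - 0) * (M * (2 * gam)))) by ring. apply E.
  intros t _. rewrite Cmod_mult.
  replace (RtoC eps + Ci * RtoC gam - (RtoC eps - Ci * RtoC gam))%C with (RtoC (2 * gam) * Ci)%C at 2.
  2:{ apply C_ext; unfold Re, Im; simpl; ring. }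
  rewrite (Cmod_mult (RtoC (2 * gam))), Cmod_R, Rabs_right by lra.
  rewrite Cmod_Ci.
  rewrite Rmult_1_r. apply Rmult_le_compat_r. lra. apply Hf. apply segment_Re.
Qed.

Lemma segment_int_plus f g p q I K : is_segment_int f p q I -> is_segment_int g p q K -> is_segment_int (fun v => f v + g v)%C p q (I + K)%C.
Proof.
  intros H1 H2. generalize (isCInt_plus _ _ _ _ _ _ H1 H2). apply isCInt_ext. intros t _.
  Ceq_type. ring.
Qed.

Lemma segment_int_scal c f p q I : is_segment_int f p q I -> is_segment_int (fun v => c * f v)%C p q (c * I)%C.
Proof.
  intros H1. generalize (isCInt_scal c _ _ _ _ H1). apply isCInt_ext. intros t _.
  Ceq_type. ring.
Qed.

Lemma segment_int_ext f g eps gam I : (forall v, Re v = eps -> f v = g v) ->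
  vertical_int f eps gam I ->
  vertical_int g eps gam I.
Proof. intros H. apply isCInt_ext. intros t _. rewrite H; auto. apply segment_Re. Qed.

Lemma segment_int_csum (f : nat -> C -> C) (I : nat -> C) p q N :
  (forall k, is_segment_int (f k) p q (I k)) -> is_segment_int (fun v => csum (fun k => f k v) N) p q (csum I N).
Proof.
  intros H. induction N as [|N IH]; simpl.
  - assert (Z := isCInt_const (RtoC 0) 0 1). replace (RtoC (1 - 0) * RtoC 0)%C with (RtoC 0) in Z by ring.
    revert Z. apply isCInt_ext. intros t _.
    Ceq_type. ring.
  - now apply segment_int_plus.
Qed.

Lemma sum_n_psum (f : nat -> R) n : sum_n f n = psum f (S n).
Proof.
  induction n as [|n IH]. rewrite sum_O. simpl. ring.
  rewrite sum_Sn, IH. reflexivity.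
Qed.

Lemma sum_n_RtoC (r : nat -> R) n : sum_n (G := C_AbelianMonoid) (fun k => RtoC (r k)) n = RtoC (sum_n r n).
Proof.
  induction n as [|n IH]. now rewrite !sum_O. rewrite !sum_Sn, IH.
  change (RtoC (sum_n r n) + RtoC (r (S n)) = RtoC (sum_n r n + r (S n)))%C. now rewrite RtoC_plus.
Qed.

Lemma is_series_RtoC (r : nat -> R) (l : R) : is_series r l ->
  is_series (K := C_AbsRing) (V := C_NormedModule) (fun k => RtoC (r k)) (RtoC l).
Proof.
  intros H. change (filterlim (sum_n (G := C_AbelianMonoid) (fun k => RtoC (r k))) eventually (locally (T := C_UniformSpace) (RtoC l))).
  intros P HP. apply locally_Cmod in HP. destruct HP as [d [Hd HP]].
  assert (K := H (ball l (mkposreal d Hd)) (locally_ball _ _)). unfold filtermap in *. revert K. apply filter_imp. intros n Hn.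
  apply HP. rewrite sum_n_RtoC, <- RtoC_minus, Cmod_R. exact Hn.
Qed.

Lemma psum_le f g N : (forall k, (k < N)%nat -> f k <= g k) -> psum f N <= psum g N.
Proof. induction N; intros H; simpl. lra. assert (psum f N <= psum g N) by auto. assert (f N <= g N) by auto. lra. Qed.

Lemma Cmod_csum f N : Cmod (csum f N) <= psum (fun k => Cmod (f k)) N.
Proof. induction N; simpl. rewrite Cmod_0; lra. eapply Rle_trans. apply Cmod_triangle. lra. Qed.

Lemma csum_minus f g N : csum (fun k => f k - g k)%C N = (csum f N - csum g N)%C.
Proof. induction N; simpl. ring. rewrite IHN. ring. Qed.

Lemma csum_RtoC f N : csum (fun k => RtoC (f k)) N = RtoC (psum f N).
Proof. induction N; simpl. reflexivity. now rewrite IHN, RtoC_plus. Qed.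

(** * Assembling the residue expansion *)

Section Inversion.
Variables (b z u : R) (nu : nat -> R).
Hypothesis hb : 0 < b.
Hypothesis hz : 0 < z.
Hypothesis hu : 0 < u.
Hypothesis hnu : zeros_of_Phi b z nu.

Let Q := Phi_den b z.
Let P := Phi_num b z.
Let d := eig_weight b z nu.
Let KK := pf_rem b z nu.
Let p := pw b z.
Let p_pos : 0 < p. Proof. apply pw_pos. Qed.
Let h0 : R := Re (RtoC p * (P 0 / (RtoC b * Q 0)))%C.
Let neg k : nu k < 0. Proof. apply (nu_neg b z nu hnu). Qed.
Let dpos k : 0 < d k. Proof. apply (eig_weight_pos b z nu hb hz hnu). Qed.
Let Q0 : Q 0 <> 0%R. Proof. apply (nonneg_not_zero b z nu hb hnu 0). lra. Qed.
Let nb : RtoC b <> 0%R. Proof. intros E; injection E; lra. Qed.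
Let np : RtoC p <> 0%R. Proof. intros E; injection E; lra. Qed.

(** The coefficient of [1 / v - 1 / (v - nu k)] in the expansion of [G]. These numbers are positive
    and sum to the residue at 0. *)
Definition residue_coef (k : nat) : R := b / p * (d k / (nu k * nu k)).
Definition residue_at (k : nat) : R := - residue_coef k * exp (nu k * u).

Lemma residue_coef_pos k : 0 < residue_coef k.
Proof.
  assert (H := neg k). assert (H' := dpos k). unfold residue_coef. apply Rmult_lt_0_compat.
  now apply Rdiv_lt_0_compat. apply Rdiv_lt_0_compat; auto. nra.
Qed.

Lemma psum_residue_coef N : psum residue_coef N = b / p * psum (fun k => d k / (nu k * nu k)) N.
Proof. unfold residue_coef. now rewrite psum_scal. Qed.

Lemma G_eq v : G b z v = (P v / (v * Q v))%C.
Proof.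
  unfold G. rewrite <- RtoC_plus, !Phi_Fdd by lra. reflexivity.
Qed.

Lemma right_not_zero v : 0 <= Re v -> Q v <> 0%R.
Proof.
  intros H E. apply (zero_iff b z nu hb hnu) in E. destruct E as [k ->]. unfold Re in H; simpl in H. generalize (neg k); lra.
Qed.

Lemma right_distance v k : 0 <= Re v -> - nu k <= Cmod (RtoC (nu k) - v).
Proof.
  intros H. eapply Rle_trans. 2: apply Rabs_Re_le. unfold Re in *; simpl. rewrite Rabs_left1; generalize (neg k); lra.
Qed.

(** For [Re v >= 0] one has [|nu k - v| >= |nu k|], so each further term is at most its value at
    0. *)
Lemma pf_rem_split N M v : (N <= M)%nat -> 0 <= Re v ->
  Cmod (KK N v) <= Cmod (KK M v) + (psum (fun k => d k / (nu k * nu k)) M - psum (fun k => d k / (nu k * nu k)) N).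
Proof.
  intros H Hv. induction H as [|M H IH]. lra.
  simpl psum. assert (E : Cmod (KK M v) <= Cmod (KK (S M) v) + d M / (nu M * nu M)).
  { assert (E1 : KK M v = (KK (S M) v + RtoC (d M / nu M) / (RtoC (nu M) - v))%C).
    { unfold KK, pf_rem. simpl. fold d. ring. }
    rewrite E1. eapply Rle_trans. apply Cmod_triangle. apply Rplus_le_compat_l.
    assert (Hd := right_distance v M Hv). assert (Hn := neg M). assert (Hp := dpos M).
    rewrite Cmod_div, Cmod_R. 2:{ apply Cmod_gt_0. lra. }
    unfold Rdiv at 2. rewrite Rabs_mult, Rabs_inv, (Rabs_right (d M)), (Rabs_left (nu M)) by lra.
    apply Rle_trans with (d M * / - nu M * / - nu M).
    - apply Rmult_le_compat_l. apply Rmult_le_pos. lra. left; apply Rinv_0_lt_compat; lra. apply Rinv_le_contravar; lra.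
    - right. field. lra. }
  lra.
Qed.

(** Harnack's inequality is effective only well inside the circle, whereas a bound on the whole
    vertical line is wanted. Since the remainders tend to 0 at [v], the remainder there is bounded
    by the tail of values at 0, and that tail is at most the remainder at 0. *)
Lemma pf_rem_right_bound n v : 0 <= Re v -> Cmod (KK (S n) v) <= Cmod (KK (S n) 0).
Proof.
  intros Hv. apply Rle_trans with (Re (KK (S n) 0)). 2:{ eapply Rle_trans. apply Rle_abs. apply Rabs_Re_le. }
  apply Rnot_lt_le. intros K.
  destruct (pf_rem_lim b z nu hb hz hnu v ((Cmod (KK (S n) v) - Re (KK (S n) 0)) / 2) (right_not_zero v Hv)) as [M HM]; [lra|].
  specialize (HM (S (max n M)) ltac:(lia)). fold KK in HM.
  assert (S1 := pf_rem_split (S n) (S (max n M)) v ltac:(lia) Hv).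
  assert (S2 := residue_sum_bound b z nu hb hz hnu (max n M)). fold P Q d p h0 in S2.
  assert (S3 := Re_pf_rem_real b z nu hnu (S n) 0 (Rle_refl 0)). fold KK P Q d p h0 in S3.
  rewrite (psum_ext _ (fun k => d k / (nu k * nu k))) in S3.
  2:{ intros k _. f_equal. ring. }
  lra.
Qed.

Lemma is_residue_at_0 : is_residue (fun v => Cexp (v * RtoC u) * G b z v)%C 0%R (P 0 / Q 0)%C.
Proof.
  set (h := fun v => (Cexp (v * RtoC u) * P v / Q v)%C).
  assert (Hz : forall v, 0 < Cmod (v - 0) < - nu 0%nat -> Q v <> 0%R).
  { intros v Hv E. apply (zero_iff b z nu hb hnu) in E. destruct E as [k ->].
    replace (RtoC (nu k) - 0)%C with (RtoC (nu k)) in Hv by ring.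
    rewrite Cmod_R, Rabs_left in Hv by auto. destruct k as [|k]. lra.
    assert (nu (S k) < nu 0%nat) by (apply (nu_decr b z nu hnu); lia). lra. }
  assert (Hn : forall v, 0 < Cmod (v - 0) -> v <> 0%R).
  { intros v Hv ->. replace (0 - 0)%C with (RtoC 0) in Hv by ring. rewrite Cmod_0 in Hv. lra. }
  replace (P 0 / Q 0)%C with (h 0%R).
  2:{ unfold h. rewrite Cmult_0_l, Cexp_0. unfold Cdiv. ring. }
  apply (is_residue_simple_pole _ h 0%R (- nu 0%nat)). generalize (neg 0); lra.
  - intros v Hv. apply shol_ext_loc with (fun v => Cexp (v * RtoC u) * (P v / (v * Q v)))%C.
    { apply filter_forall. intros y. now rewrite G_eq. }
    apply shol_mult. apply shol_Cexp_scal. apply shol_div. apply (Phi_num_shol b z hb hz).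
    apply shol_mult. apply shol_id. apply (Phi_den_shol b z hb hz). apply Cmult_neq_0. apply Hn; lra. now apply Hz.
  - intros v Hv. rewrite G_eq. unfold h. assert (N1 := Hz v Hv). assert (N2 := Hn v (proj1 Hv)). field. split; auto.
  - unfold h. apply Ccont_div; auto. apply Ccont_mult. apply shol_cont, shol_Cexp_scal.
    apply shol_cont, (Phi_num_shol b z hb hz). apply shol_cont, (Phi_den_shol b z hb hz).
Qed.

(** [Phi_den v] is [v - a] times the divided difference at [v, a], which at [v = a] is the non-zero
    slope [eig_nu_slope k]; cancelling [v - a] leaves the function [h]. *)
Lemma is_residue_at_zero k : is_residue (fun v => Cexp (v * RtoC u) * G b z v)%C (RtoC (nu k)) (RtoC (residue_at k)).
Proof.
  set (a := RtoC (nu k)). assert (Hk := neg k).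
  set (h := fun v => (Cexp (v * RtoC u) * P v / (v * Fdd b z (v :: a :: nil)))%C).
  destruct (zeros_isolated b z nu hb hz hnu k) as [e [He Hz]]. fold a Q in Hz.
  assert (Na : a <> 0%R) by (intros E; injection E; lra).
  assert (ND : Fdd b z (a :: a :: nil) <> 0%R). { unfold a. rewrite Fdd_eig_nu_slope. intros E; injection E; apply (eig_nu_slope_neq_0 b z nu hb hz hnu). }
  assert (Hn : forall v, 0 < Cmod (v - a) < Rmin e (- nu k) -> Q v <> 0%R /\ v <> 0%R /\ (v - a <> 0)%C).
  { intros v [V1 V2]. assert (A1 := Rmin_l e (- nu k)). assert (A2 := Rmin_r e (- nu k)).
    assert (N1 : v <> a). { intros ->. replace (a - a)%C with (RtoC 0) in V1 by ring. rewrite Cmod_0 in V1; lra. }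
    split; [|split].
    - apply Hz; auto; lra.
    - intros ->. replace (0 - a)%C with (- a)%C in V2 by ring. unfold a in V2. rewrite Cmod_opp, Cmod_R, Rabs_left in V2; lra.
    - now apply Csub_neq_0. }
  assert (EQ : forall v, Q v = ((v - a) * Fdd b z (v :: a :: nil))%C).
  { intros v. assert (D := Fdd_diff b z v a nil hb ltac:(lra)). fold (Phi_den b z v) in D. fold (Phi_den b z a) in D.
    unfold a in D at 1. rewrite (Phi_den_nu b z nu hb hnu) in D. rewrite <- D. unfold Q. ring. }
  replace (RtoC (residue_at k)) with (h a).
  - apply (is_residue_simple_pole _ h a (Rmin e (- nu k))). apply Rmin_glb_lt; lra.
    + intros v Hv. destruct (Hn v Hv) as [N1 [N2 N3]]. apply shol_ext_loc with (fun v => Cexp (v * RtoC u) * (P v / (v * Q v)))%C.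
      { apply filter_forall. intros y. now rewrite G_eq. }
      apply shol_mult. apply shol_Cexp_scal. apply shol_div. apply (Phi_num_shol b z hb hz).
      apply shol_mult. apply shol_id. apply (Phi_den_shol b z hb hz). now apply Cmult_neq_0.
    + intros v Hv. destruct (Hn v Hv) as [N1 [N2 N3]]. rewrite G_eq. unfold h. rewrite EQ.
      assert (N4 : Fdd b z (v :: a :: nil) <> 0%R). { intros E. apply N1. rewrite EQ, E. ring. }
      field. repeat split; auto.
    + unfold h. apply Ccont_div. apply Ccont_mult. apply shol_cont, shol_Cexp_scal. apply shol_cont, (Phi_num_shol b z hb hz).
      apply Ccont_mult. apply Ccont_id. apply Fdd_cont_head; auto; lra. now apply Cmult_neq_0.
  - unfold h. assert (D := dFdd_eig_slope b z nu hb hz k). fold a in D. rewrite (dFdd_Phi_num b z hb hz) in D. fold P in D.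
    assert (HD := eig_nu_slope_neq_0 b z nu hb hz hnu k).
    assert (EP : P a = RtoC (eig_slope b z nu k * b / nu k)).
    { rewrite RtoC_div, RtoC_mult by lra. rewrite <- D, RtoC_inv by lra. fold a. field. split; auto. }
    replace (Fdd b z (a :: a :: nil)) with (RtoC (eig_nu_slope b z nu k)) by (unfold a; now rewrite Fdd_eig_nu_slope).
    assert (EE : Cexp (a * RtoC u) = RtoC (exp (nu k * u))).
    { unfold a. rewrite <- RtoC_mult. unfold Cexp, Re, Im; simpl. rewrite cos_0, sin_0. apply C_ext; unfold Re, Im; simpl; ring. }
    rewrite EE, EP. unfold a. rewrite <- !RtoC_mult, <- RtoC_div by (apply Rmult_integral_contrapositive_currified; lra).
    f_equal. unfold residue_at, residue_coef, d, eig_weight. fold p. field. repeat split; auto; lra.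
Qed.

(** [exp (nu k * u) <= 1], so the residues are dominated by [residue_coef], whose partial sums are
    bounded through [residue_sum_bound]. *)
Lemma residue_sums_converge : exists l, is_series residue_at l.
Proof.
  assert (H1 : ex_series residue_coef).
  { destruct (ex_finite_lim_seq_incr (sum_n residue_coef) (b / p * h0)) as [l Hl].
    - intros n. rewrite sum_Sn. change (sum_n residue_coef n <= sum_n residue_coef n + residue_coef (S n)). generalize (residue_coef_pos (S n)); lra.
    - intros n. rewrite sum_n_psum, psum_residue_coef. apply Rmult_le_compat_l. left; now apply Rdiv_lt_0_compat.
      apply (residue_sum_bound b z nu hb hz hnu).
    - exists l. exact Hl. }
  destruct (ex_series_le (K := R_AbsRing) (V := R_CompleteNormedModule) residue_at residue_coef) as [l Hl]; auto.
  { intros k. change (Rabs (residue_at k) <= residue_coef k). unfold residue_at. assert (Hc := residue_coef_pos k). assert (Hp := exp_pos (nu k * u)).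
    rewrite Ropp_mult_distr_l_reverse, Rabs_Ropp, Rabs_right by nra.
    assert (exp (nu k * u) <= 1). { rewrite <- exp_0. left. apply exp_increasing. generalize (neg k). nra. } nra. }
  exists l. exact Hl.
Qed.

(** Dividing the expansion by [v] uses [nu / (v (nu - v)) = 1 / v - 1 / (v - nu)]. The pole at 0 is
    written [v - RtoC 0] to match [bromwich_kernel] with [a = 0]. *)
Lemma G_expansion N v : 0 < Re v ->
  G b z v = (csum (fun k => RtoC (residue_coef k) * (/ (v - RtoC 0) - / (v - RtoC (nu k)))) N + RtoC (b / p) * (KK N v / v))%C.
Proof.
  intros Hv. assert (HQ := right_not_zero v ltac:(lra)).
  assert (Nv : v <> 0%R). { intros ->. unfold Re in Hv; simpl in Hv. lra. }
  assert (Nk : forall k, (RtoC (nu k) - v <> 0)%C).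
  { intros k. apply Csub_neq_0. intros <-. apply HQ. apply (Phi_den_nu b z nu hb hnu). }
  rewrite G_eq. unfold KK, pf_rem. fold P Q d p.
  assert (E : csum (fun k => RtoC (residue_coef k) * (/ (v - RtoC 0) - / (v - RtoC (nu k))))%C N =
    (RtoC (b / p) * / v * csum (fun k => RtoC (d k / nu k) / (RtoC (nu k) - v)) N)%C).
  { rewrite <- csum_scal. apply csum_ext. intros k _. assert (Hk := neg k). unfold residue_coef.
    assert (N1 : RtoC (nu k) <> 0%R) by (intros E; injection E; lra).
    assert (N2 : (v - RtoC (nu k) <> 0)%C). { intros E. apply (Nk k). replace (RtoC (nu k) - v)%C with (- (v - RtoC (nu k)))%C by ring. rewrite E; ring. }
    replace (b / p * (d k / (nu k * nu k))) with (b / p * (d k / nu k) * / nu k) by (field; split; lra).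
    rewrite !RtoC_mult, RtoC_inv by lra.
    field. repeat split; auto. }
  rewrite E, RtoC_div by lra. field. repeat split; auto.
Qed.

(** Both estimates are one: the second difference is [b / p] times the remainder at 0. *)
Lemma partial_fraction_limits e : 0 < e -> exists N, forall n, (N <= n)%nat ->
  Cmod (KK n 0) <= e /\ Cmod (P 0 / Q 0 - RtoC (psum residue_coef n)) <= b / p * e.
Proof.
  intros He. destruct (pf_rem_lim b z nu hb hz hnu 0%R e Q0 He) as [N HN]. exists N. intros n Hn.
  specialize (HN n Hn). fold KK in HN. split; auto.
  replace (P 0 / Q 0 - RtoC (psum residue_coef n))%C with (RtoC (b / p) * KK n 0)%C.
  - rewrite Cmod_mult, Cmod_R, Rabs_right. 2:{ left. now apply Rdiv_lt_0_compat. }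
    apply Rmult_le_compat_l; auto. left. now apply Rdiv_lt_0_compat.
  - unfold KK, pf_rem. fold P Q d p.
    rewrite (csum_ext _ (fun k => RtoC (d k / (nu k * nu k)))).
    + rewrite csum_RtoC, psum_residue_coef, RtoC_mult, RtoC_div by lra. field. repeat split; auto.
    + intros k _. assert (Hk := neg k). replace (RtoC (nu k) - 0)%C with (RtoC (nu k)) by ring.
      rewrite <- RtoC_div by lra. f_equal. field. lra.
Qed.

Definition bromwich_const (eps : R) : R := (4 * exp (eps * u) + 2 * (2 + PI)) / u.

(** Here [gam] is fixed while the number of fractions grows. The kernel errors add up to at most the
    stated bound for every truncation, since the coefficients have sum at most [b / p * h0]; the
    remainder and the two truncated sums contribute only multiples of an arbitrary [e]. *)
Lemma bromwich_bound (l eps gam : R) (I : C) : is_series residue_at l -> 0 < eps -> 0 < gam ->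
  vertical_int (fun v => Cexp (v * RtoC u) * G b z v)%C eps gam I ->
  Cmod (I - RtoC (2 * PI) * Ci * (P 0 / Q 0 + RtoC l)) <= b / p * h0 * (2 * bromwich_const eps) / gam.
Proof.
  intros Hl He Hg HI. assert (HP := PI_RGT_0).
  assert (Hbp : 0 < b / p) by now apply Rdiv_lt_0_compat.
  assert (Hk1 : forall a, a <= 0 -> exists K, vertical_int (fun v => Cexp (v * RtoC u) * / (v - RtoC a))%C eps gam K).
  { intros a Ha. apply segment_int_ex. intros v Hv. apply Ccont_mult. apply shol_cont, shol_Cexp_scal.
    apply Ccont_inv. apply Ccont_minus. apply Ccont_id. apply Ccont_const.
    intros E. apply (f_equal Re) in E. unfold Re in *. simpl in E. lra. }
  destruct (Hk1 0 ltac:(lra)) as [I0 HI0].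
  assert (Hbc : forall a K, a <= 0 -> vertical_int (fun v => Cexp (v * RtoC u) * / (v - RtoC a))%C eps gam K ->
     Cmod (K - RtoC (2 * PI) * Ci * Cexp (RtoC a * RtoC u)) <= bromwich_const eps / gam).
  { intros a K Ha HK. eapply Rle_trans. apply (bromwich_kernel a eps u gam K Ha He hu Hg HK).
    right. unfold bromwich_const. field. split; lra. }
  (* Total integrals serve as witnesses, which yields a sequence of values and not merely an
     existence statement for each [k]. *)
  assert (Hik : forall k, { K : C | vertical_int (fun v => Cexp (v * RtoC u) * / (v - RtoC (nu k)))%C eps gam K }).
  { intros k. set (ff := fun t : R => (Cexp (vpoint eps gam t * RtoC u)
       * / (vpoint eps gam t - RtoC (nu k))
       * (RtoC eps + Ci * RtoC gam - (RtoC eps - Ci * RtoC gam)))%C).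
    exists (RInt (fun t => Re (ff t)) 0 1, RInt (fun t => Im (ff t)) 0 1).
    destruct (Hk1 (nu k) ltac:(left; auto)) as [K HK]. assert (HK' := HK). change (isCInt ff 0 1 K) in HK'. apply isCInt_pair in HK'.
    destruct HK' as [K1 K2]. rewrite (is_RInt_unique _ _ _ _ K1), (is_RInt_unique _ _ _ _ K2).
    replace (Re K, Im K) with K by (now destruct K). exact HK. }
  set (Ik := fun k => proj1_sig (Hik k)). assert (HIk := fun k => proj2_sig (Hik k)). cbv beta in HIk. fold (Ik) in HIk.
  assert (B0 := Hbc 0 I0 ltac:(lra) HI0). rewrite Cmult_0_l, Cexp_0 in B0.
  assert (HN : forall e, 0 < e -> Cmod (I - RtoC (2 * PI) * Ci * (P 0 / Q 0 + RtoC l)) <=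
      b / p * h0 * (2 * bromwich_const eps) / gam + (4 * gam * (exp (eps * u) * (b / p * (e / eps))) + 2 * PI * (b / p * e + e))).
  { intros e Hep.
    destruct (partial_fraction_limits e Hep) as [N1 HN1].
    assert (Hs := Hl (ball l (mkposreal e Hep)) (locally_ball _ _)). destruct Hs as [N2 HN2].
    set (n := max N1 N2). specialize (HN1 (S n) ltac:(lia)). specialize (HN2 n ltac:(lia)).
    change (Rabs (sum_n residue_at n - l) < e) in HN2. rewrite sum_n_psum in HN2.
    destruct HN1 as [L1 L2].
    (* [JN] is the integral of the truncated expansion; [LN] below is its value when each kernel
       integral is replaced by its limit. *)
    set (JN := csum (fun k => RtoC (residue_coef k) * (I0 - Ik k))%C (S n)).
    assert (HJN : is_segment_int (fun v => csum (fun k => RtoC (residue_coef k) * (Cexp (v * RtoC u) * / (v - RtoC 0) - Cexp (v * RtoC u) * / (v - RtoC (nu k))))%C (S n)) (RtoC eps - Ci * RtoC gam)%C (RtoC eps + Ci * RtoC gam)%C JN).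
    { apply segment_int_csum. intros k. apply segment_int_scal.
      generalize (segment_int_plus _ _ _ _ _ _ HI0 (segment_int_scal (- RtoC 1) _ _ _ _ (HIk k))).
      intros Hx. replace (I0 - Ik k)%C with (I0 + - RtoC 1 * Ik k)%C by ring. revert Hx. apply segment_int_ext. intros v _. ring. }
    assert (HR := segment_int_plus _ _ _ _ _ _ HI (segment_int_scal (- RtoC 1) _ _ _ _ HJN)).
    assert (BR : Cmod (I + - RtoC 1 * JN) <= 4 * gam * (exp (eps * u) * (b / p * (e / eps)))).
    { apply (segment_int_bound _ _ _ _ _ Hg) with (2 := HR). intros v Hv.
      rewrite (G_expansion (S n)) by lra.
      match goal with |- Cmod ?X <= _ => replace X with (Cexp (v * RtoC u) * (RtoC (b / p) * (KK (S n) v / v)))%C end.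
      - assert (Hvm : eps <= Cmod v). { rewrite <- Hv. eapply Rle_trans. apply Rle_abs. apply Rabs_Re_le. }
        rewrite !Cmod_mult, Cmod_Cexp, Cmod_R, Cmod_div, (Rabs_right (b / p)) by (try lra; apply Cmod_gt_0; lra).
        replace (Re (v * RtoC u)) with (eps * u) by (rewrite <- Hv; unfold Re; simpl; ring).
        apply Rmult_le_compat_l. left; apply exp_pos. apply Rmult_le_compat_l. lra.
        apply Rmult_le_compat. apply Cmod_ge_0. left; apply Rinv_0_lt_compat; lra.
        eapply Rle_trans. apply pf_rem_right_bound; lra. exact L1. apply Rinv_le_contravar; lra.
      - rewrite (csum_ext (fun k => RtoC (residue_coef k) * (Cexp (v * RtoC u) * / (v - RtoC 0) - Cexp (v * RtoC u) * / (v - RtoC (nu k))))%C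
          (fun k => Cexp (v * RtoC u) * (RtoC (residue_coef k) * (/ (v - RtoC 0) - / (v - RtoC (nu k)))))%C) by (intros; ring).
        rewrite csum_scal. ring. }
    set (LN := csum (fun k => RtoC (residue_coef k) * (RtoC (2 * PI) * Ci * 1 - RtoC (2 * PI) * Ci * Cexp (RtoC (nu k) * RtoC u)))%C (S n)).
    assert (BJ : Cmod (JN - LN) <= b / p * h0 * (2 * bromwich_const eps) / gam).
    { unfold JN, LN. rewrite <- csum_minus. eapply Rle_trans. apply Cmod_csum.
      apply Rle_trans with (psum (fun k => 2 * bromwich_const eps / gam * residue_coef k) (S n)).
      - apply psum_le. intros k _.
        replace (RtoC (residue_coef k) * (I0 - Ik k) - RtoC (residue_coef k) * (RtoC (2 * PI) * Ci * 1 - RtoC (2 * PI) * Ci * Cexp (RtoC (nu k) * RtoC u)))%C with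
          (RtoC (residue_coef k) * ((I0 - RtoC (2 * PI) * Ci * 1) - (Ik k - RtoC (2 * PI) * Ci * Cexp (RtoC (nu k) * RtoC u))))%C by ring.
        assert (Hc := residue_coef_pos k). rewrite Cmod_mult, Cmod_R, Rabs_right, Rmult_comm by lra. apply Rmult_le_compat_r. lra.
        eapply Rle_trans. apply Cmod_triangle. rewrite Cmod_opp.
        assert (Bk := Hbc (nu k) (Ik k) ltac:(left; auto) (HIk k)).
        replace (2 * bromwich_const eps / gam) with (bromwich_const eps / gam + bromwich_const eps / gam) by (field; lra). lra.
      - rewrite psum_scal, psum_residue_coef.
        assert (Sb := residue_sum_bound b z nu hb hz hnu n). fold P Q d p h0 in Sb.
        assert (Hbc0 : 0 <= 2 * bromwich_const eps / gam).
        { generalize (Cmod_ge_0 (I0 - RtoC (2 * PI) * Ci * 1)). replace (2 * bromwich_const eps / gam) with (2 * (bromwich_const eps / gam)) by (field; lra). lra. }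
        replace (b / p * h0 * (2 * bromwich_const eps) / gam) with (2 * bromwich_const eps / gam * (b / p * h0)) by (field; split; lra).
        apply Rmult_le_compat_l; auto. apply Rmult_le_compat_l; lra. }
    assert (EL : LN = (RtoC (2 * PI) * Ci * (RtoC (psum residue_coef (S n)) + RtoC (psum residue_at (S n))))%C).
    { unfold LN. rewrite (csum_ext _ (fun k => RtoC (2 * PI) * Ci * RtoC (residue_coef k + residue_at k))%C).
      - rewrite csum_scal, csum_RtoC. f_equal. rewrite <- RtoC_plus. f_equal. generalize (S n). intros m. induction m; simpl. ring. rewrite IHm; ring.
      - intros k _. assert (EE : Cexp (RtoC (nu k) * RtoC u) = RtoC (exp (nu k * u))).
        { rewrite <- RtoC_mult. unfold Cexp, Re, Im; simpl. rewrite cos_0, sin_0. apply C_ext; unfold Re, Im; simpl; ring. }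
        rewrite EE. unfold residue_at. rewrite RtoC_plus, (RtoC_mult (- residue_coef k)), RtoC_opp. ring. }
    assert (BL : Cmod (LN - RtoC (2 * PI) * Ci * (P 0 / Q 0 + RtoC l)) <= 2 * PI * (b / p * e + e)).
    { rewrite EL. replace (RtoC (2 * PI) * Ci * (RtoC (psum residue_coef (S n)) + RtoC (psum residue_at (S n))) - RtoC (2 * PI) * Ci * (P 0 / Q 0 + RtoC l))%C with
        (RtoC (2 * PI) * Ci * (- (P 0 / Q 0 - RtoC (psum residue_coef (S n))) + (RtoC (psum residue_at (S n)) - RtoC l)))%C by ring.
      rewrite !Cmod_mult, Cmod_R, Rabs_right by lra.
      rewrite Cmod_Ci.
      rewrite Rmult_1_r. apply Rmult_le_compat_l. lra. eapply Rle_trans. apply Cmod_triangle. rewrite Cmod_opp.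
      apply Rplus_le_compat; auto. rewrite <- RtoC_minus, Cmod_R. lra. }
    replace (I - RtoC (2 * PI) * Ci * (P 0 / Q 0 + RtoC l))%C with
      ((I + - RtoC 1 * JN) + ((JN - LN) + (LN - RtoC (2 * PI) * Ci * (P 0 / Q 0 + RtoC l))))%C by ring.
    eapply Rle_trans. apply Cmod_triangle.
    assert (T := Cmod_triangle (JN - LN) (LN - RtoC (2 * PI) * Ci * (P 0 / Q 0 + RtoC l))). lra. }
  apply Rnot_lt_le. intros K.
  set (A1 := b / p * h0 * (2 * bromwich_const eps) / gam) in *. set (X := Cmod (I - RtoC (2 * PI) * Ci * (P 0 / Q 0 + RtoC l))) in *.
  (* The truncation error is [W e]; half the supposed excess is enough for a contradiction. *)
  set (W := 4 * gam * (exp (eps * u) * (b / p * / eps)) + 2 * PI * (b / p + 1)).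
  assert (HW : 0 < W).
  { unfold W. apply Rplus_lt_0_compat.
    - apply Rmult_lt_0_compat; [lra|]. apply Rmult_lt_0_compat; [apply exp_pos|].
      apply Rmult_lt_0_compat; [exact Hbp|]. now apply Rinv_0_lt_compat.
    - apply Rmult_lt_0_compat; lra. }
  assert (Y := HN ((X - A1) / (2 * W)) ltac:(apply Rdiv_lt_0_compat; lra)).
  set (e := (X - A1) / (2 * W)) in *.
  replace (4 * gam * (exp (eps * u) * (b / p * (e / eps))) + 2 * PI * (b / p * e + e)) with (W * e) in Y.
  2:{ unfold W. field. split; lra. }
  replace (W * e) with ((X - A1) / 2) in Y by (unfold e; field; lra). lra.
Qed.

Lemma inverse_laplace_G (l eps : R) : is_series residue_at l -> 0 < eps ->
  is_inverse_laplace (G b z) eps u (P 0 / Q 0 + RtoC l)%C.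
Proof.
  intros Hl He. assert (HP := PI_RGT_0).
  set (ff := fun gam t : R => (Cexp (vpoint eps gam t * RtoC u)
       * G b z (vpoint eps gam t)
       * (RtoC eps + Ci * RtoC gam - (RtoC eps - Ci * RtoC gam)))%C).
  exists (fun gam => (RInt (fun t => Re (ff gam t)) 0 1, RInt (fun t => Im (ff gam t)) 0 1)).
  assert (HJ : forall gam, vertical_int (fun v => Cexp (v * RtoC u) * G b z v)%C eps gam
     (RInt (fun t => Re (ff gam t)) 0 1, RInt (fun t => Im (ff gam t)) 0 1)).
  { intros gam. destruct (segment_int_ex (fun v => Cexp (v * RtoC u) * G b z v)%C eps gam) as [K HK].
    - intros v Hv. apply Ccont_mult. apply shol_cont, shol_Cexp_scal.
      apply continuous_ext with (fun v => P v / (v * Q v))%C. intros; now rewrite G_eq.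
      assert (HQ := right_not_zero v ltac:(lra)).
      apply Ccont_div. apply shol_cont, (Phi_num_shol b z hb hz). apply Ccont_mult. apply Ccont_id. apply shol_cont, (Phi_den_shol b z hb hz).
      apply Cmult_neq_0; auto. intros ->. unfold Re in Hv; simpl in Hv. lra.
    - assert (HK' := HK). change (isCInt (ff gam) 0 1 K) in HK'. apply isCInt_pair in HK'.
      destruct HK' as [K1 K2]. rewrite (is_RInt_unique _ _ _ _ K1), (is_RInt_unique _ _ _ _ K2).
      replace (Re K, Im K) with K by (now destruct K). exact HK. }
  split. { intros gam _. apply HJ. }
  intros Pr HPr. apply locally_Cmod in HPr. destruct HPr as [e [Hpe HPr]].
  set (A1 := b / p * h0 * (2 * bromwich_const eps)).
  exists (Rmax 1 (Rabs A1 / e)). intros gam Hgam.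
  assert (M1 := Rmax_l 1 (Rabs A1 / e)). assert (M2 := Rmax_r 1 (Rabs A1 / e)).
  assert (B := bromwich_bound l eps gam _ Hl He ltac:(lra) (HJ gam)). fold A1 in B.
  apply HPr. set (J := (RInt (fun t => Re (ff gam t)) 0 1, RInt (fun t => Im (ff gam t)) 0 1) : C) in *.
  assert (N1 : RtoC (2 * PI) <> 0%R) by (intros E; injection E; lra).
  assert (N2 : Ci <> 0%R) by (intros E; injection E; lra).
  replace (/ (RtoC (2 * PI) * Ci) * J - (P 0 / Q 0 + RtoC l))%C with
    (/ (RtoC (2 * PI) * Ci) * (J - RtoC (2 * PI) * Ci * (P 0 / Q 0 + RtoC l)))%C by (field; repeat split; auto).
  rewrite Cmod_mult, Cmod_inv, Cmod_mult, Cmod_R, Rabs_right by (try (now apply Cmult_neq_0); lra).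
  rewrite Cmod_Ci.
  set (X := Cmod (J - RtoC (2 * PI) * Ci * (P 0 / Q 0 + RtoC l))) in *.
  assert (HX : X < e).
  { apply Rle_lt_trans with (1 := B). apply Rle_lt_trans with (Rabs A1 / gam).
    - apply Rmult_le_compat_r. left; apply Rinv_0_lt_compat; lra. apply Rle_abs.
    - apply Rmult_lt_reg_r with gam. lra. unfold Rdiv. rewrite Rmult_assoc, Rinv_l, Rmult_1_r by lra.
      replace (Rabs A1) with (Rabs A1 / e * e) by (field; lra). rewrite (Rmult_comm e). apply Rmult_lt_compat_r; lra. }
  assert (Hi : / (2 * PI * 1) <= 1). { rewrite <- Rinv_1. apply Rinv_le_contravar. lra. generalize PI2_3_2. unfold PI2. lra. }
  apply Rle_lt_trans with (1 * X); [|lra]. apply Rmult_le_compat_r; auto. apply Cmod_ge_0.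
Qed.

End Inversion.

Theorem mainTheorem3 (b z u : R) (nu : nat -> R)
    (hb : 0 < b) (hz : 0 < z) (hu : 0 < u) (hnu : zeros_of_Phi b z nu) :
  exists (res0 : C) (res : nat -> C) (S : C),
    is_residue (fun v : C => (Cexp (v * RtoC u) * G b z v)%C) (RtoC 0) res0 /\
    (forall k : nat,
       is_residue (fun v : C => (Cexp (v * RtoC u) * G b z v)%C)
         (RtoC (nu k)) (res k)) /\
    is_series (K := C_AbsRing) (V := C_NormedModule) res S /\
    (forall eps : R, 0 < eps ->
       is_inverse_laplace (G b z) eps u (res0 + S)%C).
Proof.
  destruct (residue_sums_converge b z u nu hb hz hu hnu) as [l Hl].
  exists (Phi_num b z 0 / Phi_den b z 0)%C, (fun k => RtoC (residue_at b z u nu k)), (RtoC l).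
  split; [|split; [|split]].
  - apply (is_residue_at_0 b z u nu hb hz hnu).
  - intros k. apply (is_residue_at_zero b z u nu hb hz hnu).
  - now apply is_series_RtoC.
  - intros eps He. apply (inverse_laplace_G b z u nu hb hz hu hnu l eps Hl He).
Qed.
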